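(* Let $a\ge b\ge1$ be integers. Let $r_1=1/4$ and $r_n=\frac{1}{2n}$ for $n\ge2$, and set $p_n=\frac12+r_n$ for $n\ge1$. Then, as $n\to\infty$, $$\frac{|C(a,b)\cap[1,n]|}{2^{-a}\binom{a-1}{b-1}\log n}\xrightarrow{d}S,\qquad \frac{|C( *,a)\cap[1,n]|}{\log n}\xrightarrow{d}S,\qquad \frac{|C_w\cap[1,n]|}{2\log n}\xrightarrow{d}S,$$ where $S$ is a random variable with $\mathbb P(S>t)=e^{-t}$ for $t>0$ and $\xrightarrow{d}$ denotes convergence in distribution.
   Context: Let $p_0=1$, $q_0=0$, $q_n=1-p_n$ for $n\ge1$, and let $X=(X_k)_{k\ge0}$ be the Markov chain on $\mathbb Z_+$ with $X_0=0$, $\mathbb P(X_{k+1}=n+1\mid X_k=n)=p_n$, $\mathbb P(X_{k+1}=n-1\mid X_k=n)=q_n$. Let $\xi(x)=\sum_{k\ge0}1_{\{X_k=x\}}$ and $\xi(x,\uparrow)=\sum_{k\ge0}1_{\{X_k=x,X_{k+1}=x+1\}}$. Let $C(a,b)=\{x\in\mathbb Z_+:\xi(x)=a,\ \xi(x,\uparrow)=b\}$ and $C( *,a)=\{x\in\mathbb Z_+:\xi(x,\uparrow)=a\}$. A site $R$ is a weak cutpoint if for some $k$, $X_k=R$, $X_i\le R$ for $0\le i\le k-1$ and $X_i\ge R$ for all $i\ge k+1$; $C_w$ is the set of weak cutpoints. *)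

(* Defs.v *)
From HB Require Import structures.
From mathcomp Require Import all_boot all_order all_algebra.
From mathcomp Require Import all_classical all_reals all_analysis.
Set Implicit Arguments. Unset Strict Implicit. Unset Printing Implicit Defensive.
Import Order.TTheory GRing.Theory Num.Theory.
Import numFieldNormedType.Exports.
Local Open Scope classical_set_scope.
Local Open Scope ring_scope.

Definition pseq {R : realType} (n : nat) : R :=
  if n == 0%N then 1
  else if n == 1%N then 2^-1 + 4^-1
  else 2^-1 + (2 * n%:R)^-1.

Definition trans {R : realType} (p : nat -> R) (x y : nat) : R :=
  if y == x.+1 then p x
  else if x == y.+1 then 1 - p x
  else 0.

Fixpoint path_prob_from {R : realType} (Q : nat -> nat -> R) (x : nat) (s : seq nat) : R :=
  match s with
  | [::] => 1
  | y :: s' => Q x y * path_prob_from Q y s'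
  end.

Definition path_prob {R : realType} (Q : nat -> nat -> R) (s : seq nat) : R :=
  match s with
  | [::] => 1
  | x0 :: s' => (x0 == 0%N)%:R * path_prob_from Q x0 s'
  end.

Definition is_markov_chain_from0 {R : realType} {d : measure_display}
  {T : measurableType d} (P : probability T R) (X : nat -> T -> nat)
  (Q : nat -> nat -> R) : Prop :=
  forall s : seq nat,
    P [set w | forall i, (i < size s)%N -> X i w = nth 0%N s i] = (path_prob Q s)%:E.

Definition has_exactly (A : nat -> Prop) (m : nat) : Prop :=
  exists s : seq nat, [/\ uniq s, size s = m & forall k, A k <-> k \in s].

Definition local_time_eq {T : Type} (X : nat -> T -> nat) (w : T) (x a : nat) : Prop :=
  has_exactly (fun k => X k w = x) a.

Definition up_time_eq {T : Type} (X : nat -> T -> nat) (w : T) (x b : nat) : Prop :=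
  has_exactly (fun k => X k w = x /\ X k.+1 w = x.+1) b.

Definition weak_cutpoint {T : Type} (X : nat -> T -> nat) (w : T) (r : nat) : Prop :=
  exists k, [/\ X k w = r, (forall i, (i < k)%N -> (X i w <= r)%N)
               & (forall i, (k < i)%N -> (r <= X i w)%N)].

Definition count_in {R : realType} (Pr : nat -> Prop) (n : nat) : R :=
  \sum_(1 <= x < n.+1) (asbool (Pr x))%:R.

Definition exp1_cdf {R : realType} (t : R) : R :=
  if t < 0 then 0 else 1 - expR (- t).

Definition conv_in_dist {R : realType} {d : measure_display}
  {T : measurableType d} (P : probability T R) (Y : nat -> T -> R) (F : R -> R) : Prop :=
  forall t : R, {for t, continuous F} ->
    (fun n => P [set w | Y n w <= t]) @ \oo --> (F t)%:E.

(* Main.v *)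
Require Import Defs.
From HB Require Import structures.
From mathcomp Require Import all_boot all_order all_algebra.
From mathcomp Require Import all_classical all_reals all_analysis.
From mathcomp Require Import zify ring lra.
Import Order.TTheory GRing.Theory Num.Theory.
Import numFieldNormedType.Exports.
Local Open Scope classical_set_scope.
Local Open Scope ring_scope.

(** From site 2 on, the chain is the Doob transform of simple random walk by
    [h z = z]; hence [g] is harmonic at [z >= 2] iff [z * g z] is affine there,
    and all hitting probabilities are explicit.  Record at each site [x] the
    word of its successive exits (up or down).  A site with the one-letter
    word [up] is a strong cutpoint, and the strong cutpoints form a renewal
    set with renewal sequence [u 0 = 1], [u n = 1 / (2 n)].  If [tau n] is the
    probability that a gap exceeds [n], the renewal equation
    [\sum_(j <= n) u j * tau (n - j) = 1] and monotonicity of [tau] give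
    [tau n ~ 2 / ln n], and requiring the first [k ~ t / 2 * ln n] gaps to be
    at most [n] (resp. [n / (k + 1)]) bounds the probability of having more
    than [k] strong cutpoints up to [n] from above (resp. below) by a quantity
    tending to [exp (- t)].

    For a fixed word [v] ending with an up step, let [A n] and [S n] count the
    sites up to [n] with word [v], resp. the strong cutpoints.  The joint law
    of the words at two sites [x < y] solves a linear recursion on the words,
    which yields [P (v at x, v' at y) ~ 2 ^ - (|v| + |v'|) / (x * (y - x))],
    whence [2 ^ |v| * A n - 2 * S n] has second moment [O (ln n)].  Each of the
    three counts is a count of sites whose word lies in a given set of words
    of total mass [\sum_v 2 ^ - |v| = c]: truncating long words (a first
    moment bound) shows that the count is [2 * c * S n] up to [o (ln n)] in
    probability. *)

(** No count can be compared with a constant: the limit is not degenerate, so fluctuations are of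
    the order of the mean. Hence the comparison with another count, that of the strong cutpoints.
    The sum of [1 / (x * (y - x))] over pairs up to [n] is of order [(ln n) ^ 2]. The weights
    [2 ^ |v|] and [2 = 2 ^ 1], the latter for the one-letter word, bring the leading terms of all
    four correlations to this same quantity, so they cancel in the second moment of the difference;
    what is left has an extra factor [1 / x] or [1 / (y - x)] and sums to [O (ln n)].

    The two renewal bounds meet because [k] is only of order [ln n]: [ln (n / (k + 1)) ~ ln n], so
    shortening the allowed gap does not change [tau] to first order. Monotonicity of [tau] takes the
    place of a Tauberian theorem.

    Everything starts at site 2 because [r 1 = 1 / 4] breaks the formula [1 / (2 n)]; site 1 adds at
    most one to a count. *)

(** * Real-valued probabilities and moment inequalities for counts *)

Section RealProbability.
Context {R : realType} {d : measure_display} {T : measurableType d}.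
Variable P : probability T R.

Definition pr (A : set T) : R := fine (P A).

Lemma prE (A : set T) : measurable A -> P A = (pr A)%:E.
Proof. by move=> mA; rewrite /pr fineK// fin_num_measure. Qed.

Lemma pr_ge0 (A : set T) : 0 <= pr A.
Proof. by rewrite /pr fine_ge0. Qed.

Lemma pr_setT : pr setT = 1.
Proof. by rewrite /pr probability_setT. Qed.

Lemma pr_le (A B : set T) :
  measurable A -> measurable B -> A `<=` B -> pr A <= pr B.
Proof.
move=> mA mB AB; rewrite -lee_fin -!prE//.
by apply: le_measure => //; rewrite inE.
Qed.

Lemma pr_le1 (A : set T) : measurable A -> pr A <= 1.
Proof. by move=> mA; rewrite -pr_setT; exact: pr_le. Qed.

Lemma prU (A B : set T) : measurable A -> measurable B -> A `&` B = set0 ->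
  pr (A `|` B) = pr A + pr B.
Proof.
move=> mA mB AB; apply: EFin_inj.
rewrite EFinD -!prE//; last exact: measurableU.
by rewrite measureU.
Qed.

Lemma prDI (A B : set T) : measurable A -> measurable B ->
  pr (A `\` B) = pr A - pr (A `&` B).
Proof.
move=> mA mB; apply/esym/eqP; rewrite subr_eq; apply/eqP.
rewrite -prU; last 3 first.
- exact: measurableD.
- exact: measurableI.
- by apply/seteqP; split => x // -[[? ?] [? ?]].
by rewrite setUC setUIDK.
Qed.

Lemma pr_U_le (A B : set T) : measurable A -> measurable B ->
  pr (A `|` B) <= pr A + pr B.
Proof.
move=> mA mB; rewrite -lee_fin EFinD -!prE//; last exact: measurableU.
exact: measureU2.
Qed.

Lemma indicM_r (A B : set T) w :
  \1_A w * \1_B w = \1_(A `&` B) w :> R.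
Proof. by rewrite indicI. Qed.

(** The one place where an integral is taken. All moment bounds below are pointwise inequalities
    between finite combinations of indicators. *)
Lemma pr_comb_ge0 (I : Type) (r : seq I) (c : I -> R) (E : I -> set T) :
  (forall i, measurable (E i)) ->
  (forall w, 0 <= \sum_(i <- r) c i * \1_(E i) w) ->
  0 <= \sum_(i <- r) c i * pr (E i).
Proof.
move=> mE h.
have : (0 <= \int[P]_w (\sum_(i <- r) c i * \1_(E i) w)%:E)%E.
  by apply: integral_ge0 => w _; rewrite lee_fin.
under eq_integral do rewrite -sumEFin.
rewrite (@integral_sum _ _ _ P setT measurableT I
    (fun i w => (c i * \1_(E i) w)%:E)); last first.
  move=> i; under eq_fun do rewrite EFinM.
  by apply: integrableZl => //; exact: integrable_indic.
rewrite -lee_fin -sumEFin => /le_trans; apply.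
apply: lee_sum => i _.
under eq_integral do rewrite EFinM.
rewrite integralZl//; last exact: integrable_indic.
by rewrite integral_indic// setIT EFinM -prE.
Qed.

Lemma pr_comb_le (I J : Type) (r : seq I) (s : seq J) (c : I -> R) (e : J -> R)
  (E : I -> set T) (F : J -> set T) :
  (forall i, measurable (E i)) -> (forall j, measurable (F j)) ->
  (forall w, \sum_(i <- r) c i * \1_(E i) w <= \sum_(j <- s) e j * \1_(F j) w) ->
  \sum_(i <- r) c i * pr (E i) <= \sum_(j <- s) e j * pr (F j).
Proof.
move=> mE mF h.
(* Both sides become a single signed combination indexed by [I + J], so that positivity suffices. *)
pose X := [seq (inl i : I + J) | i <- r] ++ [seq inr j | j <- s].
pose k (x : I + J) := match x with inl i => - c i | inr j => e j end.
pose K (x : I + J) := match x with inl i => E i | inr j => F j end.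
have key (f : set T -> R) : \sum_(x <- X) k x * f (K x) =
    \sum_(j <- s) e j * f (F j) - \sum_(i <- r) c i * f (E i).
  rewrite /X big_cat !big_map /= addrC; congr +%R.
  by rewrite -sumrN; apply: eq_bigr => i _; rewrite mulNr.
rewrite -subr_ge0 -key; apply: pr_comb_ge0 => [[i|j]|w] //=.
by rewrite (key (fun A => \1_A w)) subr_ge0.
Qed.

Lemma pr_count_markov (I : Type) (r : seq I) (E : I -> set T) (lam : R)
  (B : set T) : 0 < lam -> (forall i, measurable (E i)) -> measurable B ->
  (forall w, B w -> lam <= \sum_(i <- r) \1_(E i) w) ->
  pr B <= (\sum_(i <- r) pr (E i)) / lam.
Proof.
move=> lam0 mE mB h; rewrite ler_pdivlMr// mulrC.
have := @pr_comb_le unit I [:: tt] r (fun=> lam) (fun=> 1) (fun=> B) E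
  (fun=> mB) mE.
rewrite big_seq1 => H.
have -> : \sum_(i <- r) pr (E i) = \sum_(i <- r) 1 * pr (E i).
  by apply: eq_bigr => i _; rewrite mul1r.
apply: H => w; rewrite big_seq1; under eq_bigr do rewrite mul1r.
rewrite indicE; case: (boolP (w \in B)) => [/set_mem/h|_]; rewrite ?mulr1//.
by rewrite mulr0; apply: sumr_ge0 => i _; rewrite indicE.
Qed.

(** The second moment is not centred: it is applied to a difference of counts whose leading parts
    cancel, not to a count minus its mean. *)
Lemma pr_comb_chebyshev (I : Type) (r : seq I) (c : I -> R) (E : I -> set T)
  (lam : R) (B : set T) : 0 < lam -> (forall i, measurable (E i)) ->
  measurable B ->
  (forall w, B w -> lam <= `|\sum_(i <- r) c i * \1_(E i) w|) ->
  pr B <= (\sum_(i <- r) \sum_(j <- r) c i * c j * pr (E i `&` E j)) / lam ^+ 2.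
Proof.
move=> lam0 mE mB h; rewrite ler_pdivlMr ?exprn_gt0// mulrC.
have := @pr_comb_le unit (I * I) [:: tt] [seq (i, j) | i <- r, j <- r]
  (fun=> lam ^+ 2) (fun x => c x.1 * c x.2) (fun=> B)
  (fun x => E x.1 `&` E x.2) (fun=> mB).
rewrite big_seq1 big_allpairs_dep /=; apply; first by move=> x; exact: measurableI.
move=> w; rewrite big_seq1 big_allpairs_dep /=.
have -> : \sum_(i <- r) \sum_(j <- r) c i * c j * \1_(E i `&` E j) w =
    (\sum_(i <- r) c i * \1_(E i) w) ^+ 2.
  rewrite expr2 mulr_suml; apply: eq_bigr => i _.
  rewrite mulr_sumr; apply: eq_bigr => j _.
  by rewrite -indicM_r mulrACA.
rewrite indicE; case: (boolP (w \in B)) => [/set_mem/h hw|_].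
  by rewrite mulr1 -(real_normK (num_real (\sum_(i <- r) _))) lerXn2r// nnegrE// ltW.
by rewrite mulr0 sqr_ge0.
Qed.

Lemma pr_bigsetU_disj (F : nat -> set T) (m n : nat) :
  (forall i, measurable (F i)) ->
  (forall i j w, (m <= i)%N -> (m <= j)%N -> F i w -> F j w -> i = j) ->
  pr (\bigcup_(i in [set i | (m <= i < n)%N]) F i) = \sum_(m <= i < n) pr (F i).
Proof.
move=> mF dF; have mU D : measurable (\bigcup_(i in D) F i).
  by apply: bigcup_measurable.
elim: n => [|n IH].
  rewrite big_geq// (_ : \bigcup_(i in _) F i = set0) /pr ?measure0//.
  by apply/seteqP; split => // w [i] /=; lia.
have [mn|nm] := leqP m n; last first.
  rewrite big_geq// (_ : \bigcup_(i in _) F i = set0) /pr ?measure0//.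
  by apply/seteqP; split => // w [i] /=; lia.
rewrite big_nat_recr//= -IH -prU//; last first.
  apply/seteqP; split => // w [[i /= hi Fi] Fn].
  by move: (hi); rewrite (dF i n w _ mn Fi Fn); lia.
congr pr; apply/seteqP; split => w.
  move=> [i /= hi Fi]; have [ein|ni] := eqVneq i n; first by right; rewrite -ein.
  by left; exists i => //=; lia.
by move=> [[i /= hi Fi]|Fn]; [exists i => //=; lia|exists n => //=; lia].
Qed.

(** The sets [D n] of points where [A m] and [B] still disagree for some [m >= n] decrease to the
    empty set, and they contain the symmetric difference of [A n] and [B]. *)
Lemma pr_cvg_eventually (A : nat -> set T) (B : set T) :
  (forall n, measurable (A n)) -> measurable B ->
  (forall w, exists M, forall n, (M <= n)%N -> A n w <-> B w) ->
  pr (A n) @[n --> \oo] --> pr B.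
Proof.
move=> mA mB h.
pose D n := \bigcup_(m in [set m | (n <= m)%N]) (A m `\` B `|` B `\` A m).
have mD n : measurable (D n).
  by apply: bigcup_measurable => m _; apply: measurableU; exact: measurableD.
have D0 : \bigcap_n D n = set0.
  apply/seteqP; split => // w hw; have [M hM] := h w.
  have [m /= Mm] := hw M I; have [h1 h2] := hM m Mm.
  by move=> [[/h1 ? ?]|[/h2 ? ?]].
have cD : pr (D n) @[n --> \oo] --> (0:R).
  have : (P \o D) x @[x --> \oo] --> P (\bigcap_n D n).
    apply: nonincreasing_cvg_mu => //.
    - by apply: le_lt_trans (ltry 1); exact: probability_le1.
    - exact: bigcap_measurable.
    - move=> n m nm; apply/subsetPset => w [j /= hj Hj].
      by exists j => //=; lia.
  rewrite D0 measure0 => /fine_cvgP[_]; exact.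
apply/cvgrPdist_le => e e0.
move/cvgrPdist_le : cD => /(_ e e0).
apply: filterS => n; rewrite sub0r normrN ger0_norm ?pr_ge0// => Dn.
apply: le_trans Dn.
have AD : A n `\` B `<=` D n by move=> w hw; exists n => //=; left.
have BD : B `\` A n `<=` D n by move=> w hw; exists n => //=; right.
have e1 := prDI _ _ (mA n) mB; have e2 := prDI _ _ mB (mA n).
have l1 := pr_le _ _ (measurableD (mA n) mB) (mD n) AD.
have l2 := pr_le _ _ (measurableD mB (mA n)) (mD n) BD.
move: e2; rewrite setIC => e2.
have := pr_ge0 (A n `\` B); have := pr_ge0 (B `\` A n).
by rewrite ler_norml; lra.
Qed.

Lemma pr_bigcup_le (F : nat -> set T) (c : R) : (forall i, measurable (F i)) ->
  (forall n, \sum_(0 <= i < n) pr (F i) <= c) -> pr (\bigcup_i F i) <= c.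
Proof.
move=> mF h; rewrite -lee_fin -prE; last exact: bigcup_measurable.
apply: (@le_trans _ _ (\sum_(0 <= i <oo) P (F i))%E).
  by apply: measure_sigma_subadditive => //; exact: bigcup_measurable.
apply: lime_le; first exact: is_cvg_nneseries.
apply: nearW => n; under eq_bigr do rewrite prE//.
by rewrite sumEFin lee_fin.
Qed.

Lemma pr_null_bigcup (F : nat -> set T) : (forall i, measurable (F i)) ->
  (forall i, pr (F i) = 0) -> pr (\bigcup_i F i) = 0.
Proof.
move=> mF h; apply/le_anti; rewrite pr_ge0 andbT.
by apply: pr_bigcup_le => // n; rewrite big1.
Qed.

End RealProbability.

Lemma sum_shift {V : nmodType} (F : nat -> V) (x n : nat) :
  \sum_(x.+1 <= y < (x + n).+1) F y = \sum_(1 <= j < n.+1) F (x + j)%N.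
Proof.
rewrite -{1}(add1n x) big_addn -addnS addKn.
by apply: eq_bigr => j _; rewrite addnC.
Qed.

(** * Renewal sets described by their joint occupation probabilities *)

Section Renewal.
Context {R : realType} {d : measure_display} {T : measurableType d}.
Variables (P : probability T R) (S : nat -> set T) (u : nat -> R).
Hypothesis mS : forall x, measurable (S x).

Definition all_in (ys : seq nat) : set T := foldr (fun y A => S y `&` A) setT ys.

Fixpoint gap_prod (x : nat) (ys : seq nat) : R :=
  if ys is y :: ys' then u (y - x) * gap_prod y ys' else 1.

Definition none_in (a b : nat) : set T :=
  [set w | forall j, (a <= j < b)%N -> ~ S j w].

Definition count_S (a b : nat) (w : T) : nat := \sum_(a <= x < b) `[< S x w >].

(* The regeneration property at [x], relative to an event [A] of the past. *)
Definition regen (x : nat) (A : set T) : Prop := measurable A /\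
  forall ys, path ltn x ys ->
    pr P (A `&` S x `&` all_in ys) = pr P (A `&` S x) * gap_prod x ys.

Lemma measurable_all_in ys : measurable (all_in ys).
Proof. by elim: ys => [|y ys IH] //=; exact: measurableI. Qed.

Lemma measurable_none_in a b : measurable (none_in a b).
Proof.
rewrite (_ : none_in a b = \bigcap_(j in [set j | (a <= j < b)%N]) ~` S j).
  by apply: bigcap_measurableType => j _; exact: measurableC.
by apply/seteqP; split => w h j /=; exact: h.
Qed.

Lemma none_in_geq a b : (b <= a)%N -> none_in a b = setT.
Proof. by move=> ba; apply/seteqP; split => // w _ j; lia. Qed.

Lemma none_in_recr a j : (a <= j)%N -> none_in a j.+1 = none_in a j `\` S j.
Proof.
move=> aj; apply/seteqP; split => w /=.
  by move=> h; split; [move=> i hi; apply: h; lia|apply: h; lia].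
move=> [h1 h2] i hi; have [->//|ij] := eqVneq i j.
by apply: h1; lia.
Qed.

Lemma count_S_recr a b w : (a <= b)%N ->
  count_S a b.+1 w = (count_S a b w + `[< S b w >])%N.
Proof. by move=> ab; rewrite /count_S big_nat_recr. Qed.

Lemma measurable_count a b (Q : nat -> Prop) :
  measurable [set w | Q (count_S a b w)].
Proof.
have mP (c : Prop) : measurable [set _ : T | c].
  have [h|h] := pselect c.
    by rewrite (_ : [set _ | _] = setT)//; apply/seteqP; split.
  by rewrite (_ : [set _ | _] = set0)//; apply/seteqP; split.
have base c Q' : (c <= a)%N -> measurable [set w | Q' (count_S a c w)].
  move=> ca; rewrite (_ : [set w | _] = [set w | Q' 0%N])//.
  by apply/seteqP; split => w /=; rewrite /count_S big_geq.
elim: b Q => [|b IH] Q; first exact: base.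
have [ab|ba] := leqP a b; last exact: base.
rewrite (_ : [set w | _] = (S b `&` [set w | Q (count_S a b w).+1]) `|`
   (~` S b `&` [set w | Q (count_S a b w)])).
  apply: measurableU; apply: measurableI => //; last exact: measurableC.
  exact: (IH (fun k => Q k.+1)).
apply/seteqP; split => w; rewrite /= count_S_recr//.
  by case: asboolP => Sb; rewrite ?addn1 ?addn0; [left|right].
by case: asboolP => Sb []; rewrite ?addn1 ?addn0 => -[].
Qed.

Let mI (A B : set T) : measurable A -> measurable B -> measurable (A `&` B).
Proof. exact: measurableI. Qed.

Lemma regen_next x y A : (x < y)%N -> regen x A -> regen y (A `&` S x).
Proof.
move=> xy [mA h]; split => [|ys hys]; first exact: mI.
have := h (y :: ys); rewrite /= xy => /(_ hys).
have := h [:: y]; rewrite /= xy setIT => /(_ isT).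
by rewrite setIA => -> ->; rewrite mulr1 mulrA.
Qed.

(** Both sides of the regeneration identity are additive in the past event, so it passes to
    differences. *)
Lemma regen_diff y j A :
  regen y A -> regen y (A `&` S j) -> regen y (A `\` S j).
Proof.
move=> [mA h1] [_ h2]; split => [|ys hys]; first exact: measurableD.
have e B : measurable B -> pr P ((A `\` S j) `&` B) =
    pr P (A `&` B) - pr P (A `&` S j `&` B).
  move=> mB; rewrite (_ : _ `&` _ = (A `&` B) `\` S j); last first.
    by apply/seteqP; split => w /=; tauto.
  by rewrite prDI//; [rewrite setIAC|exact: mI].
rewrite -setIA !e//; last by apply: mI => //; exact: measurable_all_in.
by rewrite setIA h1// [in X in _ - X]setIA h2// mulrBl.
Qed.

(** Avoiding one more site is a set difference, so the correlations on increasing sequences alone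
    give regeneration at first returns, by removing sites one at a time. *)
Lemma regen_none a A : (forall y, (a <= y)%N -> regen y A) ->
  forall j y, (a <= j <= y)%N -> regen y (A `&` none_in a j).
Proof.
move=> h; elim=> [|j IH] y hj.
  by rewrite none_in_geq ?setIT; [apply: h; lia|lia].
have [aj|ja] := leqP a j; last first.
  by rewrite none_in_geq ?setIT//; apply: h; lia.
rewrite none_in_recr// setIDA.
apply: regen_diff; first by apply: IH; lia.
by apply: regen_next; [lia|apply: IH; lia].
Qed.

Lemma none_in_first_uniq a i j w : (a <= i)%N -> (a <= j)%N ->
  none_in a i w -> S i w -> none_in a j w -> S j w -> i = j.
Proof.
move=> ai aj hi Si hj Sj; case: (ltngtP i j) => // ij; exfalso.
  by apply: (hj i) => //; lia.
by apply: (hi j) => //; lia.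
Qed.

Lemma first_exists a b w : ~ none_in a b w ->
  exists2 y, (a <= y < b)%N & none_in a y w /\ S y w.
Proof.
elim: b => [|b IH] h; first by exfalso; apply: h => j; lia.
have [ab|ba] := leqP a b; last by exfalso; apply: h => j; lia.
have [hn|/IH[y hy ?]] := pselect (none_in a b w); last by exists y => //; lia.
exists b; first lia; split=> //; apply: contrapT => Sb; apply: h.
by rewrite none_in_recr.
Qed.

Lemma last_exists a b w : ~ none_in a b w ->
  exists2 y, (a <= y < b)%N & S y w /\ none_in y.+1 b w.
Proof.
elim: b => [|b IH] h; first by exfalso; apply: h => j; lia.
have [ab|ba] := leqP a b; last by exfalso; apply: h => j; lia.
have [Sb|nSb] := pselect (S b w).
  by exists b; [lia|split => // j; lia].
have /IH[y hy [Sy ny]] : ~ none_in a b w.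
  by move=> hn; apply: h; rewrite none_in_recr.
exists y; first lia; split => //; rewrite none_in_recr//; lia.
Qed.

Lemma count_S_none a y w : none_in a y w -> count_S a y w = 0%N.
Proof.
move=> h; rewrite /count_S big_nat_cond big1// => i /andP[/h hi _].
by case: asboolP.
Qed.

Lemma count_S_first a b y w : (a <= y < b)%N -> none_in a y w -> S y w ->
  count_S a b w = (count_S y.+1 b w).+1.
Proof.
move=> hy hn Sy; rewrite /count_S (@big_cat_nat _ _ _ y)//=; [|lia..].
rewrite -/(count_S a y w) count_S_none// add0n big_ltn ?asboolT//; lia.
Qed.

Lemma first_count_decomposition A a b k : measurable A ->
  pr P (A `&` [set w | (k < count_S a b w)%N]) =
  \sum_(a <= y < b)
    pr P (A `&` none_in a y `&` S y `&` [set w | (k <= count_S y.+1 b w)%N]).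
Proof.
move=> mA; rewrite -pr_bigsetU_disj; last 2 first.
- move=> y; apply: mI; last exact: (measurable_count _ _ (fun i => _ <= i)%N).
  by apply: mI => //; apply: mI => //; exact: measurable_none_in.
- move=> i j w ai aj [[[_ hi] Si] _] [[[_ hj] Sj] _].
  exact: (none_in_first_uniq a i j w).
congr pr; apply/seteqP; split => w.
  move=> [Aw /= kw].
  have /first_exists[y hy [hn Sy]] : ~ none_in a b w.
    by move=> /count_S_none h; rewrite h in kw.
  exists y => //; split; first by split.
  by rewrite /=; rewrite (count_S_first _ _ _ _ hy hn Sy) in kw.
move=> [y /= hy [[[Aw hn] Sy] /= kw]]; split => //=.
by rewrite (count_S_first _ _ _ _ hy hn Sy).
Qed.

Lemma first_total_decomposition A a b : measurable A ->
  pr P A = pr P (A `&` none_in a b) +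
    \sum_(a <= y < b) pr P (A `&` none_in a y `&` S y).
Proof.
move=> mA; have mN i j := measurable_none_in i j.
rewrite -pr_bigsetU_disj; last 2 first.
- by move=> y; apply: mI => //; exact: mI.
- by move=> i j w ai aj [[_ hi] Si] [[_ hj] Sj]; exact: (none_in_first_uniq a i j w).
have e : A `\` none_in a b = \bigcup_(y in [set i | (a <= i < b)%N])
    (A `&` none_in a y `&` S y).
  apply/seteqP; split => w.
    by move=> [Aw /first_exists[y hy [hn Sy]]]; exists y.
  by move=> [y hy [[Aw hn] Sy]]; split => // h; exact: (h y).
by rewrite -e prDI// addrC subrK.
Qed.

Lemma last_total_decomposition A a b : measurable A ->
  pr P A = pr P (A `&` none_in a b) +
    \sum_(a <= y < b) pr P (A `&` S y `&` none_in y.+1 b).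
Proof.
move=> mA; have mN i j := measurable_none_in i j.
have e : A `\` none_in a b = \bigcup_(y in [set i | (a <= i < b)%N])
    (A `&` S y `&` none_in y.+1 b).
  apply/seteqP; split => w.
    by move=> [Aw /last_exists[y hy [hn Sy]]]; exists y.
  by move=> [y hy [[Aw hn] Sy]]; split => // h; exact: (h y).
(* For [y >= b] the event [none_in y.+1 b] is vacuous and disjointness would fail; [pr_bigsetU_disj]
   asks for it at all indices from [a] on. *)
pose F y := if (y < b)%N then A `&` S y `&` none_in y.+1 b else set0.
have eF : \sum_(a <= y < b) pr P (A `&` S y `&` none_in y.+1 b) =
    \sum_(a <= y < b) pr P (F y).
  by apply: eq_big_nat => y hy; rewrite /F ifT//; lia.
rewrite eF -pr_bigsetU_disj; last 2 first.
- by move=> y; rewrite /F; case: ifP => // _; apply: mI => //; exact: mI.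
- move=> i j w ai aj; rewrite /F; case: ifP => // ib; case: ifP => // jb.
  move=> [[_ Si] hi] [[_ Sj] hj]; case: (ltngtP i j) => // ij; exfalso.
    by apply: (hi j) => //; lia.
  by apply: (hj i) => //; lia.
rewrite (_ : \bigcup_(y in _) F y = A `\` none_in a b); last first.
  rewrite e; apply: eq_bigcupr => y /= hy; rewrite /F ifT//; lia.
by rewrite prDI// addrC subrK.
Qed.

Hypothesis u0 : u 0 = 1.
Variable x0 : nat.
Hypothesis regen_all : forall y, (x0 <= y)%N -> regen y setT.
Hypothesis pr_x0 : 0 < pr P (S x0).

(** The gap law, read at the reference site [x0]; [first_returnE] shows that it is the same at every
    regenerative site. [ret_tail] is the [tau] of the overview. *)
Definition ret (n : nat) : R :=
  pr P (S x0 `&` none_in x0.+1 (x0 + n) `&` S (x0 + n)) / pr P (S x0).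

Definition ret_tail (n : nat) : R := 1 - \sum_(1 <= j < n.+1) ret j.

Lemma ret_ge0 n : 0 <= ret n.
Proof. by rewrite divr_ge0 ?pr_ge0. Qed.

Lemma regen_first x A j y : regen x A -> (x < j <= y)%N ->
  regen y (A `&` S x `&` none_in x.+1 j).
Proof.
by move=> h hj; apply: regen_none; [move=> z hz; exact: regen_next|lia].
Qed.

Lemma regen_pair x A y : regen x A -> (x < y)%N ->
  pr P (A `&` S x `&` S y) = pr P (A `&` S x) * u (y - x).
Proof.
move=> [_ h] xy; have := h [:: y]; rewrite /= xy setIT mulr1; exact.
Qed.

Lemma renewal_equation x A n : regen x A -> (0 < n)%N ->
  pr P (A `&` S x) * u n = \sum_(1 <= j < n.+1)
    pr P (A `&` S x `&` none_in x.+1 (x + j) `&` S (x + j)) * u (n - j).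
Proof.
move=> h n0; have mA := h.1.
have -> : pr P (A `&` S x) * u n = pr P (A `&` S x `&` S (x + n)).
  by rewrite regen_pair// ?addKn//; lia.
rewrite (@first_total_decomposition _ x.+1 (x + n).+1); last by apply: mI => //; exact: mI.
rewrite (_ : _ `&` none_in _ _ = set0) ?[pr _ set0]/pr ?measure0 ?add0r; last first.
  by apply/seteqP; split => // w [[_ Sn] hn]; apply: (hn (x + n)%N) => //; lia.
rewrite sum_shift; apply: eq_big_nat => j hj.
have [->|jn] := eqVneq j n.
  rewrite subnn u0 mulr1; congr pr; apply/seteqP; split => w /=; tauto.
rewrite (_ : n - j = x + n - (x + j))%N; last lia.
rewrite -regen_pair; [|by apply: regen_first => //; lia|lia].
by congr pr; apply/seteqP; split => w /=; tauto.
Qed.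

(** The first return probabilities from [x] and from [x0] solve the same triangular system, the
    renewal equation, whose diagonal coefficient is [u 0 = 1]; strong induction on [n] identifies
    them. *)
Lemma first_returnE x A n : regen x A -> (0 < n)%N ->
  pr P (A `&` S x `&` none_in x.+1 (x + n) `&` S (x + n)) =
  pr P (A `&` S x) * ret n.
Proof.
move=> h; elim/ltn_ind: n => n IH n0.
have e1 := renewal_equation _ _ _ h n0.
have e2 := renewal_equation _ _ _ (regen_all _ (leqnn x0)) n0.
rewrite setTI in e2.
have e3 : u n = \sum_(1 <= j < n.+1) ret j * u (n - j).
  apply: (mulfI (lt0r_neq0 pr_x0)); rewrite e2 mulr_sumr.
  apply: eq_bigr => j _; rewrite /ret mulrA [_ * (_ / _)]mulrCA mulfV ?mulr1//.
  by rewrite gt_eqF.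
move: e1; rewrite [in LHS]e3 !big_nat_recr//= subnn u0 !mulr1 mulrDr mulr_sumr.
rewrite (_ : \sum_(1 <= i < n) pr P (A `&` S x) * (ret i * u (n - i)) =
  \sum_(1 <= i < n) pr P (A `&` S x `&` none_in x.+1 (x + i) `&` S (x + i)) *
     u (n - i)); first by move/addrI.
by apply: eq_big_nat => j hj; rewrite IH ?mulrA//; lia.
Qed.

Lemma no_returnE x A n : regen x A ->
  pr P (A `&` S x `&` none_in x.+1 (x + n).+1) = pr P (A `&` S x) * ret_tail n.
Proof.
move=> h; have mA := h.1.
have := @first_total_decomposition (A `&` S x) x.+1 (x + n).+1 (mI _ _ mA (mS x)).
rewrite sum_shift => e.
rewrite /ret_tail mulrBr mulr1 {1}e mulr_sumr; apply/esym/eqP; rewrite subr_eq.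
apply/eqP; congr +%R; apply: eq_big_nat => j hj.
by rewrite first_returnE//; lia.
Qed.

Lemma ret_tail_ge0 n : 0 <= ret_tail n.
Proof.
have := no_returnE _ _ n (regen_all _ (leqnn x0)); rewrite setTI => e.
by rewrite -(pmulr_rge0 _ pr_x0) -e pr_ge0.
Qed.

Lemma ret_tail_anti m n : (m <= n)%N -> ret_tail n <= ret_tail m.
Proof.
move=> mn; rewrite lerD2l lerN2 (@big_cat_nat _ _ _ m.+1 1 n.+1)//= lerDl.
by apply: sumr_ge0 => j _; exact: ret_ge0.
Qed.

Lemma ret_tail_le1 n : ret_tail n <= 1.
Proof. by rewrite gerBl sumr_ge0// => j _; exact: ret_ge0. Qed.

Lemma ret_tail_compl n : 1 - ret_tail n = \sum_(1 <= j < n.+1) ret j.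
Proof. by rewrite /ret_tail opprB addrC subrK. Qed.

(** Decomposition at the last point [x + j] of the renewal set up to [x + n]: after it comes a gap
    exceeding [n - j]. *)
Lemma last_renewalE x n : regen x setT ->
  pr P (S x) = \sum_(0 <= j < n.+1) pr P (S x) * u j * ret_tail (n - j).
Proof.
move=> h; have := @last_total_decomposition (setT `&` S x) x.+1 (x + n).+1
  (mI _ _ measurableT (mS x)).
rewrite no_returnE// setTI => e.
rewrite big_nat_recl//= u0 mulr1 subn0 [LHS]e; congr +%R.
rewrite sum_shift big_add1 /=.
apply: eq_big_nat => j hj.
have r : regen (x + j.+1) (setT `&` S x) by apply: regen_next => //; lia.
have := no_returnE _ _ (n - j.+1) r.
rewrite (_ : x + j.+1 + (n - j.+1) = x + n)%N; last lia.
by rewrite regen_pair ?setTI ?addKn//; rewrite -addSnnS leq_addr.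
Qed.

Lemma ret_tail_equation n : \sum_(0 <= j < n.+1) u j * ret_tail (n - j) = 1.
Proof.
apply: (mulfI (lt0r_neq0 pr_x0)).
rewrite mulr1 [RHS](last_renewalE _ n (regen_all _ (leqnn x0))) mulr_sumr.
by apply: eq_bigr => j _; rewrite mulrA.
Qed.

Lemma none_initE n :
  pr P (none_in x0 n.+1) =
  1 - \sum_(x0 <= y < n.+1) pr P (S y) * ret_tail (n - y).
Proof.
have := @last_total_decomposition setT x0 n.+1 measurableT.
rewrite pr_setT setTI => e; apply/esym/eqP; rewrite subr_eq e.
apply/eqP; congr +%R; apply: eq_big_nat => y hy.
have := no_returnE y setT (n - y) (regen_all y _).
by rewrite subnKC ?setTI => [->|]//; lia.
Qed.

(** If [k] further points lie within distance [n], each of the [k] gaps is at most [n]. The window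
    left after the first gap is shorter, and enlarging it back to [n] only weakens the bound. *)
Lemma count_return_le x A n k : regen x A ->
  pr P (A `&` S x `&` [set w | (k <= count_S x.+1 (x + n).+1 w)%N]) <=
  pr P (A `&` S x) * (1 - ret_tail n) ^+ k.
Proof.
elim: k x A n => [|k IH] x A n h; have mA := h.1.
  rewrite expr0 mulr1; apply: pr_le => //; last exact: mI.
  by apply: mI; [exact: mI|exact: (measurable_count _ _ (fun i => _ <= i)%N)].
rewrite first_count_decomposition; last exact: mI.
rewrite sum_shift exprS mulrA.
rewrite {1}ret_tail_compl mulr_sumr mulr_suml.
apply: ler_sum_nat => j hj.
rewrite -first_returnE//; last lia.
have r : regen (x + j) (A `&` S x `&` none_in x.+1 (x + j)).
  by apply: regen_first => //; lia.
have := IH _ _ (n - j)%N r.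
rewrite (_ : x + j + (n - j) = x + n)%N; last lia.
move=> /le_trans; apply; apply: ler_wpM2l; first exact: pr_ge0.
have := ret_tail_le1 (n - j); have := ret_tail_le1 n.
have := ret_tail_anti _ _ (leq_subr j n) => *.
by apply: lerXn2r; rewrite ?nnegrE; lra.
Qed.

(** If all [k] gaps are at most [m], the [k] points lie within distance [k * m]. *)
Lemma count_return_ge x A m n k : regen x A -> (k * m <= n)%N ->
  pr P (A `&` S x) * (1 - ret_tail m) ^+ k <=
  pr P (A `&` S x `&` [set w | (k <= count_S x.+1 (x + n).+1 w)%N]).
Proof.
elim: k x A n => [|k IH] x A n h kmn; have mA := h.1.
  rewrite expr0 mulr1; apply: pr_le; [exact: mI| |by move=> w Aw; split].
  by apply: mI; [exact: mI|exact: (measurable_count _ _ (fun i => _ <= i)%N)].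
have mn : (m <= n)%N by nia.
rewrite first_count_decomposition; last exact: mI.
rewrite sum_shift exprS mulrA.
rewrite {1}ret_tail_compl mulr_sumr mulr_suml.
rewrite (@big_cat_nat _ _ _ m.+1 1 n.+1)//=.
apply: (@le_trans _ _ (\sum_(1 <= j < m.+1) pr P (A `&` S x) * ret j *
  (1 - ret_tail m) ^+ k)) => //; apply: ler_wpDr.
  by apply: sumr_ge0 => j _; exact: pr_ge0.
apply: ler_sum_nat => j hj.
rewrite -first_returnE//; last lia.
have r : regen (x + j) (A `&` S x `&` none_in x.+1 (x + j)).
  by apply: regen_first => //; lia.
have := IH _ _ (n - j)%N r.
rewrite (_ : x + j + (n - j) = x + n)%N; last lia.
by apply; nia.
Qed.

Lemma regen_init y : (x0 <= y)%N -> regen y (setT `&` none_in x0 y).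
Proof. by move=> h; apply: regen_none => //; lia. Qed.

Lemma count_le n k :
  pr P [set w | (k < count_S x0 n.+1 w)%N] <= (1 - ret_tail n) ^+ k.
Proof.
have := @first_count_decomposition setT x0 n.+1 k measurableT.
rewrite setTI => ->.
have := @first_total_decomposition setT x0 n.+1 measurableT.
rewrite pr_setT => e.
have t1 := ret_tail_le1 n.
have p0 : 0 <= (1 - ret_tail n) ^+ k by apply: exprn_ge0; lra.
apply: (@le_trans _ _ (\sum_(x0 <= y < n.+1)
   pr P (setT `&` none_in x0 y `&` S y) * (1 - ret_tail n) ^+ k)); last first.
  rewrite -mulr_suml; apply: ler_piMl => //; rewrite e lerDr; exact: pr_ge0.
apply: ler_sum_nat => y hy.
have := count_return_le _ _ (n - y) k (regen_init y _).
rewrite subnKC; last lia.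
move=> /(_ _)/le_trans; apply; first lia.
apply: ler_wpM2l; first exact: pr_ge0.
have := ret_tail_le1 (n - y).
have := ret_tail_anti _ _ (leq_subr y n) => *.
by apply: lerXn2r; rewrite ?nnegrE; lra.
Qed.

(** The sites up to [l] are reserved for the first point, and [m] sites for each of the [k] gaps
    that follow it. *)
Lemma count_ge n k m l : (k * m + l <= n)%N ->
  (1 - pr P (none_in x0 l.+1)) * (1 - ret_tail m) ^+ k <=
  pr P [set w | (k < count_S x0 n.+1 w)%N].
Proof.
move=> kml.
have := @first_count_decomposition setT x0 n.+1 k measurableT.
rewrite setTI => ->.
have := @first_total_decomposition setT x0 l.+1 measurableT.
rewrite pr_setT setTI => e; rewrite {1}e addrC addKr mulr_suml.
have key y : (x0 <= y < l.+1)%N -> pr P (setT `&` none_in x0 y `&` S y) *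
    (1 - ret_tail m) ^+ k <= pr P (setT `&` none_in x0 y `&` S y `&`
     [set w | (k <= count_S y.+1 n.+1 w)%N]).
  move=> hy; have := count_return_ge _ _ m (n - y) k (regen_init y _).
  rewrite subnKC; last nia.
  by apply; nia.
apply: (le_trans (ler_sum_nat key)).
have [xl|lx] := leqP x0 l.+1; last first.
  rewrite big_geq ?sumr_ge0//; last lia.
  by move=> y _; exact: pr_ge0.
rewrite (@big_cat_nat _ _ _ l.+1 x0 n.+1)//= ?lerDl; last nia.
by apply: sumr_ge0 => j _; exact: pr_ge0.
Qed.

End Renewal.

(** * Two-sided bounds on the gap tail from the renewal equation *)

Section LogRenewalAsymptotics.
Context {R : realType}.

Definition renewal_u (n : nat) : R := if n is 0 then 1 else (2 * n%:R)^-1.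

Definition green (n : nat) : R := \sum_(0 <= j < n.+1) renewal_u j.

Lemma renewal_u_ge0 n : 0 <= renewal_u n.
Proof. by case: n => [|n] //=; rewrite invr_ge0 mulr_ge0. Qed.

Lemma greenS n : green n.+1 = green n + (2 * n.+1%:R)^-1.
Proof. by rewrite /green big_nat_recr. Qed.

Lemma ln_succ_le n : (0 < n)%N -> ln n.+1%:R - ln n%:R <= (n%:R)^-1 :> R.
Proof.
move=> n0; have n0' : 0 < n%:R :> R by rewrite ltr0n.
rewrite -ln_div ?posrE ?ltr0n// (_ : n.+1%:R / n%:R = 1 + n%:R^-1); last first.
  by rewrite -natr1; field; rewrite gt_eqF.
by apply: le_ln1Dx; rewrite (lt_le_trans (@ltrN10 R))// invr_ge0 ltW.
Qed.

Lemma ln_succ_ge n : (0 < n)%N -> (n.+1%:R)^-1 <= ln n.+1%:R - ln n%:R :> R.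
Proof.
move=> n0; have n0' : 0 < n%:R :> R by rewrite ltr0n.
have n1 : 0 < n.+1%:R :> R by rewrite ltr0n.
rewrite -(opprB (ln n%:R)) lerNr -ln_div ?posrE//.
rewrite (_ : n%:R / n.+1%:R = 1 + - (n.+1%:R)^-1); last first.
  by rewrite -natr1; field; rewrite natr1 gt_eqF.
apply: le_ln1Dx; rewrite ltrN2 invf_lt1// ltr1n; lia.
Qed.

Lemma green_ge n : 1 + 2^-1 * ln n.+1%:R <= green n.
Proof.
elim: n => [|n IH]; first by rewrite ln1 mulr0 addr0 /green big_nat1.
rewrite greenS invfM; have := ln_succ_le _ (ltn0Sn n); move: IH.
by move: (ln _) (ln _) (n.+1%:R^-1) => x y z ? ?; lra.
Qed.

Lemma green_le n : (0 < n)%N -> green n <= 3 / 2 + 2^-1 * ln n%:R.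
Proof.
elim: n => [//|[|n] IH] _.
  by rewrite greenS /green big_nat1 ln1 mulr1 /=; lra.
rewrite greenS invfM; have := ln_succ_ge _ (ltn0Sn n); move: (IH isT).
by move: (ln _) (ln _) (n.+2%:R^-1) => x y z ? ?; lra.
Qed.

Variable tau : nat -> R.
Hypothesis tau_ge0 : forall n, 0 <= tau n.
Hypothesis tau_le1 : forall n, tau n <= 1.
Hypothesis tau_anti : forall m n, (m <= n)%N -> tau n <= tau m.
Hypothesis tau_eq : forall n, \sum_(0 <= j < n.+1) renewal_u j * tau (n - j) = 1.

(** Every [tau (n - j)] in the renewal equation is at least [tau n]. *)
Lemma tau_le n : tau n <= (green n)^-1.
Proof.
have g0 : 0 < green n.
  by apply: lt_le_trans (green_ge n); rewrite ltr_pwDl// mulr_ge0// ln_ge0// ler1n.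
rewrite -[X in _ <= X]mul1r ler_pdivlMr// -(tau_eq n) mulrC /green mulr_suml.
apply: ler_sum => j _; apply: ler_wpM2l; first exact: renewal_u_ge0.
by apply: tau_anti; exact: leq_subr.
Qed.

(** The renewal equation at [l * j + l]: for indices up to [l * j] the argument of [tau] is at least
    [l], and the other [l] terms are at most [1 / (2 * l * j)] each. *)
Lemma tau_ge l j : (0 < l)%N -> (0 < j)%N ->
  (1 - (2 * j%:R)^-1) / green (l * j) <= tau l.
Proof.
move=> l0 j0.
have g0 : 0 < green (l * j).
  apply: lt_le_trans (green_ge _).
  by rewrite ltr_pwDl// mulr_ge0// ln_ge0// ler1n.
rewrite ler_pdivrMr//; have := tau_eq (l * j + l).
rewrite (@big_cat_nat _ _ _ (l * j).+1)//=; last lia.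
move=> eq1.
have j0' : 0 < j%:R :> R by rewrite ltr0n.
have l0' : 0 < l%:R :> R by rewrite ltr0n.
have h1 : \sum_((l * j).+1 <= i < (l * j + l).+1)
    renewal_u i * tau (l * j + l - i) <= (2 * j%:R)^-1.
  apply: (@le_trans _ _ (\sum_((l * j).+1 <= i < (l * j + l).+1)
     (2 * (l * j)%:R)^-1)).
    apply: ler_sum_nat => i hi; rewrite -[X in _ <= X]mulr1.
    apply: ler_pM => //; first exact: renewal_u_ge0.
    case: i hi => [|i] hi //=; rewrite lef_pV2 ?posrE ?mulr_gt0 ?ltr0n//; last nia.
    by rewrite ler_pM2l// ler_nat; lia.
  rewrite big_const_nat iter_addr addr0 subSS addKn natrM.
  rewrite le_eqVlt; apply/orP; left; apply/eqP; rewrite -mulr_natr.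
  by field; rewrite !gt_eqF.
have h2 : \sum_(0 <= i < (l * j).+1) renewal_u i * tau (l * j + l - i) <=
    tau l * green (l * j).
  rewrite /green mulr_sumr; apply: ler_sum_nat => i hi.
  rewrite [X in _ <= X]mulrC; apply: ler_wpM2l; first exact: renewal_u_ge0.
  by apply: tau_anti; lia.
by rewrite lerBlDr; have := lerD h2 h1; rewrite eq1.
Qed.

(** Since [1 / (1 - s) = 1 + s / (1 - s)], it is at most [expR (s / (1 - s))]. *)
Lemma expR_ge_pow (s : R) k : 0 <= s < 1 ->
  expR (- (k%:R * s / (1 - s))) <= (1 - s) ^+ k.
Proof.
move=> /andP[s0 s1]; have d0 : 0 < 1 - s by rewrite subr_gt0.
rewrite -mulrA -mulrN expRM_natl; 
apply: lerXn2r; [by rewrite nnegrE expR_ge0|by rewrite nnegrE ltW|].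
rewrite expRN -[leRHS]invrK lef_pV2 ?posrE ?invr_gt0 ?expR_gt0//.
apply: le_trans (expR_ge1Dx _); rewrite le_eqVlt; apply/orP; left; apply/eqP.
by field; rewrite gt_eqF.
Qed.

Lemma expR_le_pow (s : R) k : 0 <= s <= 1 ->
  (1 - s) ^+ k <= expR (- (k%:R * s)).
Proof.
move=> /andP[s0 s1]; rewrite -mulrN expRM_natl; apply: lerXn2r; rewrite ?nnegrE ?expR_ge0 ?subr_ge0//.
exact: expR_ge1Dx.
Qed.

End LogRenewalAsymptotics.

(** * Limits involving the truncation of a multiple of [ln n] *)

Section LogLimits.
Context {R : realType}.

Lemma near_ln_ge (M : R) : \forall n \near \oo, M <= ln n%:R.
Proof.
near=> n; rewrite -(expRK M) ler_ln ?posrE ?expR_gt0//.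
  by near: n; exact: nbhs_infty_ger.
by rewrite ltr0n; near: n; exact: nbhs_infty_gt.
Unshelve. all: by end_near. Qed.

Lemma cvg_inv_ln : (ln n%:R)^-1 @[n --> \oo] --> (0 : R).
Proof.
apply/cvgrPdist_le => e e0; near=> n.
have h : e^-1 <= ln n%:R :> R by near: n; exact: near_ln_ge.
have l0 : 0 < ln n%:R :> R by apply: lt_le_trans h; rewrite invr_gt0.
rewrite sub0r normrN ger0_norm; last by rewrite invr_ge0 ltW.
by rewrite -[leRHS]invrK lef_pV2 ?posrE ?invr_gt0.
Unshelve. all: by end_near. Qed.

(** From [1 + y <= (1 + sqrt y) ^ 2]. With [y = r * ln n] it makes [ln (k n).+1] negligible against
    [ln n]. *)
Lemma ln1D_le_sqrt (y : R) : 0 <= y -> ln (1 + y) <= 2 * Num.sqrt y.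
Proof.
move=> y0; have s0 := sqrtr_ge0 y.
have -> : 2 * Num.sqrt y = Num.sqrt y + Num.sqrt y by rewrite mulrDl mul1r.
apply: (@le_trans _ _ (ln (1 + Num.sqrt y) + ln (1 + Num.sqrt y))).
  rewrite -lnM ?posrE; [|lra..].
  rewrite ler_ln ?posrE; [|lra|by apply: mulr_gt0; lra].
  have := sqr_sqrtr y0; rewrite expr2; nra.
by apply: lerD; apply: le_ln1Dx; lra.
Qed.

Variable r : R.
Hypothesis r0 : 0 <= r.

Let k n := Num.truncn (r * ln n%:R : R).

Lemma cvg_trunc_ln : (k n)%:R / ln n%:R @[n --> \oo] --> r.
Proof.
apply: (@squeeze_cvgr _ _ _ _ (fun n => r - (ln n%:R)^-1) (fun=> r)); last 2 first.
- by rewrite -[X in _ --> X]subr0; apply: cvgB; [exact: cvg_cst|exact: cvg_inv_ln].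
- exact: cvg_cst.
near=> n; have l0 : 0 < ln n%:R :> R.
  by apply: (@lt_le_trans _ _ 1) => //; near: n; exact: near_ln_ge.
have h0 : 0 <= r * ln n%:R by exact: mulr_ge0 (ltW l0).
have /andP[h1 h2] := truncn_itv h0.
rewrite ler_pdivrMr// h1 andbT ler_pdivlMr// mulrBl mulVf ?gt_eqF//.
by rewrite lerBlDr natr1 ltW.
Unshelve. all: by end_near. Qed.

Lemma cvg_ln_trunc_ln : ln (k n).+1%:R / ln n%:R @[n --> \oo] --> (0 : R).
Proof.
apply: (@squeeze_cvgr _ _ _ _ (fun=> 0)
  (fun n => 2 * Num.sqrt (r * (ln n%:R)^-1))); last 2 first.
- exact: cvg_cst.
- have -> : 0 = 2 * Num.sqrt (r * 0) :> R by rewrite mulr0 sqrtr0 mulr0.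
  apply: cvgM; first exact: cvg_cst.
  apply: continuous_cvg; first exact: sqrt_continuous.
  by apply: cvgM; [exact: cvg_cst|exact: cvg_inv_ln].
near=> n; have l0 : 0 < ln n%:R :> R.
  by apply: (@lt_le_trans _ _ 1) => //; near: n; exact: near_ln_ge.
have h0 : 0 <= r * ln n%:R by exact: mulr_ge0 (ltW l0).
have /andP[h1 h2] := truncn_itv h0.
have l0' := ltW l0.
rewrite divr_ge0//=; last by rewrite ln_ge0// ler1n.
rewrite ler_pdivrMr//.
have e : 2 * Num.sqrt (r / ln n%:R) * ln n%:R = 2 * Num.sqrt (r * ln n%:R).
  rewrite -mulrA; congr (2 * _).
  rewrite -[X in _ * X = _](ger0_norm l0') -sqrtr_sqr -sqrtrM ?divr_ge0//.
  by congr Num.sqrt; field; rewrite gt_eqF.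
rewrite e; apply: le_trans (ln1D_le_sqrt _ h0).
rewrite ler_ln ?posrE//; last by lra.
by rewrite -natr1 addrC lerD2l.
Unshelve. all: by end_near. Qed.

End LogLimits.

(** * Exponential limit for the number of points of the renewal set *)

Section LogRenewalLimit.
Context {R : realType} {d : measure_display} {T : measurableType d}.
Variables (P : probability T R) (S : nat -> set T).
Hypothesis mS : forall x, measurable (S x).
Hypothesis prS : forall x ys, (2 <= x)%N -> path ltn x ys ->
  pr P (S x `&` all_in S ys) = (2 * x%:R)^-1 * gap_prod renewal_u x ys.

Let tau := ret_tail P S 2.

Lemma pr_S x : (2 <= x)%N -> pr P (S x) = (2 * x%:R)^-1.
Proof. by move=> x2; have := prS x [::] x2 isT; rewrite /= setIT mulr1. Qed.

Let regenS y : (2 <= y)%N -> regen P S renewal_u y setT.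
Proof.
by move=> y2; split => // ys hys; rewrite setTI prS// pr_S.
Qed.

Let prS2 : 0 < pr P (S 2).
Proof. by rewrite pr_S// invr_gt0 mulr_gt0. Qed.

Let tau_equation n : \sum_(0 <= j < n.+1) renewal_u j * tau (n - j) = 1.
Proof. exact: (ret_tail_equation P S renewal_u mS erefl 2 regenS prS2). Qed.

Let tau_ge0 n : 0 <= tau n.
Proof. exact: (ret_tail_ge0 P S renewal_u mS erefl 2 regenS prS2). Qed.

Let tau_le1 n : tau n <= 1.
Proof. exact: (ret_tail_le1 P S 2). Qed.

Let tau_anti m n : (m <= n)%N -> tau n <= tau m.
Proof. exact: (ret_tail_anti P S 2). Qed.

(** As [pr (S y) = u y] for [y >= 2], the sum in [none_initE] is the renewal equation without its
    terms [j = 0] and [j = 1]; the probability is therefore [tau m + tau (m - 1) / 2]. *)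
Lemma pr_none_init_le m : (0 < m)%N -> pr P (none_in S 2 m.+1) <= 2 * tau m.-1.
Proof.
move=> m0; rewrite (none_initE P S renewal_u mS erefl 2 regenS prS2).
have := tau_equation m.
rewrite big_ltn// big_ltn//= subn0 mul1r mulr1 subn1.
rewrite (eq_big_nat _ _ (F2 := fun y => pr P (S y) * tau (m - y))); last first.
  by move=> [|i]// hi; rewrite pr_S//; lia.
rewrite -/tau => e; have := tau_anti _ _ (leq_pred m); have := tau_ge0 m.-1.
by move: (\sum_(_ <= _ < _) _) e => x e; lra.
Qed.

Lemma pr_count_le n k : (0 < n)%N ->
  pr P [set w | (k < count_S S 2 n.+1 w)%N] <=
  expR (- ((k%:R - 2^-1) / (3 / 2 + 2^-1 * ln n%:R + 2^-1 * ln k.+1%:R))).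
Proof.
move=> n0; have := count_le P S renewal_u mS erefl 2 regenS prS2 n k.
move=> /le_trans; apply; rewrite -/tau.
apply: (le_trans (expR_le_pow _ k _)); first by rewrite tau_ge0 tau_le1.
rewrite ler_expR lerN2.
have k1 : 0 < k.+1%:R :> R by rewrite ltr0n.
have n1 : 0 < n%:R :> R by rewrite ltr0n.
have nk : (0 < n * k.+1)%N by lia.
have G0 : 0 < green (n * k.+1) :> R.
  apply: lt_le_trans (green_ge _); rewrite ltr_pwDl// mulr_ge0// ln_ge0//.
  by rewrite ler1n.
have G1 := @green_le R _ nk.
rewrite natrM lnM ?posrE// mulrDr addrA in G1.
have D0 := lt_le_trans G0 G1.
(* With [j = k + 1] the correction [1 / (2 * (k + 1))], multiplied by [k], costs at most [1 / 2],
   while the denominator grows only by [ln (k + 1) / 2]. *)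
have tg := tau_ge tau tau_ge0 tau_le1 tau_anti tau_equation n k.+1 n0 (ltn0Sn k).
have [k0|k0] := posnP k.
  rewrite k0 sub0r mul0r mulNr oppr_le0 divr_ge0//.
  by rewrite k0 in D0; exact: ltW.
have kr0 : 1 <= k%:R :> R by rewrite ler1n.
apply: (@le_trans _ _ (k%:R * ((1 - (2 * k.+1%:R)^-1) / green (n * k.+1)))); last first.
  by apply: ler_wpM2l.
rewrite mulrA; apply: ler_pM.
- lra.
- by rewrite invr_ge0 ltW.
- rewrite mulrBr mulr1 lerD2l lerN2 invfM mulrCA ger_pMr ?invr_gt0//.
  by rewrite ler_pdivrMr// mul1r ler_nat.
- by rewrite lef_pV2 ?posrE.
Qed.

(** The [n] sites are cut into [k + 1] blocks of length [m], one for the first point and one for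
    each gap. [s] bounds [tau m.-1 <= 1 / (1 + ln m / 2)]: one has [n <= 2 * m * (k + 1)], and
    [ln 2 <= 1] turns the constant [1] into [1 / 2]. *)
Lemma pr_count_ge n k (s := (2^-1 + 2^-1 * ln n%:R - 2^-1 * ln k.+1%:R)^-1) :
  (0 < n)%N -> 0 < s < 2^-1 ->
  (1 - 2 * s) * expR (- (k%:R * s / (1 - s))) <=
  pr P [set w | (k < count_S S 2 n.+1 w)%N].
Proof.
move=> n0 /andP[s0 s1].
have k1 : 0 < k.+1%:R :> R by rewrite ltr0n.
have n1 : 0 < n%:R :> R by rewrite ltr0n.
pose m := (n %/ k.+1)%N.
have s1' : 2 < 2^-1 + 2^-1 * ln n%:R - 2^-1 * ln k.+1%:R :> R.
  by move: s1; rewrite /s ltf_pV2 ?posrE// -invr_gt0.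
have nk : (k.+1 < n)%N.
  rewrite -(ltr_nat R) -ltr_ln ?posrE//.
  by move: (ln _) (ln _) s1' => x y ?; lra.
have m0 : (0 < m)%N by rewrite /m divn_gt0// ltnW.
have tm : tau m.-1 <= s.
  apply: (le_trans (tau_le tau tau_anti tau_equation _)).
  have g := @green_ge R m.-1; rewrite prednK// in g.
  rewrite lef_pV2 ?posrE; last 2 first.
  - apply: lt_le_trans g; rewrite ltr_pwDl// mulr_ge0// ln_ge0// ler1n.
    by rewrite /m divn_gt0// ltnW.
  - by apply: lt_trans s1'.
  apply: le_trans g.
  have m1 : 0 < m%:R :> R by rewrite ltr0n.
  have h : ln n%:R <= ln (2 * m%:R * k.+1%:R) :> R.
    rewrite ler_ln ?posrE ?mulr_gt0//.
    rewrite -[2]/(2%:R) -!natrM ler_nat.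
    by have := ltn_ceil n (ltn0Sn k); rewrite -/m; nia.
  rewrite !lnM ?posrE ?mulr_gt0// in h.
  have l2 : ln 2 <= 1 :> R.
    by rewrite -[2]/(1 + 1); apply: le_ln1Dx; lra.
  by move: (ln _) (ln n%:R) (ln k.+1%:R) (ln m%:R) h l2 => a b c e ? ?; lra.
have kml : (k * m + m <= n)%N.
  by have := leq_divM n k.+1; rewrite -/m; nia.
apply: le_trans (count_ge P S renewal_u mS erefl 2 regenS prS2 n k m m kml).
have s1b : 2 * s <= 1 by lra.
apply: ler_pM; [lra|exact: expR_ge0| |].
- rewrite lerD2l lerN2; apply: (le_trans (pr_none_init_le _ m0)).
  by rewrite ler_pM2l.
- apply: (le_trans (expR_ge_pow _ k _)); first by apply/andP; split; lra.
  have := tau_anti _ _ (leq_pred m); rewrite -/tau.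
  have := tau_le1 m => *.
  by apply: lerXn2r; rewrite ?nnegrE; lra.
Qed.

Lemma renewal_count_cvg (t : R) : 0 <= t ->
  pr P [set w | t / 2 * ln n%:R < (count_S S 2 n.+1 w)%:R] @[n --> \oo] -->
  expR (- t).
Proof.
move=> t0; have r0 : 0 <= t / 2 by lra.
pose k n := Num.truncn (t / 2 * ln n%:R : R).
have Z := @cvg_inv_ln R.
have X := cvg_trunc_ln _ r0; have Y := cvg_ln_trunc_ln _ r0.
rewrite -/(k _) in X Y.
have lpos : \forall n \near \oo, 0 < ln n%:R :> R.
  near=> n; apply: (@lt_le_trans _ _ 1) => //; near: n; exact: near_ln_ge.
(* The inverse of the [s] of [pr_count_ge], divided by [ln n]. Its limit [1 / 2] and
   [k n / ln n --> t / 2] give the exponent [t]. *)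
pose den n : R := 2^-1 * (ln n%:R)^-1 + 2^-1 - 2^-1 * (ln (k n).+1%:R / ln n%:R).
have cden : den n @[n --> \oo] --> (2^-1 : R).
  have -> : 2^-1 = 2^-1 * 0 + 2^-1 - 2^-1 * 0 :> R by lra.
  apply: cvgB; last first.
    by apply: cvgM => //; exact: cvg_cst.
  apply: cvgD; last exact: cvg_cst.
  by apply: cvgM => //; exact: cvg_cst.
have half0 : 2^-1 != 0 :> R by [].
pose s n : R := (ln n%:R)^-1 / den n.
have cs : s n @[n --> \oo] --> (0 : R).
  by rewrite -(mul0r (2^-1)^-1); apply: cvgM => //; exact: cvgV.
pose ks n : R := (k n)%:R / ln n%:R / den n.
have cks : ks n @[n --> \oo] --> t.
  have -> : t = t / 2 / 2^-1 by rewrite invrK divfK.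
  by apply: cvgM => //; exact: cvgV.
pose lo n : R := (1 - 2 * s n) * expR (- (ks n / (1 - s n))).
pose hi n : R := expR (- (((k n)%:R / ln n%:R - 2^-1 * (ln n%:R)^-1) /
  (3 / 2 * (ln n%:R)^-1 + 2^-1 + 2^-1 * (ln (k n).+1%:R / ln n%:R)))).
apply: (@squeeze_cvgr _ _ _ _ lo hi).
- near=> n.
  have l0 : 0 < ln n%:R :> R by near: n.
  have n0 : (0 < n)%N by near: n; exact: nbhs_infty_gt.
  have h0 : 0 <= t / 2 * ln n%:R by apply: mulr_ge0 => //; exact: ltW.
  have -> : [set w | t / 2 * ln n%:R < (count_S S 2 n.+1 w)%:R] =
      [set w | (k n < count_S S 2 n.+1 w)%N].
    by apply/seteqP; split => w /=; rewrite /k truncn_lt_nat.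
  apply/andP; split; last first.
    apply: (le_trans (pr_count_le _ _ n0)); rewrite /hi.
    rewrite le_eqVlt; apply/orP; left; apply/eqP; congr (expR (- _)).
    have k0 : 0 <= ln (k n).+1%:R :> R by rewrite ln_ge0// ler1n.
    by field; rewrite !gt_eqF//; lra.
  have d0 : 0 < den n by near: n; apply: (cvgr_gt (2^-1)) => //; lra.
  have e1 : s n = (2^-1 + 2^-1 * ln n%:R - 2^-1 * ln (k n).+1%:R)^-1.
    rewrite /s; have -> : den n = (2^-1 + 2^-1 * ln n%:R - 2^-1 * ln (k n).+1%:R) / ln n%:R.
      by rewrite /den; field; rewrite gt_eqF.
    by rewrite invfM invrK mulrCA mulVf ?mulr1// gt_eqF.
  have e2 : ks n = (k n)%:R * s n by rewrite /ks /s mulrA.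
  rewrite /lo e2 e1; apply: pr_count_ge => //; rewrite -e1; apply/andP; split.
    by rewrite divr_gt0// invr_gt0.
  near: n; apply: (cvgr_lt (0:R)) => //; lra.
- rewrite (_ : expR (- t) = (1 - 2 * 0) * expR (- (t / (1 - 0)))); last first.
    by rewrite mulr0 subr0 mul1r divr1.
  apply: cvgM.
    apply: cvgB; first exact: cvg_cst.
    by apply: cvgM => //; exact: cvg_cst.
  apply: continuous_cvg; first exact: continuous_expR.
  apply: cvgN; apply: cvgM => //; apply: cvgV; first by rewrite subr0 oner_neq0.
  by apply: cvgB => //; exact: cvg_cst.
- have -> : expR (- t) = expR (- ((t / 2 - 2^-1 * 0) /
    (3 / 2 * 0 + 2^-1 + 2^-1 * 0))).
    by congr (expR (- _)); field.
  apply: continuous_cvg; first exact: continuous_expR.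
  apply: cvgN; apply: cvgM.
    by apply: cvgB => //; apply: cvgM => //; exact: cvg_cst.
  apply: cvgV; first by rewrite !mulr0 add0r addr0.
  apply: cvgD; last by apply: cvgM => //; exact: cvg_cst.
  apply: cvgD; last exact: cvg_cst.
  by apply: cvgM => //; exact: cvg_cst.
Unshelve. all: by end_near. Qed.

End LogRenewalLimit.

(** * Step probabilities and harmonic functions of the chain *)

Section StepProbabilities.
Context {R : realType}.
Local Notation p := (@pseq R).

(** The Doob transform form of the step. It fails at [z = 1], where it would give [1] instead of
    [3 / 4]; hence the bounds [2 <= z] throughout. *)
Lemma pseqE z : (2 <= z)%N -> p z = z.+1%:R / (2 * z%:R).
Proof.
move=> z2; have z0 : z%:R != 0 :> R by rewrite pnatr_eq0; lia.
rewrite /pseq ifF; last by apply/eqP; lia.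
rewrite ifF; last by apply/eqP; lia.
by rewrite -natr1; field.
Qed.

Lemma pseq_gt0 z : 0 < p z.
Proof.
case: z => [|[|z]]; first by rewrite /pseq.
  by rewrite /pseq /=; lra.
by rewrite pseqE// divr_gt0// ltr0n.
Qed.

Lemma pseq_le1 z : p z <= 1.
Proof.
case: z => [|[|z]]; first by rewrite /pseq.
  by rewrite /pseq /=; lra.
rewrite pseqE// ler_pdivrMr ?mulr_gt0 ?ltr0n// mul1r -[2]/(2%:R) -natrM ler_nat; lia.
Qed.

Lemma qseqE z : (2 <= z)%N -> 1 - p z = z.-1%:R / (2 * z%:R).
Proof.
move=> z2; have z0 : z%:R != 0 :> R by rewrite pnatr_eq0; lia.
rewrite pseqE// -natr1 (_ : z.-1%:R = z%:R - 1); first by field.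
by rewrite -subn1 natrB//; lia.
Qed.

Lemma trans_up z : trans p z z.+1 = p z.
Proof. by rewrite /trans eqxx. Qed.

(** At [z = 0] the truncated predecessor is [0] and both sides vanish, so the reflecting site needs
    no separate treatment. *)
Lemma trans_down z : trans p z z.-1 = 1 - p z.
Proof.
rewrite /trans; case: z => [|z] /=; first by rewrite /pseq subrr.
by rewrite eqxx ifF//; apply/eqP; lia.
Qed.

Definition harmonic_at (g : nat -> R) (z : nat) : Prop :=
  g z = p z * g z.+1 + (1 - p z) * g z.-1.

Lemma harmonic_affine_step (g : nat -> R) z : (2 <= z)%N -> harmonic_at g z ->
  z.+1%:R * g z.+1 - z%:R * g z = z%:R * g z - z.-1%:R * g z.-1.
Proof.
move=> z2; rewrite /harmonic_at qseqE// pseqE//.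
have z0 : z%:R != 0 :> R by rewrite pnatr_eq0; lia.
move=> e; have -> : z%:R * g z = (z.+1%:R * g z.+1 + z.-1%:R * g z.-1) / 2.
  by rewrite {1}e; field.
by lra.
Qed.

Lemma harmonic_affine (g : nat -> R) a b j : (1 <= a)%N -> (a + j <= b)%N ->
  (forall z, (a < z < b)%N -> harmonic_at g z) ->
  (a + j)%:R * g (a + j)%N =
  a%:R * g a + j%:R * (a.+1%:R * g a.+1 - a%:R * g a).
Proof.
move=> a1 jb h.
have step i : (a + i.+1 <= b)%N ->
  (a + i.+1)%:R * g (a + i.+1)%N - (a + i)%:R * g (a + i)%N =
  a.+1%:R * g a.+1 - a%:R * g a.
  elim: i => [|i IH] ib; first by rewrite addn0 addn1.
  rewrite -IH; last lia.
  have hz : (2 <= a + i.+1)%N by lia.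
  have := harmonic_affine_step g (a + i.+1) hz.
  rewrite -addnS => -> //; first by rewrite addnS.
  by apply: h; lia.
elim: j jb => [|j IH] jb; first by rewrite addn0 mul0r addr0.
have -> : (a + j.+1)%:R * g (a + j.+1)%N = (a + j)%:R * g (a + j)%N +
    ((a + j.+1)%:R * g (a + j.+1)%N - (a + j)%:R * g (a + j)%N) by ring.
rewrite step// IH; last lia.
by rewrite -[j.+1%:R]natr1; ring.
Qed.

Lemma harmonic_interpolation (g : nat -> R) a b z : (1 <= a)%N ->
  (a <= z <= b)%N -> (forall z, (a < z < b)%N -> harmonic_at g z) ->
  (b - a)%:R * (z%:R * g z) =
  (b - z)%:R * (a%:R * g a) + (z - a)%:R * (b%:R * g b).
Proof.
move=> a1 /andP[az zb] h.
have h1 := harmonic_affine g a b (z - a) a1.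
have h2 := harmonic_affine g a b (b - a) a1.
rewrite !subnKC// in h1 h2; last exact: leq_trans zb.
rewrite h1// h2//.
rewrite (natrB _ zb) (natrB _ az) (natrB _ (leq_trans az zb)); ring.
Qed.

(** Reflection at [0] gives [g 1 = g 0], and positivity of [p] propagates the equality upward: from
    below, the chain is sure to reach [x]. *)
Lemma harmonic_const (g : nat -> R) x : (forall z, (z < x)%N -> harmonic_at g z) ->
  forall z, (z <= x)%N -> g z = g 0%N.
Proof.
move=> h; elim/ltn_ind => -[//|z] IH zx.
have := h z zx; rewrite /harmonic_at.
have -> : g z.-1 = g 0%N by case: z IH zx => //= z IH zx; apply: IH; lia.
rewrite (IH z) ?leqnn//; last lia.
move=> e; apply: (mulfI (lt0r_neq0 (pseq_gt0 z))).
by lra.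
Qed.

Lemma affine_bounded_slope (c D M : R) : (forall j : nat, c + j%:R * D <= M) -> D <= 0.
Proof.
move=> h; rewrite leNgt; apply/negP => D0.
have := h (Num.truncn ((M - c) / D)).+1.
have := truncnS_gt ((M - c) / D); rewrite ltr_pdivrMr// => *; lra.
Qed.

End StepProbabilities.

(** * Exit words over a finite and over an infinite horizon *)

Section ExitWords.
Context {T : Type}.
Variable X : nat -> T -> nat.

(* The successive exits ([true] is up) from [x] at times in [k, k + m). *)
Definition exits (k m x : nat) (w : T) : seq bool :=
  [seq X i.+1 w == x.+1 | i <- iota k m & X i w == x].

Lemma exitsS k m x w : exits k m.+1 x w =
  if X k w == x then (X k.+1 w == x.+1) :: exits k.+1 m x w
  else exits k.+1 m x w.
Proof. by rewrite /exits /=; case: ifP. Qed.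

Lemma exitsD k m n x w :
  exits k (m + n) x w = exits k m x w ++ exits (k + m) n x w.
Proof. by rewrite /exits iotaD filter_cat map_cat. Qed.

Definition wordspec := nat -> option (seq bool).

Definition upd (W : wordspec) (z : nat) (v : seq bool) : wordspec :=
  fun y => if y == z then Some v else W y.

Definition words_match (W : wordspec) (k m : nat) : set T :=
  [set w | forall y v, W y = Some v -> exits k m y w = v].

(** The prescribed words are the complete exit words of the trajectory. In particular, a constrained
    site visited infinitely often matches nothing. *)
Definition final_match (W : wordspec) (k : nat) : set T :=
  [set w | exists M, forall m, (M <= m)%N -> words_match W k m w].

(** Exit words only grow with the horizon: once a prescribed word has been matched and then
    exceeded, it is never matched again. *)
Lemma words_match_final W k w : exists M, forall m, (M <= m)%N ->
  words_match W k m w <-> final_match W k w.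
Proof.
have [[M hM]|nf] := pselect (final_match W k w).
  by exists M => m Mm; split => _; [exists M|exact: hM].
suff [M hM] : exists M, forall m, (M <= m)%N -> ~ words_match W k m w.
  by exists M => m /hM h; split.
have [[M0 h0]|h0] := pselect (exists M0, words_match W k M0 w); last first.
  by exists 0%N => m _ h; apply: h0; exists m.
have /existsNP[m /not_implyP[M0m hm]] : ~ forall m, (M0 <= m)%N -> words_match W k m w.
  by move=> h; apply: nf; exists M0.
move: hm => /existsNP[y /existsNP[v /not_implyP[Wy hv]]].
exists m => m' mm' hm'; apply: hv.
have e0 := h0 _ _ Wy; have e1 := hm' _ _ Wy.
move: e1; rewrite -(subnKC mm') exitsD -(subnKC M0m) exitsD e0 -catA.
move/(congr1 size); rewrite !size_cat => /eqP; rewrite -{2}[size v]addn0 eqn_add2l.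
by rewrite addn_eq0 !size_eq0 => /andP[/eqP -> _]; rewrite cats0.
Qed.

End ExitWords.

(** * Match probabilities and their bounds uniform in the horizon *)

Section MatchProbability.
Context {R : realType}.
Local Notation p := (@pseq R).

(* [match_pr m z W] is the probability, for the chain started at [z], that the
   exit words of the first [m] steps are those prescribed by [W]. *)
Fixpoint match_pr (m z : nat) (W : wordspec) : R :=
  if m is m'.+1 then
    match W z with
    | None => p z * match_pr m' z.+1 W + (1 - p z) * match_pr m' z.-1 W
    | Some [::] => 0
    | Some (true :: v) => p z * match_pr m' z.+1 (upd W z v)
    | Some (false :: v) => (1 - p z) * match_pr m' z.-1 (upd W z v)
    end
  else `[< forall y v, W y = Some v -> v = [::] >]%:R.

Lemma match_pr_itv m z W : 0 <= match_pr m z W <= 1.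
Proof.
have p0 x := ltW (@pseq_gt0 R x); have p1 := @pseq_le1 R.
have q0 x : 0 <= 1 - p x by rewrite subr_ge0.
have q1 x : 1 - p x <= 1 by rewrite gerBl.
elim: m z W => [|m IH] z W /=; first by case: asbool; rewrite ?lexx ?ler01.
case: (W z) => [[|[] v]|]; first by rewrite lexx ler01.
- by have /andP[? ?] := IH z.+1 (upd W z v); rewrite mulr_ge0//= mulr_ile1.
- by have /andP[? ?] := IH z.-1 (upd W z v); rewrite mulr_ge0//= mulr_ile1.
have /andP[a0 a1] := IH z.+1 W; have /andP[b0 b1] := IH z.-1 W.
rewrite addr_ge0 ?mulr_ge0//=.
have := ler_wpM2l (p0 z) a1; have := ler_wpM2l (q0 z) b1.
by rewrite !mulr1 => ? ?; lra.
Qed.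

(** A site with letters left must still be visited, and [z |-> y / z] is harmonic above [y] with
    value [1] at [y]: each of the two possible steps contributes at most [y / (2 z)]. *)
Lemma match_pr_hit_le m z W y b v : (1 <= y)%N -> W y = Some (b :: v) ->
  (y <= z)%N -> match_pr m z W <= y%:R / z%:R.
Proof.
move=> y1; elim: m z W => [|m IH] z W Wy yz.
  rewrite /= asboolF ?divr_ge0// => h; by have := h _ _ Wy.
have [->|zy] := eqVneq z y.
  by rewrite divff ?pnatr_eq0; [case/andP: (match_pr_itv m.+1 y W)|lia].
have yz' : (y < z)%N by lia.
have z0 : z%:R != 0 :> R by rewrite pnatr_eq0; lia.
have z1 : z.+1%:R != 0 :> R by rewrite pnatr_eq0.
have z2 : z.-1%:R != 0 :> R by rewrite pnatr_eq0; lia.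
have p0 := @pseq_gt0 R z.
have q0 : 0 <= 1 - p z by rewrite subr_ge0 pseq_le1.
have up W' : W' y = Some (b :: v) ->
    p z * match_pr m z.+1 W' <= y%:R / (2 * z%:R).
  move=> h; apply: (@le_trans _ _ (p z * (y%:R / z.+1%:R))).
    by rewrite ler_pM2l//; apply: IH => //; lia.
  rewrite pseqE; last lia.
  by rewrite le_eqVlt; apply/orP; left; apply/eqP; field; rewrite z0 nat1r.
have dn W' : W' y = Some (b :: v) ->
    (1 - p z) * match_pr m z.-1 W' <= y%:R / (2 * z%:R).
  move=> h; apply: (@le_trans _ _ ((1 - p z) * (y%:R / z.-1%:R))).
    by apply: ler_wpM2l => //; apply: IH => //; lia.
  rewrite qseqE; last lia.
  by rewrite le_eqVlt; apply/orP; left; apply/eqP; field; rewrite z0.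
have half : y%:R / z%:R = y%:R / (2 * z%:R) + y%:R / (2 * z%:R) :> R by field.
have h0 : 0 <= y%:R / (2 * z%:R) :> R by rewrite divr_ge0// mulr_ge0.
have Wy' v' : upd W z v' y = Some (b :: v) by rewrite /upd ifF//; apply/eqP; lia.
rewrite half /=; case: (W z) => [[|[] v']|]; first by rewrite addr_ge0.
- by apply: ler_wpDr => //; exact: up.
- by apply: ler_wpDr => //; exact: dn.
- by apply: lerD; [exact: up|exact: dn].
Qed.

(** All prescribed words are exhausted at sites up to [y], so never touching [y] suffices;
    [1 - y / z] is harmonic above [y] and vanishes at [y]. *)
Lemma match_pr_escape_ge m z W y : (1 <= y)%N -> W y = Some [::] ->
  (forall x v, W x = Some v -> v = [::] /\ (x <= y)%N) ->
  (y <= z)%N -> 1 - y%:R / z%:R <= match_pr m z W.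
Proof.
move=> y1 Wy h; elim: m z => [|m IH] z yz.
  by rewrite /= asboolT ?gerBl ?divr_ge0// => x v /h[].
have [->|zy] := eqVneq z y.
  by rewrite /= Wy divff ?subrr// pnatr_eq0; lia.
have yz' : (y < z)%N by lia.
rewrite /=; case E : (W z) => [v|]; first by have [_] := h _ _ E; lia.
have z0 : z%:R != 0 :> R by rewrite pnatr_eq0; lia.
have z1 : z.+1%:R != 0 :> R by rewrite pnatr_eq0.
have z2 : z.-1%:R != 0 :> R by rewrite pnatr_eq0; lia.
have p0 := @pseq_gt0 R z.
have q0 : 0 <= 1 - p z by rewrite subr_ge0 pseq_le1.
apply: (@le_trans _ _ (p z * (1 - y%:R / z.+1%:R) + (1 - p z) * (1 - y%:R / z.-1%:R))).
  rewrite [X in _ <= X](_ : _ = 1 - (p z * (y%:R / z.+1%:R) + (1 - p z) * (y%:R / z.-1%:R))); last ring.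
  rewrite lerD2l lerN2 qseqE ?pseqE; [|lia..].
  by rewrite le_eqVlt; apply/orP; left; apply/eqP; field; rewrite z0 z2 nat1r.
by apply: lerD; [rewrite ler_pM2l//|apply: ler_wpM2l => //]; apply: IH; lia.
Qed.

(** The exhausted site [y] separates the walk from [x], which still awaits a visit. *)
Lemma match_pr_blocked m z W x y b v : W y = Some [::] -> (x < y)%N ->
  W x = Some (b :: v) -> (y <= z)%N -> match_pr m z W = 0.
Proof.
move=> + xy; elim: m z W => [|m IH] z W Wy Wx yz.
  by rewrite /= asboolF// => h; have := h _ _ Wx.
have [->|zy] := eqVneq z y; first by rewrite /= Wy.
have Wy' v' : upd W z v' y = Some [::] by rewrite /upd ifF//; apply/eqP; lia.
have Wx' v' : upd W z v' x = Some (b :: v) by rewrite /upd ifF//; apply/eqP; lia.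
rewrite /=; case: (W z) => [[|[] v']|]//; rewrite !IH ?mulr0 ?addr0//; lia.
Qed.

End MatchProbability.

(** * From path probabilities to the probabilities of exit words *)

Section Walk.
Context {R : realType} {d : measure_display} {T : measurableType d}.
Variables (P : probability T R) (X : nat -> T -> nat).
Hypothesis Xmeas : forall k x, measurable [set w | X k w = x].
Hypothesis HX : is_markov_chain_from0 P X (trans pseq).
Local Notation p := (@pseq R).
Local Notation Q := (trans p).

Definition cyl (s : seq nat) : set T :=
  [set w | forall i, (i < size s)%N -> X i w = nth 0%N s i].

Lemma measurable_cyl s : measurable (cyl s).
Proof.
rewrite (_ : cyl s = \bigcap_(i in [set i | (i < size s)%N])
    [set w | X i w = nth 0%N s i]).
  by apply: bigcap_measurableType.
by apply/seteqP; split => w h i /=; exact: h.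
Qed.

Lemma pr_cyl s : pr P (cyl s) = path_prob Q s.
Proof. by rewrite /pr HX. Qed.

Lemma path_prob_rcons s z y :
  path_prob Q (rcons (rcons s z) y) = path_prob Q (rcons s z) * Q z y.
Proof.
have from x s' : path_prob_from Q x (rcons s' y) =
    path_prob_from Q x s' * Q (last x s') y.
  by elim: s' x => [|a s' IH] x /=; [rewrite mulr1 mul1r|rewrite IH mulrA].
case: s => [|a s] /=; first by rewrite !mulr1.
by rewrite from mulrA last_rcons.
Qed.

Lemma cyl_rcons s y : cyl (rcons s y) = cyl s `&` [set w | X (size s) w = y].
Proof.
apply/seteqP; split => w /=.
  move=> h; split; last by rewrite h ?size_rcons// nth_rcons ltnn eqxx.
  by move=> i hi; rewrite h ?size_rcons ?nth_rcons ?hi//; lia.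
move=> [h e] i; rewrite size_rcons nth_rcons ltnS leq_eqVlt => /orP[/eqP ->|hi].
  by rewrite ltnn eqxx.
by rewrite hi; exact: h.
Qed.

Lemma measurable_exits k m x v : measurable [set w | exits X k m x w = v].
Proof.
elim: m k v => [|m IH] k v.
  have [->|nv] := eqVneq v [::].
    by rewrite (_ : [set w | _] = setT)//; apply/seteqP; split.
  rewrite (_ : [set w | _] = set0)//; apply/seteqP; split => // w /= e.
  by rewrite -e in nv.
have mC : measurable (~` [set w | X k w = x]) by exact: measurableC.
case: v => [|b v].
  rewrite (_ : [set w | _] = ~` [set w | X k w = x] `&`
      [set w | exits X k.+1 m x w = [::]]); first exact: measurableI.
  by apply/seteqP; split => w /=; rewrite exitsS; case: eqP => // ? [].
rewrite (_ : [set w | _] = (~` [set w | X k w = x] `&`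
    [set w | exits X k.+1 m x w = b :: v]) `|` ([set w | X k w = x] `&`
    ((if b then [set w | X k.+1 w = x.+1] else ~` [set w | X k.+1 w = x.+1])
    `&` [set w | exits X k.+1 m x w = v]))).
  apply: measurableU; first exact: measurableI.
  apply: measurableI => //; apply: measurableI => //.
  by case: b => //; exact: measurableC.
apply/seteqP; split => w /=; rewrite exitsS; case: eqP => hx.
- by move=> [<- <-]; right; split => //; split => //; case: eqP.
- by left.
- move=> [[]//|[_ [+ ->]]]; case: b => /=.
    by move=> ->; rewrite eqxx.
  by case: eqP.
- by move=> [[]|[]].
Qed.

Lemma measurable_words_match W k m : measurable (words_match X W k m).
Proof.
rewrite (_ : words_match X W k m = \bigcap_y
   (if W y is Some v then [set w | exits X k m y w = v] else setT)).
  apply: bigcap_measurableType => y _.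
  by case: (W y) => // v; exact: measurable_exits.
apply/seteqP; split => w /= h y; first by case E : (W y) => [v|] //= _; exact: h.
by move=> v E; have := h y I; rewrite E.
Qed.

Lemma measurable_final_match W k : measurable (final_match X W k).
Proof.
rewrite (_ : final_match X W k = \bigcup_M
  \bigcap_(m in [set m | (M <= m)%N]) words_match X W k m).
  apply: bigcup_measurable => M _; apply: bigcap_measurableType => m _.
  exact: measurable_words_match.
by apply/seteqP; split => w; [move=> [M hM]; exists M|move=> [M _ hM]; exists M].
Qed.

(** The cylinder extended by any other site is null because the two step probabilities add up to
    one. *)
Lemma pr_cyl_split s z A : measurable A ->
  pr P (cyl (rcons s z) `&` A) =
  pr P (cyl (rcons (rcons s z) z.+1) `&` A) +
  pr P (cyl (rcons (rcons s z) z.-1) `&` A).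
Proof.
move=> mA; set C := cyl (rcons s z).
set C1 := cyl (rcons _ z.+1); set C2 := cyl (rcons _ z.-1).
have mC : measurable C := measurable_cyl _.
have mC1 : measurable C1 := measurable_cyl _.
have mC2 : measurable C2 := measurable_cyl _.
have C1C : C1 `<=` C by rewrite /C1 cyl_rcons => w [].
have C2C : C2 `<=` C by rewrite /C2 cyl_rcons => w [].
have C12 : C1 `&` C2 = set0.
  apply/seteqP; split => // w; rewrite /C1 /C2 !cyl_rcons.
  by move=> [[_ /= e1] [_ /= e2]]; rewrite e1 in e2; lia.
have mU : measurable (C1 `|` C2) by exact: measurableU.
have N0 : pr P (C `\` (C1 `|` C2)) = 0.
  rewrite prDI// (_ : C `&` _ = C1 `|` C2); last first.
    by apply/seteqP; split => w; [case|move=> [] h; split; auto; [left|right]].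
  rewrite prU// !pr_cyl !path_prob_rcons trans_up trans_down -mulrDr.
  by rewrite [p z + _]addrC subrK mulr1 subrr.
rewrite -prU; [|exact: measurableI|exact: measurableI|]; last first.
  by rewrite setIACA C12 set0I.
rewrite -setIUl; apply/eqP; rewrite eq_le; apply/andP; split; last first.
  apply: pr_le; [exact: measurableI|exact: measurableI|].
  by move=> w [[h|h] Aw]; split => //; [exact: C1C|exact: C2C].
rewrite -[X in _ <= X]addr0 -N0 -prU; last 3 first.
- exact: measurableI.
- exact: measurableD.
- by apply/seteqP; split => // w [[? _] []].
apply: pr_le; [exact: measurableI| |].
  by apply: measurableU; [exact: measurableI|exact: measurableD].
by move=> w [Cw Aw]; have [h|h] := pselect ((C1 `|` C2) w); [left|right].
Qed.

(** The Markov property in the form used here: whatever the history [s], the words formed from time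
    [size s] on depend only on the current site [z]. *)
Lemma pr_cyl_match m z s W :
  pr P (cyl (rcons s z) `&` words_match X W (size s) m) =
  path_prob Q (rcons s z) * match_pr m z W.
Proof.
elim: m z s W => [|m IH] z s W.
  rewrite /=; case: asboolP => h.
    rewrite (_ : words_match _ _ _ _ = setT) ?setIT ?pr_cyl ?mulr1//.
    by apply/seteqP; split => // w _ y v /h ->.
  rewrite (_ : words_match _ _ _ _ = set0) ?setI0 ?mulr0.
    by rewrite /pr measure0.
  by apply/seteqP; split => // w hw; apply: h => y v /hw <-.
rewrite pr_cyl_split; last exact: measurable_words_match.
set C1 := cyl (rcons _ z.+1); set C2 := cyl (rcons _ z.-1).
have h1 w : C1 w -> X (size s) w = z /\ X (size s).+1 w = z.+1.
  by rewrite /C1 !cyl_rcons size_rcons => -[[_ /= ->] /= ->].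
have h2 w : C2 w -> X (size s) w = z /\ X (size s).+1 w = z.-1.
  by rewrite /C2 !cyl_rcons size_rcons => -[[_ /= ->] /= ->].
have i1 W' : pr P (C1 `&` words_match X W' (size s).+1 m) =
    path_prob Q (rcons s z) * (p z * match_pr m z.+1 W').
  have := IH z.+1 (rcons s z) W'.
  by rewrite size_rcons => ->; rewrite path_prob_rcons trans_up mulrA.
have i2 W' : pr P (C2 `&` words_match X W' (size s).+1 m) =
    path_prob Q (rcons s z) * ((1 - p z) * match_pr m z.-1 W').
  have := IH z.-1 (rcons s z) W'.
  by rewrite size_rcons => ->; rewrite path_prob_rcons trans_down mulrA.
have pr0 : pr P set0 = 0 by rewrite /pr measure0.
have ltz : (z.-1 == z.+1) = false by apply/eqP; lia.
have eqz : (z.+1 == z.+1) = true by exact: eqxx.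
(* The step agrees with the specification: [W'] drops the first letter [c] at [z], or [z] is
   unconstrained. *)
have other C x c W' : (forall w, C w -> X (size s) w = z /\ X (size s).+1 w = x) ->
    ((forall v, W z = Some v -> exists2 v', v = c :: v' & W' z = Some v') /\
    (W z = None -> W' z = None)) ->
    (x == z.+1) = c -> (forall y, y != z -> W' y = W y) ->
    C `&` words_match X W (size s) m.+1 = C `&` words_match X W' (size s).+1 m.
  move=> hC [hz hz'] hc hW; apply/seteqP; split => w [Cw hw]; split => // y v;
    have [e1 e2] := hC _ Cw.
    have [->|yz] := eqVneq y z.
      case E : (W z) => [v1|]; last by rewrite hz'.
      have [v' ev ->] := hz _ E => -[<-]; have := hw _ _ E.
      by rewrite exitsS e1 eqxx ev => -[].
    rewrite hW// => /hw; rewrite exitsS e1 ifF//.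
    by apply/negbTE; rewrite eq_sym.
  have [->|yz] := eqVneq y z.
    move=> E; have [v' -> E'] := hz _ E.
    by rewrite exitsS e1 eqxx (hw _ _ E') e2 hc.
  rewrite -(hW _ yz) => /hw; rewrite exitsS e1 ifF//.
  by apply/negbTE; rewrite eq_sym.
(* The step contradicts it; the default [~~ c] of [head] also covers an exhausted word at [z]. *)
have bad C x c v : (forall w, C w -> X (size s) w = z /\ X (size s).+1 w = x) ->
    W z = Some v -> (x == z.+1) = c -> head (~~ c) v = ~~ c ->
    C `&` words_match X W (size s) m.+1 = set0.
  move=> hC Wz hc hv; apply/seteqP; split => // w [Cw /(_ _ _ Wz)].
  have [e1 e2] := hC _ Cw; rewrite exitsS e1 eqxx e2 hc => e.
  by move: hv; rewrite -e /=; case: (c).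
have updz v y : y != z -> upd W z v y = W y by rewrite /upd => /negbTE ->.
rewrite /=; case E : (W z) => [[|[] v]|].
- by rewrite (bad C1 z.+1 true [::])// (bad C2 z.-1 false [::])// pr0 addr0 mulr0.
- rewrite (bad C2 z.-1 false (true :: v))// pr0 addr0 -i1; congr pr.
  apply: (other C1 z.+1 true) => //; last exact: updz.
  by rewrite E; split => // _ [<-]; exists v => //; rewrite /upd eqxx.
- rewrite (bad C1 z.+1 true (false :: v))// pr0 add0r -i2; congr pr.
  apply: (other C2 z.-1 false) => //; last exact: updz.
  by rewrite E; split => // _ [<-]; exists v => //; rewrite /upd eqxx.
- rewrite mulrDr -i1 -i2; congr (pr P _ + pr P _).
    by apply: (other C1 z.+1 true) => //; rewrite E.
  by apply: (other C2 z.-1 false) => //; rewrite E.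
Qed.

Lemma path_prob_exists z : exists s, 0 < path_prob Q (rcons s z).
Proof.
elim: z => [|z [s hs]]; first by exists [::]; rewrite /= mulr1.
exists (rcons s z); rewrite path_prob_rcons trans_up mulr_gt0//; exact: pseq_gt0.
Qed.

Definition final_pr (z : nat) (W : wordspec) : R :=
  lim (match_pr m z W @[m --> \oo]).

Let cyl_match_cvg s z W :
  path_prob Q (rcons s z) * match_pr m z W @[m --> \oo] -->
  pr P (cyl (rcons s z) `&` final_match X W (size s)).
Proof.
under eq_fun do rewrite -pr_cyl_match.
have mC := measurable_cyl (rcons s z).
apply: pr_cvg_eventually.
- by move=> n; apply: measurableI => //; exact: measurable_words_match.
- by apply: measurableI => //; exact: measurable_final_match.
move=> w; have [M hM] := words_match_final X W (size s) w.
by exists M => n /hM [h1 h2]; split => -[Cw h]; split; auto.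
Qed.

(** [match_pr] need not be monotone in the horizon. Multiplied by the positive probability of a path
    from [0] to [z], it is the probability of events that stabilise pointwise, hence it
    converges. *)
Lemma match_pr_cvg z W : match_pr m z W @[m --> \oo] --> final_pr z W.
Proof.
have [s hs] := path_prob_exists z.
have h := cyl_match_cvg s z W.
suff : cvgn (fun m => match_pr m z W : R) by [].
apply/cvg_ex; exists ((path_prob Q (rcons s z))^-1 *
  pr P (cyl (rcons s z) `&` final_match X W (size s))).
have -> : (fun m => match_pr m z W) = (fun m => (path_prob Q (rcons s z))^-1 *
    (path_prob Q (rcons s z) * match_pr m z W)).
  by apply/funext => m; rewrite mulKf// gt_eqF.
by apply: cvgM => //; exact: cvg_cst.
Qed.

Lemma pr_final_match W : pr P (final_match X W 0) = final_pr 0 W.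
Proof.
have mF := measurable_final_match W 0.
have e1 : path_prob Q [:: 0%N] = 1 by rewrite /= mulr1.
have mC := measurable_cyl [:: 0%N].
have h := cyl_match_cvg [::] 0%N W.
have e2 : (fun m => path_prob Q (rcons [::] 0%N) * match_pr m 0 W) =
    (fun m => match_pr m 0 W) by apply/funext => m; rewrite e1 mul1r.
rewrite e2 in h.
have -> : pr P (final_match X W 0) =
    pr P (cyl [:: 0%N] `&` final_match X W 0).
  rewrite setIC; apply/eqP; rewrite -subr_eq0 -prDI//.
  rewrite eq_le pr_ge0 andbT.
  have -> : 0 = pr P (setT `\` cyl [:: 0%N]).
    by rewrite prDI// setTI pr_setT pr_cyl e1 subrr.
  apply: pr_le; [exact: measurableD|exact: measurableD|by move=> w []].
by rewrite /final_pr; apply/esym/cvg_lim.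
Qed.

End Walk.

(** * One-step equations and explicit values over an infinite horizon *)

Section FinalEquations.
Context {R : realType}.
Local Notation p := (@pseq R).
Local Notation fp := (@final_pr R).
Hypothesis fp_cvg : forall z W, match_pr m z W @[m --> \oo] --> fp z W.

Let fp_shift z W : match_pr m.+1 z W @[m --> \oo] --> fp z W.
Proof. by rewrite (cvg_shiftS (fun m => match_pr m z W : R)). Qed.

Let fp_unique z W (l : R) : match_pr m.+1 z W @[m --> \oo] --> l -> fp z W = l.
Proof. by move=> h; apply: (cvg_unique _ (fp_shift z W) h). Qed.

Lemma final_harmonic z W : W z = None -> harmonic_at (fp^~ W) z.
Proof.
move=> Wz; apply: fp_unique => /=; rewrite Wz.
by apply: cvgD; apply: cvgM => //; exact: cvg_cst.
Qed.

Lemma final_nil z W : W z = Some [::] -> fp z W = 0.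
Proof. by move=> Wz; apply: fp_unique => /=; rewrite Wz; exact: cvg_cst. Qed.

Lemma final_up z W v : W z = Some (true :: v) ->
  fp z W = p z * fp z.+1 (upd W z v).
Proof.
move=> Wz; apply: fp_unique => /=; rewrite Wz.
by apply: cvgM => //; exact: cvg_cst.
Qed.

Lemma final_down z W v : W z = Some (false :: v) ->
  fp z W = (1 - p z) * fp z.-1 (upd W z v).
Proof.
move=> Wz; apply: fp_unique => /=; rewrite Wz.
by apply: cvgM => //; exact: cvg_cst.
Qed.

Let fp_le z W (c : R) : (forall m, match_pr m z W <= c) -> fp z W <= c.
Proof.
move=> h; apply: limr_le; first by apply: cvgP; exact: fp_cvg.
exact: nearW.
Qed.

Let fp_ge z W (c : R) : (forall m, c <= match_pr m z W) -> c <= fp z W.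
Proof.
move=> h; apply: limr_ge; first by apply: cvgP; exact: fp_cvg.
exact: nearW.
Qed.

Lemma final_ge0 z W : 0 <= fp z W.
Proof. by apply: fp_ge => m; case/andP: (@match_pr_itv R m z W). Qed.

Lemma final_le1 z W : fp z W <= 1.
Proof. by apply: fp_le => m; case/andP: (@match_pr_itv R m z W). Qed.

Lemma final_above y W : (2 <= y)%N -> (forall z, (y < z)%N -> W z = None) ->
  forall j, (y + j)%:R * fp (y + j)%N W =
    y%:R * fp y W + j%:R * (y.+1%:R * fp y.+1 W - y%:R * fp y W).
Proof.
move=> y2 h j; apply: (harmonic_affine (fp^~ W) y (y + j) j) => //; first lia.
by move=> z hz; apply: final_harmonic; apply: h; lia.
Qed.

(** Above [y], [z * fp z] is affine. It is bounded because a return to [y] is required, so its slope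
    is at most [0], and it is nonnegative, so its slope is at least [0]. *)
Lemma final_return y W b v : (2 <= y)%N -> (forall z, (y < z)%N -> W z = None) ->
  W y = Some (b :: v) -> y.+1%:R * fp y.+1 W = y%:R * fp y W.
Proof.
move=> y2 h Wy; have e := final_above _ _ y2 h.
set D := y.+1%:R * fp y.+1 W - y%:R * fp y W.
suff -> : y.+1%:R * fp y.+1 W = y%:R * fp y W + D.
  suff -> : D = 0 by rewrite addr0.
  have D1 : D <= 0.
    apply: (affine_bounded_slope (y%:R * fp y W) _ y%:R) => j.
    have yj : 0 < (y + j)%:R :> R by rewrite ltr0n; lia.
    rewrite -e -ler_pdivlMl// mulrC.
    by apply: fp_le => m; apply: (match_pr_hit_le _ _ _ y b v) => //; lia.
  have D2 : - D <= 0.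
    apply: (affine_bounded_slope (- (y%:R * fp y W)) _ 0) => j.
    have := mulr_ge0 (ler0n R (y + j)) (final_ge0 (y + j) W).
    by rewrite e -/D; lra.
  by apply/eqP; rewrite eq_le D1 -oppr_le0.
by rewrite /D addrC subrK.
Qed.

(** Here the affine function vanishes at [y]. Its slope is at most [1] since probabilities are, and
    at least [1] by [match_pr_escape_ge]. *)
Lemma final_escape y W : (2 <= y)%N -> W y = Some [::] ->
  (forall x v, W x = Some v -> v = [::] /\ (x <= y)%N) ->
  fp y.+1 W = y.+1%:R^-1.
Proof.
move=> y2 Wy h.
have h' z : (y < z)%N -> W z = None.
  by case E : (W z) => [v|] // yz; have [_] := h _ _ E; lia.
have e := final_above _ _ y2 h'; rewrite final_nil// mulr0 in e.
have y0 : 0 < y.+1%:R :> R by rewrite ltr0n.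
have D1 : y.+1%:R * fp y.+1 W - 1 <= 0.
  apply: (affine_bounded_slope 0 _ y%:R) => j.
  have := final_le1 (y + j) W.
  have yj : 0 <= (y + j)%:R :> R by [].
  move=> /(ler_wpM2l yj); rewrite e natrD.
  by move: (y.+1%:R * _) => a ?; lra.
have D2 : y.+1%:R^-1 <= fp y.+1 W.
  have -> : y.+1%:R^-1 = 1 - y%:R / y.+1%:R :> R.
    by rewrite -[y.+1%:R]natr1; field; rewrite natr1 gt_eqF.
  by apply: fp_ge => m; apply: match_pr_escape_ge => //; lia.
apply/eqP; rewrite eq_le D2 andbT -(ler_pM2l y0) divff ?gt_eqF//.
by rewrite -subr_le0.
Qed.

(** Stepping up and coming back has probability [p y * y / (y + 1) = 1 / 2]. *)
Lemma final_top_up y W b v : (2 <= y)%N -> (forall z, (y < z)%N -> W z = None) ->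
  W y = Some [:: true, b & v] -> fp y W = 2^-1 * fp y (upd W y (b :: v)).
Proof.
move=> y2 h Wy; rewrite (final_up _ _ _ Wy).
have h' z : (y < z)%N -> upd W y (b :: v) z = None.
  by move=> yz; rewrite /upd ifF; [exact: h|apply/eqP; lia].
have e : upd W y (b :: v) y = Some (b :: v) by rewrite /upd eqxx.
have := final_return _ _ _ _ y2 h' e; rewrite pseqE// mulrAC => ->.
have y0 : y%:R != 0 :> R by rewrite pnatr_eq0; lia.
by field.
Qed.

Lemma final_top_last y W : (2 <= y)%N -> W y = Some [:: true] ->
  (forall x v, W x = Some v -> x = y \/ (v = [::] /\ (x <= y)%N)) ->
  fp y W = (2 * y%:R)^-1.
Proof.
move=> y2 Wy h; rewrite (final_up _ _ _ Wy) final_escape//.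
- have y0 : y%:R != 0 :> R by rewrite pnatr_eq0; lia.
  have y1 : y.+1%:R != 0 :> R by rewrite pnatr_eq0.
  by rewrite pseqE//; field; rewrite y0 nat1r.
- by rewrite /upd eqxx.
- move=> x v; rewrite /upd; case: eqP => [-> [<-]//|ne /h[]//].
Qed.

Lemma final_top_blocked y x W b v : (x < y)%N -> W y = Some [:: true] ->
  W x = Some (b :: v) -> fp y W = 0.
Proof.
move=> xy Wy Wx; rewrite (final_up _ _ _ Wy).
suff -> : fp y.+1 (upd W y [::]) = 0 by rewrite mulr0.
apply/eqP; rewrite eq_le final_ge0 andbT; apply: fp_le => m.
rewrite (match_pr_blocked _ _ _ x y b v)//; last by rewrite /upd ifF//; apply/eqP; lia.
by rewrite /upd eqxx.
Qed.

Lemma final_below x W : (forall z, (z < x)%N -> W z = None) ->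
  forall z, (z <= x)%N -> fp z W = fp x W.
Proof.
move=> h; have c : forall z, (z <= x)%N -> fp z W = fp 0%N W.
  by apply: (harmonic_const (fp^~ W)) => z /h; exact: final_harmonic.
by move=> z /c ->; rewrite c.
Qed.

(** After a step down the walk is sure to return to [x], so only the step itself is paid for. *)
Lemma final_bottom_down x W v : (forall z, (z < x)%N -> W z = None) ->
  W x = Some (false :: v) -> fp x W = (1 - p x) * fp x (upd W x v).
Proof.
move=> h Wx; rewrite (final_down _ _ _ Wx); congr (_ * _).
apply: final_below; last exact: leq_pred.
by move=> z zx; rewrite /upd ifF; [exact: h|apply/eqP; lia].
Qed.

Lemma final_between x y z W : (2 <= x)%N -> (x <= z <= y)%N ->
  (forall z, (x < z < y)%N -> W z = None) ->
  (y - x)%:R * (z%:R * fp z W) =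
  (y - z)%:R * (x%:R * fp x W) + (z - x)%:R * (y%:R * fp y W).
Proof.
move=> x2 hz h; apply: (harmonic_interpolation (fp^~ W)) => //; first lia.
by move=> i /h; exact: final_harmonic.
Qed.

(** A step up followed by the exit from the interval between [x] and [y]. The weight [x] and
    [p x = (x + 1) / (2 x)] combine into [(x + 1) / 2], so the weighted values satisfy the gambler's
    ruin of simple random walk. *)
Lemma final_mid_up x y W v (dl := (y - x)%:R^-1 : R) : (2 <= x < y)%N ->
  (forall z, (x < z < y)%N -> W z = None) -> W x = Some (true :: v) ->
  2 * (x%:R * fp x W) = (1 - dl) * (x%:R * fp x (upd W x v)) +
     dl * (y%:R * fp y (upd W x v)).
Proof.
move=> /andP[x2 xy] h Wx; rewrite (final_up _ _ _ Wx).
set W' := upd W x v.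
have h' z : (x < z < y)%N -> W' z = None.
  by move=> hz; rewrite /W' /upd ifF; [exact: h|apply/eqP; lia].
have hxy : (x <= x.+1 <= y)%N by lia.
have := final_between _ _ _ _ x2 hxy h'.
have x0 : x%:R != 0 :> R by rewrite pnatr_eq0; lia.
have d0 : (y - x)%:R != 0 :> R by rewrite pnatr_eq0; lia.
rewrite subSnn mul1r (_ : y - x.+1 = y - x - 1)%N; last lia.
rewrite (natrB _ (_ : (1 <= y - x)%N)) ?subn_gt0// => e.
have -> : 2 * (x%:R * (p x * fp x.+1 W')) = x.+1%:R * fp x.+1 W'.
  by rewrite pseqE//; field.
rewrite /dl; move: ((y - x)%:R) d0 e => D D0 e.
by apply: (mulfI D0); rewrite e; field.
Qed.

Lemma final_mid_down x y W v (dl := (y - x)%:R^-1 : R) : (2 <= x < y)%N ->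
  (forall z, (x < z < y)%N -> W z = None) -> W y = Some (false :: v) ->
  2 * (y%:R * fp y W) = dl * (x%:R * fp x (upd W y v)) +
     (1 - dl) * (y%:R * fp y (upd W y v)).
Proof.
move=> /andP[x2 xy] h Wy; rewrite (final_down _ _ _ Wy).
set W' := upd W y v.
have h' z : (x < z < y)%N -> W' z = None.
  by move=> hz; rewrite /W' /upd ifF; [exact: h|apply/eqP; lia].
have hxy : (x <= y.-1 <= y)%N by lia.
have := final_between _ _ _ _ x2 hxy h'.
have y0 : y%:R != 0 :> R by rewrite pnatr_eq0; lia.
have d0 : (y - x)%:R != 0 :> R by rewrite pnatr_eq0; lia.
rewrite (_ : y - y.-1 = 1)%N ?mul1r; last lia.
rewrite (_ : y.-1 - x = y - x - 1)%N; last lia.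
rewrite (natrB _ (_ : (1 <= y - x)%N)) ?subn_gt0// => e.
have -> : 2 * (y%:R * ((1 - p y) * fp y.-1 W')) = y.-1%:R * fp y.-1 W'.
  by rewrite qseqE; [field|lia].
rewrite /dl; move: ((y - x)%:R) d0 e => D D0 e.
by apply: (mulfI D0); rewrite e; field.
Qed.

(** The site [x] has just been left for good, so from [x + 1] the walk must reach the next site [y]
    before [x]: interpolation with value [0] at [x]. The weight [y] cancels against the [1 / (2 y)]
    of the induction hypothesis and leaves [renewal_u (y - x)]. *)
Lemma final_chain ys x W : (2 <= x)%N -> path ltn x ys -> W x = Some [::] ->
  (forall y, y \in ys -> W y = Some [:: true]) ->
  (forall z, (x < z)%N -> z \notin ys -> W z = None) ->
  (forall z v, (z < x)%N -> W z = Some v -> v = [::]) ->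
  p x * fp x.+1 W = (2 * x%:R)^-1 * gap_prod renewal_u x ys.
Proof.
elim: ys x W => [|y ys IH] x W x2 /= hp Wx Wys Wn Wb.
  have x0 : x%:R != 0 :> R by rewrite pnatr_eq0; lia.
  have x1 : x.+1%:R != 0 :> R by rewrite pnatr_eq0.
  rewrite final_escape//; first by rewrite pseqE//; field; rewrite x0 nat1r.
  move=> z v; have [zx|zx|->] := ltngtP z x.
  - by move=> /Wb ->//; split => //; lia.
  - by rewrite Wn.
  - by rewrite Wx => -[<-].
move: hp => /andP[xy hp].
have Wy : W y = Some [:: true] by apply: Wys; rewrite mem_head.
have gt z : z \in ys -> (y < z)%N.
  by move: hp; rewrite (path_sortedE ltn_trans) => /andP[/allP h _] /h.
have Wm z : (x < z < y)%N -> W z = None.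
  move=> hz; apply: Wn; first lia.
  rewrite inE; apply/norP; split; first by apply/eqP; lia.
  by apply/negP => /gt; lia.
have hxy : (x <= x.+1 <= y)%N by lia.
have := final_between _ _ _ _ x2 hxy Wm.
rewrite subSnn mul1r (final_nil x)// !mulr0 add0r (final_up _ _ _ Wy).
have y2 : (2 <= y)%N by lia.
have -> := IH y (upd W y [::]) y2 hp.
- have x0 : x%:R != 0 :> R by rewrite pnatr_eq0; lia.
  have y0 : y%:R != 0 :> R by rewrite pnatr_eq0; lia.
  have d0 : (y - x)%:R != 0 :> R by rewrite pnatr_eq0; lia.
  have -> : renewal_u (y - x) = (2 * (y - x)%:R)^-1 :> R.
    by case E : (y - x)%N => //; move: d0; rewrite E eqxx.
  move: (gap_prod _ y ys) => g e.
  have -> : p x * fp x.+1 W = (x.+1%:R * fp x.+1 W) / (2 * x%:R).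
    by rewrite pseqE//; field.
  have -> : x.+1%:R * fp x.+1 W = (y - x)%:R^-1 * (y%:R * ((2 * y%:R)^-1 * g)).
    by apply: (mulfI d0); rewrite e mulVKf.
  by move: ((y - x)%:R) d0 => D D0; field; rewrite x0 y0 D0.
- by rewrite /upd eqxx.
- move=> z hz; rewrite /upd ifF; last by apply/eqP; have := gt _ hz; lia.
  by apply: Wys; rewrite inE hz orbT.
- move=> z yz zys; rewrite /upd ifF; last by apply/eqP; lia.
  apply: Wn; first lia.
  by rewrite inE negb_or zys andbT; apply/eqP; lia.
- move=> z v zy; rewrite /upd ifF; last by apply/eqP; lia.
  have [zx|zx|->] := ltngtP z x.
  + exact: Wb.
  + by rewrite Wm//; lia.
  + by rewrite Wx => -[].
Qed.

End FinalEquations.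

(** * The linear recursion for the words at two sites *)

Section PairRecursion.
Context {R : realType}.
(** For words [v] still due at [x] and [v'] at [y], [a] and [b] stand for the final probabilities
    from [x] and from [y], multiplied by the starting site and by [2] per remaining letter;
    [dl = 1 / (y - x)] and [th = 1 - 1 / x]. So normalised, the equations at [x] and [y] have
    coefficients in [[0, 1]]. *)
Variables (a b : seq bool -> seq bool -> R) (dl th : R).
Hypotheses (dl01 : 0 <= dl <= 1) (th01 : 0 <= th <= 1).
Hypotheses (a_nil : forall v', a [::] v' = 0)
  (a_up : forall v v', a (true :: v) v' = (1 - dl) * a v v' + dl * b v v')
  (a_down : forall v v', a (false :: v) v' = th * a v v')
  (b_nil : forall v, b v [::] = 0)
  (b_down : forall v v', b v (false :: v') = dl * a v v' + (1 - dl) * b v v')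
  (b_up : forall v c v', b v [:: true, c & v'] = b v (c :: v'))
  (b_last : b [::] [:: true] = 1)
  (b_blocked : forall c v, b (c :: v) [:: true] = 0).

Let dl0 : 0 <= dl. Proof. by case/andP: dl01. Qed.
Let dl1 : 0 <= 1 - dl. Proof. by case/andP: dl01; rewrite subr_ge0. Qed.

Lemma pair_itv v v' : (0 <= a v v' <= 1) /\ (0 <= b v v' <= 1).
Proof.
have conv (x y : R) : 0 <= x <= 1 -> 0 <= y <= 1 -> 0 <= dl * x + (1 - dl) * y <= 1.
  move=> /andP[x0 x1] /andP[y0 y1]; rewrite addr_ge0 ?mulr_ge0//=.
  by have := ler_wpM2l dl0 x1; have := ler_wpM2l dl1 y1; rewrite !mulr1 => *; lra.
have [n] := ubnP (size v + size v'); elim: n v v' => // n IH v v' hn.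
have z01 : (0 : R) <= 0 <= (1 : R) by rewrite lexx ler01.
split.
  case: v hn => [|[] v] hn; first by rewrite a_nil.
    have /IH[ha hb] : (size v + size v' < n)%N by rewrite /= in hn; lia.
    by rewrite a_up addrC; exact: conv.
  have /IH[/andP[ha ha'] _] : (size v + size v' < n)%N by rewrite /= in hn; lia.
  case/andP: th01 => t0 t1.
  by rewrite a_down mulr_ge0//= mulr_ile1.
case: v' hn => [|[] [|c v']] hn.
- by rewrite b_nil.
- by case: v hn => [|c v] _; rewrite ?b_last ?b_blocked// lexx ler01.
- by rewrite b_up; apply: (IH v (c :: v') _).2; rewrite /= in hn *; lia.
- have /IH[ha hb] : (size v + size (Nil bool) < n)%N by rewrite /= in hn *; lia.
  by rewrite b_down; exact: conv.
- have /IH[ha hb] : (size v + size (c :: v') < n)%N by rewrite /= in hn *; lia.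
  by rewrite b_down; exact: conv.
Qed.

Let a0 v v' : 0 <= a v v'. Proof. by have [/andP[]] := pair_itv v v'. Qed.
Let b0 v v' : 0 <= b v v'. Proof. by have [_ /andP[]] := pair_itv v v'. Qed.
Let b1 v v' : b v v' <= 1. Proof. by have [_ /andP[]] := pair_itv v v'. Qed.

Let a_up_le v v' : a (true :: v) v' <= a v v' + dl * b v v'.
Proof.
by rewrite a_up lerD2r ler_piMl// gerBl.
Qed.

Let a_down_le v v' : a (false :: v) v' <= a v v'.
Proof. by rewrite a_down; case/andP: th01 => *; rewrite ler_piMl. Qed.

Let a_le_size v v' : a v v' <= (size v)%:R * dl.
Proof.
elim: v => [|[] v IH] /=; first by rewrite a_nil mul0r.
  apply: (le_trans (a_up_le _ _)); rewrite -natr1 mulrDl mul1r lerD//.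
  by rewrite ler_piMr.
apply: (le_trans (a_down_le _ _)); apply: (le_trans IH).
by rewrite ler_wpM2r// ler_nat.
Qed.

(** At [y] with letters still due at [x], the walk can reach [x] only after one of the down letters
    of [v'], at cost [dl]; the way back to [y] costs another [dl] through [a_le_size]. *)
Let b_le_sqr c v v' :
  b (c :: v) v' <= (size (c :: v))%:R * (size v')%:R * dl ^+ 2.
Proof.
elim: v' => [|[] v' IH]; first by rewrite b_nil mulr0 mul0r.
  case: v' IH => [|c' v'] IH.
    by rewrite b_blocked mulr_ge0 ?mulr_ge0 ?sqr_ge0.
  rewrite b_up; apply: (le_trans IH).
  by rewrite ler_wpM2r ?sqr_ge0// ler_wpM2l// ler_nat.
rewrite b_down; apply: (@le_trans _ _ (dl * ((size (c :: v))%:R * dl) + b (c :: v) v')).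
  apply: lerD; first exact: ler_wpM2l.
  by rewrite ler_piMl// gerBl.
apply: (le_trans (lerD (lexx _) IH)).
rewrite [size (false :: v')]/= -[(size v').+1%:R]natr1; lra.
Qed.

(* The main term comes from passing from [x] to [y] only once; every further
   round trip costs a factor [dl ^+ 2]. *)
Lemma pair_le v v' : a v v' <= dl * (1 + (size v ^ 2 * size v')%:R * dl ^+ 2).
Proof.
have rhs0 n : 0 <= dl * (1 + n%:R * dl ^+ 2).
  by rewrite mulr_ge0// addr_ge0// mulr_ge0// sqr_ge0.
elim: v => [|[] v IH]; first by rewrite a_nil.
  case: v IH => [|c v] IH.
    rewrite a_up a_nil mulr0 add0r ler_wpM2l//.
    by apply: (le_trans (b1 _ _)); rewrite lerDl mulr_ge0 ?sqr_ge0.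
  apply: (le_trans (a_up_le _ _)).
  apply: (@le_trans _ _ (dl * (1 + (size (c :: v) ^ 2 * size v')%:R * dl ^+ 2) +
     dl * ((size (c :: v))%:R * (size v')%:R * dl ^+ 2))).
    by apply: lerD => //; apply: ler_wpM2l.
  rewrite -mulrDr ler_wpM2l// -addrA lerD2l -mulrDl ler_wpM2r ?sqr_ge0//.
  by rewrite -natrM -natrD ler_nat /=; nia.
apply: (le_trans (a_down_le _ _)); apply: (le_trans IH).
rewrite ler_wpM2l// lerD2l ler_wpM2r ?sqr_ge0// ler_nat /=; nia.
Qed.

Let b_nil_ge v' : last false v' -> (1 - dl) ^+ size v' <= b [::] v'.
Proof.
have l1 : 1 - dl <= 1 by rewrite gerBl.
elim: v' => [//|c v' IH] hl.
case: v' IH hl => [|c' v'] IH hl.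
  by move: hl => /= -> ; rewrite b_last expr1.
have h := IH hl.
have h2 : (1 - dl) ^+ (size (c' :: v')).+1 <= (1 - dl) * b [::] (c' :: v').
  by rewrite exprS ler_wpM2l.
apply: (le_trans h2); case: c {hl}.
  by rewrite b_up ler_piMl.
by rewrite b_down a_nil mulr0 add0r.
Qed.

(** Keeps only the trajectories that complete [v] at [x], then cross to [y] once and never come
    back. *)
Let a_ge v v' : last false v -> last false v' ->
  dl * ((1 - dl) ^+ (size v + size v') * th ^+ size v) <= a v v'.
Proof.
have l1 : 1 - dl <= 1 by rewrite gerBl.
have [t0 t1] := andP th01.
move=> + hv'; elim: v => [//|c v IH] hl.
have e0 n m : 0 <= (1 - dl) ^+ n * th ^+ m by rewrite mulr_ge0 ?exprn_ge0.
case: v IH hl => [|c' v] IH hl.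
  move: hl => /= ->; rewrite a_up a_nil mulr0 add0r ler_wpM2l//.
  apply: (le_trans _ (b_nil_ge _ hv')); rewrite add1n exprS expr1.
  rewrite mulrAC ler_piMl ?exprn_ge0// mulr_ile1//.
have h := IH hl.
rewrite [size (c :: _)]/= addSn [(1 - dl) ^+ _.+1]exprS [th ^+ _.+1]exprS.
move: h; set E := (1 - dl) ^+ _; set F := th ^+ _ => h.
have EF0 : 0 <= dl * (E * F) by rewrite !mulr_ge0 ?exprn_ge0.
case: c {hl}.
  rewrite a_up; apply: ler_wpDr; first exact: mulr_ge0.
  apply: (le_trans _ (ler_wpM2l dl1 h)).
  rewrite [leLHS](_ : _ = th * ((1 - dl) * (dl * (E * F)))); last ring.
  by rewrite ler_piMl// mulr_ge0.
rewrite a_down; apply: (le_trans _ (ler_wpM2l t0 h)).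
rewrite [leLHS](_ : _ = (1 - dl) * (th * (dl * (E * F)))); last ring.
by rewrite ler_piMl// mulr_ge0.
Qed.

Lemma pow_ge_bernoulli (s : R) n : 0 <= s <= 1 -> 1 - n%:R * s <= (1 - s) ^+ n.
Proof.
move=> /andP[s0 s1]; elim: n => [|n IH]; first by rewrite mul0r subr0 expr0.
rewrite exprS; apply: (@le_trans _ _ ((1 - s) * (1 - n%:R * s))).
  have h : 0 <= n%:R * s * s by rewrite !mulr_ge0.
  by rewrite -natr1; nra.
by rewrite ler_wpM2l// subr_ge0.
Qed.

Lemma pair_ge v v' : last false v -> last false v' ->
  dl * (1 - (size v + size v')%:R * dl - (size v)%:R * (1 - th)) <= a v v'.
Proof.
move=> h h'; apply: (le_trans _ (a_ge _ _ h h')); apply: ler_wpM2l => //.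
have [t0 t1] := andP th01.
have e1 := pow_ge_bernoulli _ (size v + size v') dl01.
have t01 : 0 <= 1 - th <= 1 by apply/andP; split; lra.
have := pow_ge_bernoulli _ (size v) t01; rewrite subKr => e2.
have f1 : (1 - dl) ^+ (size v + size v') <= 1 by rewrite exprn_ile1// gerBl.
have f2 : th ^+ size v <= 1 by rewrite exprn_ile1.
by move: (_ ^+ (_ + _)) (th ^+ _) e1 e2 f1 f2 => x y *; nra.
Qed.

End PairRecursion.

(** * Probabilities of words at one site, at two sites, and of strong cutpoints *)

Section WordEvents.
Context {R : realType} {d : measure_display} {T : measurableType d}.
Variables (P : probability T R) (X : nat -> T -> nat).
Hypothesis Xmeas : forall k x, measurable [set w | X k w = x].
Hypothesis HX : is_markov_chain_from0 P X (trans pseq).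
Local Notation p := (@pseq R).
Local Notation fp := (@final_pr R).

Let fp_cvg z W : match_pr m z W @[m --> \oo] --> fp z W.
Proof. exact: (match_pr_cvg P X Xmeas HX). Qed.

Definition word_event (x : nat) (v : seq bool) : set T :=
  [set w | exists M, forall m, (M <= m)%N -> exits X 0 m x w = v].

Definition spec1 (x : nat) (v : seq bool) : wordspec :=
  fun z => if z == x then Some v else None.

Definition spec2 (x : nat) (v : seq bool) (y : nat) (v' : seq bool) : wordspec :=
  fun z => if z == x then Some v else if z == y then Some v' else None.

Definition spec_cut (xs : seq nat) : wordspec :=
  fun z => if z \in xs then Some [:: true] else None.

Lemma final_match_spec1 x v : final_match X (spec1 x v) 0 = word_event x v.
Proof.
apply/seteqP; split => w [M hM]; exists M => m /hM h.
  by apply: h; rewrite /spec1 eqxx.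
by move=> y v'; rewrite /spec1; case: eqP => // -> [<-].
Qed.

Lemma measurable_word_event x v : measurable (word_event x v).
Proof. by rewrite -final_match_spec1; exact: measurable_final_match. Qed.

Lemma word_event_uniq x v v' w : word_event x v w -> word_event x v' w -> v = v'.
Proof.
move=> [M hM] [M' hM']; rewrite -(hM (maxn M M')); last lia.
by rewrite (hM' (maxn M M'))//; lia.
Qed.

Lemma final_match_spec2 x v y v' : x != y ->
  final_match X (spec2 x v y v') 0 = word_event x v `&` word_event y v'.
Proof.
move=> xy; apply/seteqP; split => w.
  move=> [M hM]; split; exists M => m /hM h; apply: h.
    by rewrite /spec2 eqxx.
  by rewrite /spec2 eqxx ifF//; apply/negbTE; rewrite eq_sym.
move=> [[M hM] [M' hM']]; exists (maxn M M') => m hm z u; rewrite /spec2.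
case: eqP => [-> [<-]|_]; first by apply: hM; lia.
by case: eqP => // -> [<-]; apply: hM'; lia.
Qed.

Definition cut (x : nat) : set T := word_event x [:: true].

Lemma final_match_spec_cut xs :
  final_match X (spec_cut xs) 0 = all_in cut xs.
Proof.
elim: xs => [|x xs IH].
  by apply/seteqP; split => // w _; exists 0%N => m _ y v.
rewrite /= -IH; apply/seteqP; split => w.
  move=> [M hM]; split; exists M => m /hM h.
    by apply: h; rewrite /spec_cut mem_head.
  by move=> z v hz; apply: h; move: hz; rewrite /spec_cut inE; case: (z \in xs); rewrite ?orbT.
move=> [[M hM] [M' hM']]; exists (maxn M M') => m hm z v.
have h1 := hM m (leq_trans (leq_maxl _ _) hm).
have h2 := hM' m (leq_trans (leq_maxr _ _) hm).
rewrite /spec_cut inE; case: eqP => [-> [<-]//|_ /= hz]; exact: h2.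
Qed.

(** The input of the renewal part. Reaching the lowest site [x] from [0] costs nothing; its only
    exit, upward, hands over to [final_chain]. *)
Lemma pr_cut_chain x ys : (2 <= x)%N -> path ltn x ys ->
  pr P (cut x `&` all_in cut ys) = (2 * x%:R)^-1 * gap_prod renewal_u x ys.
Proof.
move=> x2 hp; rewrite -[_ `&` _]/(all_in cut (x :: ys)) -final_match_spec_cut.
rewrite (pr_final_match P X Xmeas HX).
have gt z : z \in ys -> (x < z)%N.
  by move: hp; rewrite (path_sortedE ltn_trans) => /andP[/allP h _] /h.
have nb z : (z < x)%N -> spec_cut (x :: ys) z = None.
  move=> zx; rewrite /spec_cut inE ifF//; apply/negbTE/norP; split.
    by apply/eqP; lia.
  by apply/negP => /gt; lia.
rewrite (final_below fp_cvg x _ nb)// (final_up fp_cvg x _ [::]); last first.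
  by rewrite /spec_cut mem_head.
apply: (final_chain fp_cvg) => //.
- by rewrite /upd eqxx.
- move=> y hy; rewrite /upd ifF; last by apply/eqP; have := gt _ hy; lia.
  by rewrite /spec_cut inE hy orbT.
- move=> z xz zys; rewrite /upd ifF; last by apply/eqP; lia.
  by rewrite /spec_cut inE (negbTE zys) orbF ifF//; apply/eqP; lia.
- move=> z v zx; rewrite /upd ifF; last by apply/eqP; lia.
  by rewrite nb.
Qed.

(** A word ending with a down step gets weight [0] through the value at the empty word: the walk
    would have to come back. *)
Fixpoint word_weight (x : nat) (v : seq bool) : R :=
  match v with
  | [::] => 0
  | true :: v' => if v' is [::] then (2 * x%:R)^-1 else 2^-1 * word_weight x v'
  | false :: v' => (1 - p x) * word_weight x v'
  end.

Lemma pr_word_event x v : (2 <= x)%N -> pr P (word_event x v) = word_weight x v.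
Proof.
move=> x2; rewrite -final_match_spec1 (pr_final_match P X Xmeas HX).
have nb u z : (z < x)%N -> spec1 x u z = None.
  by move=> zx; rewrite /spec1 ifF//; apply/eqP; lia.
have na u z : (x < z)%N -> spec1 x u z = None.
  by move=> zx; rewrite /spec1 ifF//; apply/eqP; lia.
have eu u u' : upd (spec1 x u) x u' = spec1 x u'.
  by apply/funext => z; rewrite /upd /spec1; case: eqP.
have ex u : spec1 x u x = Some u by rewrite /spec1 eqxx.
rewrite (final_below fp_cvg x _ (nb v))//.
elim: v => [|[] v IH].
- by rewrite (final_nil fp_cvg).
- case: v IH => [|c v] IH.
    apply: (final_top_last fp_cvg) => // z u.
    by rewrite /spec1; case: eqP => [->|]//; left.
  by rewrite (final_top_up fp_cvg x _ c v x2 (na _) (ex _)) eu IH.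
- by rewrite (final_bottom_down fp_cvg x _ v (nb _) (ex _)) eu IH.
Qed.

Lemma word_weight_ge0 x v : 0 <= word_weight x v.
Proof.
elim: v => [//|[] v IH] /=; last by rewrite mulr_ge0// subr_ge0 pseq_le1.
by case: v IH => [|c v] IH; rewrite ?invr_ge0 ?mulr_ge0.
Qed.

Lemma word_weight_le x v : (2 <= x)%N ->
  word_weight x v <= (last false v)%:R * 2 ^- size v / x%:R.
Proof.
move=> x2; have x0 : 0 < x%:R :> R by rewrite ltr0n; lia.
have q2 : 1 - p x <= 2^-1.
  rewrite qseqE// ler_pdivrMr ?mulr_gt0// mulKf ?lt0r_neq0// ler_nat; lia.
have q0 : 0 <= 1 - p x by rewrite subr_ge0 pseq_le1.
elim: v => [|c v IH]; first by rewrite /= !mul0r.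
case: v IH => [|c' v] IH.
  case: c => /=; last by rewrite mulr0 !mul0r.
  by rewrite mul1r expr1 invfM.
have e : (last false [:: c, c' & v])%:R * 2 ^- size [:: c, c' & v] / x%:R =
  2^-1 * ((last false (c' :: v))%:R * 2 ^- size (c' :: v) / x%:R) :> R.
  by rewrite /= [2 ^+ (size v).+2]exprS invfM; ring.
rewrite e; case: c {e}; first exact: ler_wpM2l.
change (word_weight x [:: false, c' & v]) with
  ((1 - p x) * word_weight x (c' :: v)).
apply: ler_pM => //; exact: word_weight_ge0.
Qed.

Section Pair.
Variables x y : nat.
Hypotheses (x2 : (2 <= x)%N) (xy : (x < y)%N).

Let na v v' z : (y < z)%N -> spec2 x v y v' z = None.
Proof. by move=> h; rewrite /spec2 !ifF//; apply/eqP; lia. Qed.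
Let nm v v' z : (x < z < y)%N -> spec2 x v y v' z = None.
Proof. by move=> h; rewrite /spec2 !ifF//; apply/eqP; lia. Qed.
Let nb v v' z : (z < x)%N -> spec2 x v y v' z = None.
Proof. by move=> h; rewrite /spec2 !ifF//; apply/eqP; lia. Qed.
Let updx v v' u : upd (spec2 x v y v') x u = spec2 x u y v'.
Proof. by apply/funext => z; rewrite /upd /spec2; case: eqP. Qed.
Let updy v v' u : upd (spec2 x v y v') y u = spec2 x v y u.
Proof.
apply/funext => z; rewrite /upd /spec2; case: (eqVneq z y) => // ->.
by rewrite ifF//; apply/eqP; lia.
Qed.
Let atx v v' : spec2 x v y v' x = Some v.
Proof. by rewrite /spec2 eqxx. Qed.
Let aty v v' : spec2 x v y v' y = Some v'.
Proof. by rewrite /spec2 eqxx ifF//; apply/eqP; lia. Qed.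
Let y2 : (2 <= y)%N. Proof. by lia. Qed.
Let x2y : (2 <= x < y)%N. Proof. by lia. Qed.

(** The instance of the pair recursion; [th = 2 * (1 - p x)] is the normalised cost of a down step
    at the lower site. *)
Let dl : R := (y - x)%:R^-1.
Let th : R := 1 - x%:R^-1.
Let a v v' : R := 2 ^+ (size v + size v') * (x%:R * fp x (spec2 x v y v')).
Let b v v' : R := 2 ^+ (size v + size v') * (y%:R * fp y (spec2 x v y v')).

Let x0 : 0 < x%:R :> R. Proof. by rewrite ltr0n; lia. Qed.
Let y0 : 0 < y%:R :> R. Proof. by rewrite ltr0n; lia. Qed.

Let dl01 : 0 <= dl <= 1.
Proof. by rewrite /dl invr_ge0 ler0n/= invf_le1 ?ltr0n ?ler1n; lia. Qed.

Let th01 : 0 <= th <= 1.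
Proof.
by rewrite /th gerBl invr_ge0 ler0n andbT subr_ge0 invf_le1// ler1n; lia.
Qed.

Let a_nil v' : a [::] v' = 0.
Proof. by rewrite /a (final_nil fp_cvg) ?mulr0. Qed.

Let a_up v v' : a (true :: v) v' = (1 - dl) * a v v' + dl * b v v'.
Proof.
rewrite /a /b [size (true :: v)]/= addSn exprSr -[_ * 2 * _]mulrA.
by rewrite (final_mid_up fp_cvg x y _ v x2y (nm _ _) (atx _ _)) updx /dl; ring.
Qed.

Let a_down v v' : a (false :: v) v' = th * a v v'.
Proof.
rewrite /a [size (false :: v)]/= addSn exprSr (final_bottom_down fp_cvg x _ v (nb _ _) (atx _ _)).
rewrite updx qseqE// /th (_ : x.-1%:R = x%:R - 1); first by field; rewrite gt_eqF.
by rewrite -subn1 natrB//; lia.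
Qed.

Let b_nil v : b v [::] = 0.
Proof. by rewrite /b (final_nil fp_cvg) ?mulr0. Qed.

Let b_down v v' : b v (false :: v') = dl * a v v' + (1 - dl) * b v v'.
Proof.
rewrite /a /b [size (false :: v')]/= addnS exprSr -[_ * 2 * _]mulrA.
by rewrite (final_mid_down fp_cvg x y _ v' x2y (nm _ _) (aty _ _)) updy /dl; ring.
Qed.

Let b_up v c v' : b v [:: true, c & v'] = b v (c :: v').
Proof.
rewrite /b [size (true :: _)]/= addnS exprSr (final_top_up fp_cvg y _ c v' y2 (na _ _) (aty _ _)).
by rewrite updy; field.
Qed.

Let b_last : b [::] [:: true] = 1.
Proof.
rewrite /b (final_top_last fp_cvg)//.
  by rewrite /= add0n expr1; field; rewrite gt_eqF.
move=> z u; rewrite /spec2; case: eqP => [-> [<-]|_].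
  by right; split => //; lia.
by case: eqP => // -> _; left.
Qed.

Let b_blocked c v : b (c :: v) [:: true] = 0.
Proof. by rewrite /b (final_top_blocked fp_cvg y x _ c v)// !mulr0. Qed.

Let pr_pairE v v' : pr P (word_event x v `&` word_event y v') =
  2 ^- size v * 2 ^- size v' / x%:R * a v v'.
Proof.
rewrite -final_match_spec2; last by apply/eqP; lia.
rewrite (pr_final_match P X Xmeas HX) (final_below fp_cvg x)//; last exact: nb.
rewrite /a exprD; field; rewrite gt_eqF//=.
by rewrite !expf_neq0.
Qed.

Let c0 (v v' : seq bool) : 0 <= 2 ^- size v * 2 ^- size v' / x%:R :> R.
Proof. by rewrite !mulr_ge0// ?invr_ge0 ?exprn_ge0. Qed.

Lemma pr_pair_le v v' : pr P (word_event x v `&` word_event y v') <=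
  2 ^- size v * 2 ^- size v' / x%:R *
    (dl * (1 + (size v ^ 2 * size v')%:R * dl ^+ 2)).
Proof.
rewrite pr_pairE; apply: ler_wpM2l => //.
exact: (pair_le a b dl th).
Qed.

Lemma pr_pair_ge v v' : last false v -> last false v' ->
  2 ^- size v * 2 ^- size v' / x%:R *
    (dl * (1 - (size v + size v')%:R * dl - (size v)%:R / x%:R)) <=
  pr P (word_event x v `&` word_event y v').
Proof.
move=> h h'; rewrite pr_pairE; apply: ler_wpM2l => //.
have := pair_ge a b dl th dl01 th01 a_nil a_up a_down b_nil b_down b_up b_last
  b_blocked v v' h h'.
by rewrite {1}/th subKr.
Qed.

End Pair.
End WordEvents.

(** * Harmonic sums controlling the second moment *)

Section HarmonicSums.
Context {R : realType}.

Definition harm (n : nat) : R := \sum_(1 <= m < n.+1) m%:R^-1.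

Lemma harm_ge0 n : 0 <= harm n.
Proof. by apply: sumr_ge0 => m _; rewrite invr_ge0. Qed.

Lemma harm_le n : (0 < n)%N -> harm n <= 1 + ln n%:R.
Proof.
move=> n0; have := @green_le R _ n0.
have -> : green n = 1 + 2^-1 * harm n.
  rewrite /green big_ltn//=; congr +%R; rewrite /harm mulr_sumr.
  by apply: eq_big_nat => -[|m] hm //=; rewrite invfM.
by move: (ln _) (harm n) => a b ?; lra.
Qed.

Lemma sum_inv_sqr_le n : \sum_(1 <= m < n.+1) (m%:R^-1 ^+ 2) <= 2 :> R.
Proof.
suff h : forall n, \sum_(1 <= m < n.+2) (m%:R^-1 ^+ 2) <= 2 - n.+1%:R^-1 :> R.
  case: n => [|n]; first by rewrite big_geq.
  by apply: (le_trans (h n)); rewrite gerBl invr_ge0.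
elim=> [|k IH]; first by rewrite big_nat1 invr1 expr1n; lra.
rewrite big_nat_recr//=; apply: (le_trans (lerD IH (lexx _))).
have k1 : 0 < k.+1%:R :> R by rewrite ltr0n.
have k2 : 0 < k.+2%:R :> R by rewrite ltr0n.
have : k.+1%:R^-1 - k.+2%:R^-1 = k.+1%:R^-1 * k.+2%:R^-1 :> R.
  have -> : k.+2%:R = k.+1%:R + 1 :> R by rewrite natr1.
  move: (k.+1%:R) k1 => K K0.
  by field; apply/andP; split; apply: lt0r_neq0; lra.
have : k.+2%:R^-1 ^+ 2 <= k.+1%:R^-1 * k.+2%:R^-1 :> R.
  rewrite expr2 ler_pM2r ?invr_gt0// lef_pV2 ?posrE// ler_nat; lia.
by move: (k.+1%:R^-1) (k.+2%:R^-1) => a b *; lra.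
Qed.

(** The size of what remains of the correlations of [x] and [x + m] after the leading terms cancel.
    Since [0^-1 = 0] it vanishes at [m = 0]; with truncated subtraction, [offdiag x (y - x)] is zero
    unless [x < y]. *)
Definition offdiag (x m : nat) : R :=
  x%:R^-1 * m%:R^-1 * (m%:R^-1 + x%:R^-1).

Lemma offdiag_ge0 x m : 0 <= offdiag x m.
Proof. by rewrite /offdiag !mulr_ge0// ?addr_ge0 ?invr_ge0. Qed.

(** Summing over [m] first, [1 / (x * m ^ 2)] yields [2 / x] and [1 / (x ^ 2 * m)] yields
    [harm n / x ^ 2]; each then sums over [x] to at most [2 * harm n]. *)
Lemma sum_offdiag_le n :
  \sum_(2 <= x < n.+1) \sum_(2 <= y < n.+1) offdiag x (y - x) <= 4 * harm n.
Proof.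
have row x : (2 <= x < n.+1)%N ->
    \sum_(2 <= y < n.+1) offdiag x (y - x) <= 2 * x%:R^-1 + x%:R^-1 ^+ 2 * harm n.
  move=> hx; rewrite (@big_cat_nat _ _ _ x.+1)//=; [|lia..].
  rewrite big_nat_cond big1 ?add0r; last first.
    move=> y /andP[hy _]; rewrite /offdiag (_ : y - x = 0)%N; last lia.
    by rewrite invr0 mulr0 mul0r.
  rewrite -{1}[x.+1]add1n big_addn.
  apply: (@le_trans _ _ (\sum_(1 <= m < n.+1) offdiag x m)).
    rewrite (@big_cat_nat _ _ _ (n.+1 - x) 1 n.+1)//=; [|lia..].
    rewrite -[leLHS]addr0; apply: lerD.
      by apply: ler_sum_nat => m hm; rewrite addnK.
    by apply: sumr_ge0 => m _; exact: offdiag_ge0.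
  rewrite (eq_bigr (fun m => x%:R^-1 * (m%:R^-1 ^+ 2) + x%:R^-1 ^+ 2 * m%:R^-1));
    last by move=> m _; rewrite /offdiag; ring.
  rewrite big_split -!mulr_sumr /= lerD2r mulrC ler_wpM2r ?invr_ge0//.
  exact: sum_inv_sqr_le.
apply: (le_trans (ler_sum_nat row)).
rewrite big_split -mulr_sumr -mulr_suml /=.
have h1 : \sum_(2 <= x < n.+1) x%:R^-1 <= harm n.
  rewrite /harm; case: n {row} => [|n]; first by rewrite !big_geq.
  by rewrite [leRHS]big_ltn// lerDr invr_ge0.
have h2 : \sum_(2 <= x < n.+1) x%:R^-1 ^+ 2 <= 2 :> R.
  apply: le_trans (sum_inv_sqr_le n); case: n {row h1} => [|n]; first by rewrite !big_geq.
  by rewrite [leRHS]big_ltn// lerDr sqr_ge0.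
apply: (le_trans (lerD (ler_wpM2l (ler0n R 2) h1) (ler_wpM2r (harm_ge0 n) h2))).
by lra.
Qed.

End HarmonicSums.

(** * Second moment of the difference between a word count and the cutpoint count *)

Section WordDeviation.
Context {R : realType} {d : measure_display} {T : measurableType d}.
Variables (P : probability T R) (X : nat -> T -> nat).
Hypothesis Xmeas : forall k x, measurable [set w | X k w = x].
Hypothesis HX : is_markov_chain_from0 P X (trans pseq).
Local Notation word_event := (word_event X).
Local Notation cut := (cut X).

Lemma count_indic (E : nat -> set T) a b w :
  (count_S E a b w)%:R = \sum_(a <= x < b) \1_(E x) w :> R.
Proof.
rewrite /count_S natr_sum; apply: eq_bigr => x _; rewrite indicE.
by case: asboolP => h; [rewrite mem_set|rewrite memNset].
Qed.

Variable v : seq bool.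
Hypothesis hv : last false v.

Let A : R := 2 ^+ size v.
Let s : R := (size v)%:R.
Let E (i : nat * bool) : set T := if i.2 then word_event i.1 v else cut i.1.
Let c (i : nat * bool) : R := if i.2 then A else - 2.
(** The contribution of the pair [(x, y)] to the second moment of [2 ^ |v| * A n - 2 * S n]. *)
Let corr (x y : nat) : R :=
  A ^+ 2 * pr P (word_event x v `&` word_event y v) +
  4 * pr P (cut x `&` cut y) -
  2 * A * pr P (word_event x v `&` cut y) -
  2 * A * pr P (cut x `&` word_event y v).
Let K1 : R := s ^+ 3 + 1 + 2 * (s + 1).

Let A0 : 0 < A. Proof. by rewrite exprn_gt0. Qed.
Let s0 : 0 <= s. Proof. exact: ler0n. Qed.
Let K10 : 0 <= K1.
Proof. by rewrite /K1 !addr_ge0 ?exprn_ge0 ?mulr_ge0 ?addr_ge0. Qed.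

Let corr_lt x y : (2 <= x)%N -> (x < y)%N -> corr x y <= K1 * offdiag x (y - x).
Proof.
move=> x2 xy.
have x0 : 0 < x%:R :> R by rewrite ltr0n; lia.
have := pr_pair_le P X Xmeas HX x y x2 xy v v.
have := pr_pair_le P X Xmeas HX x y x2 xy [:: true] [:: true].
have := pr_pair_ge P X Xmeas HX x y x2 xy v [:: true] hv isT.
have := pr_pair_ge P X Xmeas HX x y x2 xy [:: true] v isT hv.
rewrite /= -/(cut _) -/(cut _) -/A expr1 muln1 exp1n.
rewrite (_ : (size v ^ 2 * size v)%:R = s ^+ 3); last first.
  by rewrite -expnSr natrX.
rewrite !natrD -/s /offdiag.
have dl0 : 0 <= (y - x)%:R^-1 :> R by rewrite invr_ge0.
have dl1 : (y - x)%:R^-1 <= 1 :> R.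
  by rewrite invf_le1 ?ltr0n ?ler1n; lia.
have ix0 : 0 <= x%:R^-1 :> R by rewrite invr_ge0.
move: (y - x)%:R^-1 dl0 dl1 => D D0 D1.
rewrite /corr.
move: (pr P (word_event x v `&` word_event y v)) => p1.
move: (pr P (cut x `&` cut y)) => p2.
move: (pr P (word_event x v `&` cut y)) => p3.
move: (pr P (cut x `&` word_event y v)) => p4.
move: x%:R^-1 ix0 => I I0 h4 h3 h2 h1.
have A20 : 0 <= A ^+ 2 by rewrite sqr_ge0.
have A2 : 0 <= 2 * A by rewrite mulr_ge0// ltW.
have g1 : A ^+ 2 * p1 <= I * D * (1 + s ^+ 3 * D ^+ 2).
  apply: (le_trans (ler_wpM2l A20 h1)); rewrite le_eqVlt; apply/orP; left.
  by apply/eqP; field; rewrite gt_eqF.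
have g2 : 4 * p2 <= I * D * (1 + D ^+ 2).
  apply: (le_trans (ler_wpM2l (ler0n R 4) h2)); rewrite le_eqVlt; apply/orP; left.
  by apply/eqP; field.
have g3 : I * D * (1 - (s + 1) * D - s * I) <= 2 * A * p3.
  apply: (le_trans _ (ler_wpM2l A2 h3)); rewrite le_eqVlt; apply/orP; left.
  by apply/eqP; field; rewrite gt_eqF.
have g4 : I * D * (1 - (1 + s) * D - 1 * I) <= 2 * A * p4.
  apply: (le_trans _ (ler_wpM2l A2 h4)); rewrite le_eqVlt; apply/orP; left.
  by apply/eqP; field; rewrite gt_eqF.
(* The four constants [1 + 1 - 1 - 1] cancel here. *)
apply: (@le_trans _ _ (I * D * ((s ^+ 3 + 1) * D ^+ 2 + 2 * (s + 1) * D + (s + 1) * I))).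
  by lra.
rewrite [leRHS](_ : _ = I * D * (K1 * (D + I))); last ring.
apply: ler_wpM2l; first by rewrite mulr_ge0.
have D2 : D ^+ 2 <= D by rewrite expr2 ler_piMl.
have s3 : 0 <= s ^+ 3 + 1 by rewrite addr_ge0// exprn_ge0.
have := ler_wpM2l s3 D2; rewrite /K1.
have : 0 <= s * I by rewrite mulr_ge0.
have : 0 <= s ^+ 3 * I by rewrite mulr_ge0// exprn_ge0.
by move: (s ^+ 3) => s' *; nra.
Qed.

Let corr_sym x y : corr x y = corr y x.
Proof.
rewrite /corr [word_event y v `&` word_event x v]setIC [cut y `&` cut x]setIC.
rewrite [word_event y v `&` cut x]setIC [cut y `&` word_event x v]setIC.
by rewrite -!addrA; congr (_ + (_ + _)); rewrite addrC.
Qed.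

(** The negative cross terms are dropped; the two squares contribute [A / x] and [2 / x]. *)
Let corr_diag x : (2 <= x)%N -> corr x x <= (A + 2) * x%:R^-1.
Proof.
move=> x2; rewrite /corr !setIid.
have := @word_weight_le R x v x2; rewrite -(pr_word_event P X Xmeas HX)// hv.
have := @word_weight_le R x [:: true] x2; rewrite -(pr_word_event P X Xmeas HX)//.
rewrite /= -/(cut x) expr1 !mul1r -/A => h2 h1.
have h3 := mulr_ge0 (mulr_ge0 (ler0n R 2) (ltW A0)) (pr_ge0 P (word_event x v `&` cut x)).
have h4 := mulr_ge0 (mulr_ge0 (ler0n R 2) (ltW A0)) (pr_ge0 P (cut x `&` word_event x v)).
have A20 : 0 <= A ^+ 2 by rewrite sqr_ge0.
have := ler_wpM2l A20 h1.
rewrite (_ : A ^+ 2 * (A^-1 / x%:R) = A * x%:R^-1); last first.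
  by rewrite mulrA expr2 mulfK// gt_eqF.
move=> h5; rewrite [leRHS]mulrDl; move: (A * x%:R^-1) h5 => B h5.
by move: h2 h3 h4 h5; move: (x%:R^-1) (pr P (cut x)) => *; lra.
Qed.

Let corr_le x y : (2 <= x)%N -> (2 <= y)%N -> corr x y <=
  (A + 2) * ((x == y)%:R * x%:R^-1) +
  K1 * (offdiag x (y - x) + offdiag y (x - y)).
Proof.
have off0 z : offdiag z 0 = 0 :> R by rewrite /offdiag invr0 mulr0 mul0r.
move=> x2 y2; have [xy|yx|<-] := ltngtP x y.
- rewrite mul0r mulr0 add0r (_ : x - y = 0)%N; last lia.
  by rewrite off0 addr0; exact: corr_lt.
- rewrite mul0r mulr0 add0r (_ : y - x = 0)%N; last lia.
  by rewrite off0 add0r corr_sym; exact: corr_lt.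
- by rewrite mul1r subnn !off0 addr0 mulr0 addr0; exact: corr_diag.
Qed.

Lemma sum_corr_le n : \sum_(2 <= x < n.+1) \sum_(2 <= y < n.+1) corr x y <=
  (A + 2 + 8 * K1) * harm n.
Proof.
apply: (@le_trans _ _ (\sum_(2 <= x < n.+1) \sum_(2 <= y < n.+1)
  ((A + 2) * ((x == y)%:R * x%:R^-1) +
   K1 * (offdiag x (y - x) + offdiag y (x - y))))).
  apply: ler_sum_nat => x hx; apply: ler_sum_nat => y hy.
  by apply: corr_le; lia.
under eq_bigr do rewrite big_split -!mulr_sumr big_split /=.
rewrite big_split -!mulr_sumr big_split /=.
have off := @sum_offdiag_le R n.
have -> : \sum_(2 <= i < n.+1) \sum_(2 <= j < n.+1) offdiag j (i - j) =
   \sum_(2 <= i < n.+1) \sum_(2 <= j < n.+1) offdiag i (j - i) :> R.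
  by rewrite exchange_big.
have dg : \sum_(2 <= i < n.+1) \sum_(2 <= j < n.+1) ((i == j)%:R * i%:R^-1) <=
    harm n :> R.
  apply: (@le_trans _ _ (\sum_(2 <= i < n.+1) i%:R^-1)).
    apply: ler_sum_nat => i hi.
    rewrite (eq_bigr (fun j => if j == i then i%:R^-1 else 0)); last first.
      by move=> j _; rewrite eq_sym; case: eqP => _; rewrite ?mul1r ?mul0r.
    rewrite (bigD1_seq i) ?iota_uniq ?mem_index_iota//= eqxx.
    by rewrite big1 ?addr0// => j /negbTE ->.
  rewrite /harm; case: n {off} => [|n]; first by rewrite !big_geq.
  by rewrite [leRHS]big_ltn// lerDr invr_ge0.
have A20 : 0 <= A + 2 by rewrite addr_ge0// ltW.
apply: (le_trans (lerD (ler_wpM2l A20 dg) (ler_wpM2l K10 (lerD off off)))).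
by rewrite le_eqVlt; apply/orP; left; apply/eqP; ring.
Qed.

Definition word_deviation (n : nat) (lam : R) : set T :=
  [set w | lam <= `|2 ^+ size v * (count_S (word_event^~ v) 2 n.+1 w)%:R -
                    2 * (count_S cut 2 n.+1 w)%:R|].

Lemma measurable_word_deviation n lam : measurable (word_deviation n lam).
Proof.
pose Q k : set T := [set w | k = count_S (word_event^~ v) 2 n.+1 w] `&`
  [set w | lam <= `|2 ^+ size v * k%:R - 2 * (count_S cut 2 n.+1 w)%:R|].
rewrite (_ : word_deviation _ _ = \bigcup_k Q k); last first.
  apply/seteqP; split => w.
    by move=> h; exists (count_S (word_event^~ v) 2 n.+1 w).
  by move=> [k _ [/= -> ?]].
apply: bigcup_measurable => k _; apply: measurableI.
  apply: (measurable_count _ _ _ _ (fun i => k = i)) => x.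
  exact: measurable_word_event.
apply: (measurable_count _ _ _ _
  (fun i => lam <= `|2 ^+ size v * k%:R - 2 * i%:R|)) => x.
exact: measurable_word_event.
Qed.

Lemma pr_word_deviation_le n lam : 0 < lam ->
  pr P (word_deviation n lam) <= (A + 2 + 8 * K1) * harm n / lam ^+ 2.
Proof.
move=> lam0; pose r := [seq (x, e) | x <- index_iota 2 n.+1, e <- [:: true; false]].
have mE i : measurable (E i).
  by rewrite /E; case: ifP => _; exact: measurable_word_event.
have := @pr_comb_chebyshev _ _ _ P _ r c E lam (word_deviation n lam) lam0 mE
  (measurable_word_deviation n lam).
have bigr (F : nat * bool -> R) : \sum_(i <- r) F i =
    \sum_(2 <= x < n.+1) (F (x, true) + F (x, false)).
  rewrite /r big_allpairs_dep; apply: eq_bigr => x _.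
  by rewrite !big_cons big_nil /= addr0.
move=> h; apply: le_trans; first apply: h.
  move=> w hw; rewrite bigr /= /c /E /=; apply: (le_trans hw).
  rewrite !count_indic !mulr_sumr -sumrB.
  rewrite le_eqVlt; apply/orP; left; apply/eqP; congr `|_|.
  by apply: eq_bigr => x _; rewrite mulNr.
rewrite ler_wpM2r ?invr_ge0 ?sqr_ge0//; apply: le_trans (sum_corr_le n).
rewrite bigr; under eq_bigr do rewrite !bigr -big_split /=.
apply: ler_sum_nat => x hx; apply: ler_sum_nat => y hy.
rewrite /c /E /corr /=; move: (pr P _) (pr P _) (pr P _) (pr P _) => p1 p2 p3 p4.
by nra.
Qed.

Lemma word_deviation_small : exists2 K : R, 0 <= K & forall n lam,
  (0 < n)%N -> 0 < lam -> pr P (word_deviation n lam) <= K * (1 + ln n%:R) / lam ^+ 2.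
Proof.
have K0 : 0 <= A + 2 + 8 * K1.
  by rewrite !addr_ge0 ?mulr_ge0// ltW.
exists (A + 2 + 8 * K1) => // n lam n0 lam0.
apply: (le_trans (pr_word_deviation_le _ _ lam0)).
rewrite ler_wpM2r ?invr_ge0 ?sqr_ge0// ler_wpM2l//; exact: harm_le.
Qed.

End WordDeviation.

(** * Enumeration of binary words *)

Section BinaryWords.

Fixpoint words (L : nat) : seq (seq bool) :=
  if L is L'.+1 then map (cons true) (words L') ++ map (cons false) (words L')
  else [:: [::]].

Lemma mem_words L v : (v \in words L) = (size v == L).
Proof.
elim: L v => [|L IH] [|b v] //=.
  by rewrite mem_cat; apply/negbTE/norP; split; apply/mapP => -[].
rewrite mem_cat eqSS -IH; apply/orP/idP => [[]/mapP[u hu [_ ->]]//|hv].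
by case: b; [left|right]; apply: map_f.
Qed.

Lemma words_uniq L : uniq (words L).
Proof.
elim: L => [//|L IH] /=; rewrite cat_uniq !map_inj_uniq ?IH//=; last 2 first.
- by move=> ? ? [].
- by move=> ? ? [].
by rewrite andbT; apply/hasPn => _ /mapP[u _ ->]; apply/mapP => -[].
Qed.

Fixpoint words_lt (K : nat) : seq (seq bool) :=
  if K is K'.+1 then words_lt K' ++ words K' else [::].

Lemma mem_words_lt K v : (v \in words_lt K) = (size v < K)%N.
Proof.
elim: K => [|K IH]; first by rewrite in_nil.
by rewrite /= mem_cat IH mem_words ltnS orbC -leq_eqVlt.
Qed.

Lemma words_lt_uniq K : uniq (words_lt K).
Proof.
elim: K => [//|K IH] /=; rewrite cat_uniq IH words_uniq andbT /=.
by apply/hasPn => v; rewrite mem_words mem_words_lt => /eqP ->; rewrite ltnn.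
Qed.

End BinaryWords.

(** * Counts of sites with a word in a given set, compared with strong cutpoints *)

Section WordCountLimit.
Context {R : realType} {d : measure_display} {T : measurableType d}.
Variables (P : probability T R) (X : nat -> T -> nat).
Hypothesis Xmeas : forall k x, measurable [set w | X k w = x].
Hypothesis HX : is_markov_chain_from0 P X (trans pseq).
Local Notation word_event := (word_event X).
Local Notation cut := (cut X).

Let mV x v : measurable (word_event x v).
Proof. exact: measurable_word_event. Qed.

Let mcut x : measurable (cut x).
Proof. exact: measurable_word_event. Qed.

(** The threshold carries [2 ^ |v|] so that, after division by this weight, each word contributes at
    most [dt * ln n] off this event. *)
Definition deviation_union (vs : seq (seq bool)) (dt : R) (n : nat) : set T :=
  [set w | exists2 v, v \in vs &
     word_deviation X v n (dt * 2 ^+ size v * ln n%:R) w].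

Lemma measurable_deviation_union vs dt n : measurable (deviation_union vs dt n).
Proof.
elim: vs => [|v vs IH].
  by rewrite (_ : deviation_union _ _ _ = set0)//; apply/seteqP; split => // w [].
rewrite (_ : deviation_union _ _ _ =
  word_deviation X v n (dt * 2 ^+ size v * ln n%:R) `|` deviation_union vs dt n).
  by apply: measurableU => //; exact: measurable_word_deviation.
apply/seteqP; split => w.
  by move=> [u]; rewrite inE => /orP[/eqP -> ?|? ?]; [left|right; exists u].
move=> [?|[u hu ?]]; first by exists v => //; rewrite mem_head.
by exists u => //; rewrite inE hu orbT.
Qed.

Lemma deviation_union_small vs (dt eta : R) : 0 < dt -> 0 < eta ->
  all (last false) vs ->
  \forall n \near \oo, pr P (deviation_union vs dt n) <= eta.
Proof.
move=> dt0; elim: vs eta => [|v vs IH] eta eta0 /=.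
  move=> _; apply: nearW => n.
  rewrite (_ : deviation_union _ _ _ = set0) /pr ?measure0 ?ltW//.
  by apply/seteqP; split => // w [].
move=> /andP[hv hvs].
have [K K0 hK] := word_deviation_small P X Xmeas HX v hv.
have eta2 : 0 < eta / 2 by rewrite divr_gt0.
have h := IH _ eta2 hvs.
near=> n.
have hn : pr P (deviation_union vs dt n) <= eta / 2 by near: n.
(* For [L = ln n >= 1] one has [K * (1 + L) <= 2 * K * L]; the second bound makes this at most
   [eta / 2 * (dt * L) ^ 2]. *)
have L1 : Num.max 1 (4 * K / (dt ^+ 2 * eta)) <= ln n%:R :> R.
  by near: n; exact: near_ln_ge.
have n0 : (0 < n)%N by near: n; exact: nbhs_infty_gt.
move: L1; rewrite ge_max => /andP[L1 L2].
have L0 : 0 < ln n%:R :> R by exact: lt_le_trans L1.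
set lam := dt * 2 ^+ size v * ln n%:R.
have lam0 : 0 < lam by rewrite !mulr_gt0// exprn_gt0.
have hd : pr P (word_deviation X v n lam) <= eta / 2.
  apply: (le_trans (hK n lam n0 lam0)).
  rewrite ler_pdivrMr ?exprn_gt0//.
  have A1 : 1 <= 2 ^+ size v :> R by rewrite exprn_ege1// ler1n.
  have l2 : (dt * ln n%:R) ^+ 2 <= lam ^+ 2.
    have dL0 : 0 <= dt * ln n%:R by rewrite mulr_ge0// ltW.
    apply: lerXn2r; rewrite ?nnegrE//; first exact: ltW.
    by rewrite /lam mulrAC ler_peMr.
  apply: (@le_trans _ _ (eta / 2 * (dt * ln n%:R) ^+ 2)); last first.
    by rewrite ler_pM2l.
  have e0 : 0 < dt ^+ 2 * eta by rewrite mulr_gt0// exprn_gt0.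
  move: L2; rewrite ler_pdivrMr// => L2.
  have := ler_wpM2r (ltW L0) L2.
  have := ler_wpM2l K0 L1.
  rewrite exprMn; move: (ln n%:R) L1 => L L1 *.
  by nra.
apply: (@le_trans _ _ (pr P (word_deviation X v n lam `|` deviation_union vs dt n))).
  apply: pr_le.
  - exact: measurable_deviation_union.
  - apply: measurableU; first exact: measurable_word_deviation.
    exact: measurable_deviation_union.
  - by move=> w [u]; rewrite inE => /orP[/eqP -> ?|? ?]; [left|right; exists u].
apply: (@le_trans _ _ (pr P (word_deviation X v n lam) +
   pr P (deviation_union vs dt n))); last by lra.
apply: pr_U_le; first exact: measurable_word_deviation.
exact: measurable_deviation_union.
Unshelve. all: by end_near. Qed.

Variable phi : pred (seq bool).
Hypothesis phi_last : forall v, phi v -> last false v.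

Definition word_mass (K : nat) : R :=
  \sum_(0 <= L < K) (count phi (words L))%:R * 2 ^- L.

Lemma word_mass_incr : {homo word_mass : m n / (m <= n)%N >-> m <= n}.
Proof.
move=> m n mn; rewrite /word_mass (@big_cat_nat _ _ _ m 0 n)//= lerDl.
by apply: sumr_ge0 => L _; rewrite mulr_ge0// invr_ge0 exprn_ge0.
Qed.

Lemma word_massE K :
  word_mass K = \sum_(v <- [seq v <- words_lt K | phi v]) 2 ^- size v.
Proof.
rewrite /word_mass; elim: K => [|K IH]; first by rewrite big_geq// big_nil.
rewrite big_nat_recr//= IH filter_cat big_cat /=; congr +%R.
rewrite big_filter big_seq_cond.
rewrite (eq_bigr (fun=> 2 ^- K)); last first.
  by move=> v /andP[]; rewrite mem_words => /eqP ->.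
by rewrite -big_seq_cond big_const_seq iter_addr addr0 mulr_natl.
Qed.

Definition word_set (x : nat) : set T :=
  [set w | exists2 v, phi v & word_event x v w].

Definition word_set_len (L x : nat) : set T :=
  [set w | exists2 v, phi v && (size v == L) & word_event x v w].

Definition word_set_tail (K x : nat) : set T := \bigcup_i word_set_len (K + i) x.

Lemma word_set_lenE L x : word_set_len L x =
  \bigcup_(i in [set i | (i < size (words L))%N])
    (if phi (nth [::] (words L) i) then word_event x (nth [::] (words L) i) else set0).
Proof.
apply/seteqP; split => w.
  move=> [v /andP[pv sv] hv]; exists (index v (words L)).
    by rewrite /= index_mem mem_words.
  by rewrite nth_index ?mem_words// pv.
move=> [i /= hi]; case: ifP => // pv hw; exists (nth [::] (words L) i) => //.
by rewrite pv /= -mem_words mem_nth.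
Qed.

Lemma measurable_word_set_len L x : measurable (word_set_len L x).
Proof.
by rewrite word_set_lenE; apply: bigcup_measurable => i _; case: ifP.
Qed.

Lemma measurable_word_set_tail K x : measurable (word_set_tail K x).
Proof. by apply: bigcup_measurable => i _; exact: measurable_word_set_len. Qed.

Lemma indic_le_sum (B : set T) (r : seq (seq bool)) x w :
  (B w -> exists2 v, v \in r & word_event x v w) ->
  \1_B w <= \sum_(v <- r) \1_(word_event x v) w :> R.
Proof.
move=> h; have s0 (s : seq (seq bool)) : 0 <= \sum_(v <- s) \1_(word_event x v) w :> R.
  by apply: sumr_ge0 => v _; rewrite indicE.
rewrite {1}indicE; case: (boolP (w \in B)) => [/set_mem/h[v vr hv]|_]; last exact: s0.
rewrite (big_rem v)//= -[leLHS]addr0; apply: lerD.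
  by rewrite indicE mem_set.
by apply: sumr_ge0 => u _; rewrite indicE.
Qed.

Lemma pr_word_set_len_le L x : (2 <= x)%N ->
  pr P (word_set_len L x) <= (count phi (words L))%:R * 2 ^- L / x%:R.
Proof.
move=> x2; pose r := [seq v <- words L | phi v].
have := @pr_comb_le _ _ _ P unit (seq bool) [:: tt] r (fun=> 1) (fun=> 1)
  (fun=> word_set_len L x) (fun v => word_event x v)
  (fun=> measurable_word_set_len L x) (mV x).
rewrite big_seq1 mul1r => h; apply: le_trans; first apply: h.
  move=> w; rewrite big_seq1 mul1r; under eq_bigr do rewrite mul1r.
  apply: indic_le_sum => -[v /andP[pv sv] hv]; exists v => //.
  by rewrite mem_filter pv mem_words.
under eq_bigr do rewrite mul1r.
apply: (@le_trans _ _ (\sum_(v <- r) 2 ^- L / x%:R)).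
  rewrite !big_seq; apply: ler_sum => v; rewrite mem_filter mem_words => /andP[pv /eqP <-].
  rewrite (pr_word_event P X Xmeas HX)//; apply: (le_trans (word_weight_le _ _ x2)).
  by rewrite phi_last// mul1r.
rewrite big_const_seq iter_addr addr0 count_predT size_filter.
by rewrite -[leLHS]mulr_natl mulrA.
Qed.

(** A site has at most one complete word, so the events are disjoint and their indicators add up. *)
Lemma indic_word_set_split K x w :
  \1_(word_set x) w =
  \sum_(v <- [seq v <- words_lt K | phi v]) \1_(word_event x v) w +
  \1_(word_set_tail K x) w :> R.
Proof.
have zero (r : seq (seq bool)) : (forall v, v \in r -> ~ word_event x v w) ->
    \sum_(v <- r) \1_(word_event x v) w = 0 :> R.
  move=> h; rewrite big_seq big1// => v /h hv; rewrite indicE memNset//.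
have [[v pv hv]|nw] := pselect (word_set x w); last first.
  rewrite zero; last first.
    by move=> v; rewrite mem_filter => /andP[pv _] hv; apply: nw; exists v.
  rewrite !indicE !memNset ?addr0//.
  by move=> [i _ [v /andP[pv _] hv]]; apply: nw; exists v.
rewrite [LHS]indicE mem_set; last by exists v.
have [vK|Kv] := ltnP (size v) K.
  have vin : v \in [seq v <- words_lt K | phi v] by rewrite mem_filter pv mem_words_lt.
  rewrite (bigD1_seq v)//=; last by rewrite filter_uniq// words_lt_uniq.
  rewrite [\1_(word_event x v) w]indicE mem_set// big1; last first.
    move=> u uv; rewrite indicE memNset// => hu.
    by move: uv; rewrite (word_event_uniq _ _ _ _ _ hu hv) eqxx.
  rewrite indicE memNset ?addr0// => -[i _ [u /andP[pu /eqP su] hu]].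
  by move: vK; rewrite -(word_event_uniq _ _ _ _ _ hu hv) su; lia.
rewrite zero ?add0r; last first.
  move=> u; rewrite mem_filter mem_words_lt => /andP[pu su] hu.
  by move: su; rewrite (word_event_uniq _ _ _ _ _ hu hv) ltnNge Kv.
rewrite indicE mem_set//; exists (size v - K)%N => //; exists v => //.
by rewrite pv /=; apply/eqP; lia.
Qed.

Variable c : R.
Hypothesis c0 : 0 < c.
Hypothesis mass_cvg : word_mass K @[K --> \oo] --> c.

Lemma word_mass_le K : word_mass K <= c.
Proof.
rewrite -(cvg_lim _ mass_cvg)//; apply: nondecreasing_cvgn_le.
  exact: word_mass_incr.
by apply: cvgP mass_cvg.
Qed.

Lemma pr_word_set_tail_le K x : (2 <= x)%N ->
  pr P (word_set_tail K x) <= (c - word_mass K) / x%:R.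
Proof.
move=> x2; apply: pr_bigcup_le.
  by move=> i; exact: measurable_word_set_len.
move=> n; apply: (@le_trans _ _ ((word_mass (K + n) - word_mass K) / x%:R)); last first.
  by rewrite ler_wpM2r ?invr_ge0// lerD2r word_mass_le.
rewrite /word_mass (@big_cat_nat _ _ _ K 0 (K + n))//=; last exact: leq_addr.
rewrite addrAC subrr add0r mulr_suml -{2}[K]add0n big_addn addKn.
apply: ler_sum_nat => i hi; rewrite addnC; exact: pr_word_set_len_le.
Qed.

(** [Z x] is the event that the site [x] is counted; off the null set [N] it is decided by the exit
    word of [x], for [x >= 2]. *)
Variables (Z : nat -> set T) (N : set T).
Hypothesis mN : measurable N.
Hypothesis prN : pr P N = 0.
Hypothesis Z_word_set : forall x w, (2 <= x)%N -> ~ N w -> Z x w <-> word_set x w.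

Let Y (n : nat) (w : T) : R := count_in (fun x => Z x w) n / (c * ln n%:R).
Let D (n : nat) (w : T) : R := 2 * (count_S cut 2 n.+1 w)%:R / ln n%:R.

Lemma count_in_split n w : (0 < n)%N ->
  count_in (fun x => Z x w) n = `[< Z 1 w >]%:R + (count_S Z 2 n.+1 w)%:R :> R.
Proof. by move=> n0; rewrite /count_in big_ltn// /count_S natr_sum. Qed.

Let word_count_identity K n w (S := (count_S cut 2 n.+1 w)%:R : R) :
  (0 < n)%N -> 0 < ln n%:R :> R -> ~ N w ->
  c * ln n%:R * (Y n w - D n w) = `[< Z 1 w >]%:R +
  \sum_(v <- [seq v <- words_lt K | phi v])
     ((count_S (word_event^~ v) 2 n.+1 w)%:R - 2 * 2 ^- size v * S) +
  (count_S (word_set_tail K) 2 n.+1 w)%:R - 2 * (c - word_mass K) * S.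
Proof.
move=> n0 L0 Nw; rewrite /Y /D count_in_split//.
have -> : (count_S Z 2 n.+1 w)%:R =
    \sum_(v <- [seq v <- words_lt K | phi v]) (count_S (word_event^~ v) 2 n.+1 w)%:R
    + (count_S (word_set_tail K) 2 n.+1 w)%:R :> R.
  under [in RHS]eq_bigr do rewrite count_indic.
  rewrite exchange_big !count_indic -big_split /=; apply: eq_big_nat => x hx.
  rewrite -indic_word_set_split !indicE; congr (_ : bool)%:R.
  have x2 : (2 <= x)%N by lia.
  have [h1 h2] := Z_word_set x w x2 Nw.
  by apply/idP/idP => /set_mem h; apply/mem_set; auto.
have -> : \sum_(v <- [seq v <- words_lt K | phi v])
     ((count_S (word_event^~ v) 2 n.+1 w)%:R - 2 * 2 ^- size v * S) =
  \sum_(v <- [seq v <- words_lt K | phi v]) (count_S (word_event^~ v) 2 n.+1 w)%:R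
  - 2 * word_mass K * S.
  by rewrite big_split sumrN /= -mulr_suml -mulr_sumr -word_massE.
rewrite -/S; move: S (\sum_(_ <- _) _) (word_mass K) (`[< Z 1 w >]%:R)
  ((count_S (word_set_tail K) 2 n.+1 w)%:R) (ln n%:R) L0 => S s m z tl L L0.
by field; rewrite !gt_eqF.
Qed.

Let count_markov (E : nat -> set T) (t lam : R) n : (forall x, measurable (E x)) ->
  (forall x, (2 <= x)%N -> pr P (E x) <= t / x%:R) -> 0 <= t -> 0 < lam ->
  (0 < n)%N ->
  pr P [set w | lam <= (count_S E 2 n.+1 w)%:R] <= t * (1 + ln n%:R) / lam.
Proof.
move=> mE hE t0 lam0 n0.
have := @pr_count_markov _ _ _ P nat (index_iota 2 n.+1) E lam
  [set w | lam <= (count_S E 2 n.+1 w)%:R] lam0 mE.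
move=> h; apply: le_trans; first apply: h.
- exact: (measurable_count E mE _ _ (fun k => lam <= k%:R)).
- by move=> w /=; rewrite count_indic.
rewrite ler_pM2r ?invr_gt0//.
apply: (@le_trans _ _ (\sum_(2 <= x < n.+1) t / x%:R)).
  by apply: ler_sum_nat => x hx; apply: hE; lia.
rewrite -mulr_sumr ler_wpM2l//; apply: le_trans (harm_le _ n0).
by rewrite /harm [leRHS]big_ltn// lerDr invr_ge0.
Qed.

Lemma count_close (eps eta : R) : 0 < eps -> 0 < eta ->
  \forall n \near \oo, exists B : set T, [/\ measurable B, pr P B <= eta &
    forall w, ~ B w -> `|Y n w - D n w| <= eps].
Proof.
move=> eps0 eta0.
have ce0 : 0 < c * eps by exact: mulr_gt0.
(* For [ln n >= 1], the first moment bound [t * (1 + ln n) / lam] is at most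
   [8 * t / (c * eps) = eta / 8]. *)
pose t := eta * (c * eps) / 64.
have t0 : 0 < t by rewrite /t !mulr_gt0.
have [K hK] : exists K, c - word_mass K <= t.
  have : \forall K \near \oo, c - word_mass K <= t.
    move/cvgrPdist_le : mass_cvg => /(_ _ t0); apply: filterS => K.
    by apply: le_trans; exact: ler_norm.
  by case=> K _ h; exists K; apply: h => /=.
pose vs := [seq v <- words_lt K | phi v].
(* The successor keeps [m] positive when [vs] is empty. *)
pose m : R := (size vs).+1%:R.
have m0 : 0 < m by rewrite ltr0n.
pose dt := c * eps / 4 / m.
have dt0 : 0 < dt by rewrite !divr_gt0.
have eta2 : 0 < eta / 2 by rewrite divr_gt0.
have hvs : all (last false) vs.
  by apply/allP => v; rewrite mem_filter => /andP[/phi_last].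
have dev := deviation_union_small vs dt _ dt0 eta2 hvs.
near=> n.
have n0 : (0 < n)%N by near: n; exact: nbhs_infty_gt.
have : Num.max 1 (4 / (c * eps)) <= ln n%:R :> R by near: n; exact: near_ln_ge.
rewrite ge_max => /andP[L1 L2].
have L0 : 0 < ln n%:R :> R by exact: lt_le_trans L1.
(* A quarter of the total error [c * ln n * eps] for each of four terms: site 1, the words shorter
   than [K], the longer words, and the missing mass [c - word_mass K]. *)
pose lam := c * eps / 4 * ln n%:R.
have lam0 : 0 < lam by rewrite !mulr_gt0.
have lam1 : 1 <= lam.
  move: L2; rewrite ler_pdivrMr// /lam; move: (ln n%:R) => L ?; lra.
pose B1 := [set w | lam <= (count_S (word_set_tail K) 2 n.+1 w)%:R].
(* Off [B2] the missing mass, at most [t], changes [2 * c * S n] by at most [lam]. *)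
pose B2 := [set w | lam / (2 * t) <= (count_S cut 2 n.+1 w)%:R].
have mB1 : measurable B1.
  apply: (measurable_count _ _ _ _ (fun k => lam <= k%:R)) => x.
  exact: measurable_word_set_tail.
have mB2 : measurable B2.
  exact: (measurable_count _ _ _ _ (fun k => lam / (2 * t) <= k%:R)).
have mdev := measurable_deviation_union vs dt n.
have tl : t * (1 + ln n%:R) / lam <= eta / 8.
  rewrite ler_pdivrMr// /lam /t; move: (ln n%:R) L1 => L L1'.
  have e0 := mulr_gt0 eta0 ce0.
  have := ler_wpM2l (ltW e0) L1'; move: (c * eps) => q; nra.
have pB1 : pr P B1 <= eta / 8.
  apply: le_trans tl; apply: count_markov => //; last exact: ltW.
    by move=> x; exact: measurable_word_set_tail.
  move=> x x2; apply: (le_trans (pr_word_set_tail_le K x x2)).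
  by rewrite ler_wpM2r ?invr_ge0.
have pB2 : pr P B2 <= eta / 8.
  apply: le_trans tl; rewrite [leRHS](_ : _ = 2^-1 * (1 + ln n%:R) / (lam / (2 * t))); last first.
    by field; rewrite !gt_eqF.
  apply: count_markov => //; last by rewrite divr_gt0// mulr_gt0.
  move=> x x2; rewrite (pr_word_event P X Xmeas HX)//= invfM.
  by [].
exists (N `|` deviation_union vs dt n `|` (B1 `|` B2)); split.
- by apply: measurableU; exact: measurableU.
- have h1 := pr_U_le P _ _ (measurableU _ _ mN mdev) (measurableU _ _ mB1 mB2).
  have h2 := pr_U_le P _ _ mN mdev; have h3 := pr_U_le P _ _ mB1 mB2.
  have h4 : pr P (deviation_union vs dt n) <= eta / 2 by near: n.
  rewrite prN in h2; apply: (le_trans h1); lra.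
move=> w hw.
have hN : ~ N w by move=> h; apply: hw; left; left.
have hdev : ~ deviation_union vs dt n w by move=> h; apply: hw; left; right.
have hB1 : (count_S (word_set_tail K) 2 n.+1 w)%:R < lam.
  by rewrite ltNge; apply/negP => h; apply: hw; right; left.
have hB2 : (count_S cut 2 n.+1 w)%:R < lam / (2 * t).
  by rewrite ltNge; apply/negP => h; apply: hw; right; right.
have id := word_count_identity K n w n0 L0 hN.
have cL0 : 0 < c * ln n%:R by exact: mulr_gt0.
rewrite -(ler_pM2l cL0) -[X in X * `|_|]gtr0_norm// -normrM id -/vs.
set S := (count_S cut 2 n.+1 w)%:R.
have S0 : 0 <= S by [].
have sumb : `|\sum_(v <- vs) ((count_S (word_event^~ v) 2 n.+1 w)%:R -
    2 * 2 ^- size v * S)| <= lam.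
  apply: (le_trans (ler_norm_sum _ _ _)).
  apply: (@le_trans _ _ (\sum_(v <- vs) (dt * ln n%:R))).
    rewrite !big_seq; apply: ler_sum => v vin.
    have A0 : 0 < 2 ^+ size v :> R by rewrite exprn_gt0.
    have : ~ word_deviation X v n (dt * 2 ^+ size v * ln n%:R) w.
      by move=> h; apply: hdev; exists v.
    rewrite /word_deviation /= => /negP; rewrite -ltNge => /ltW hd.
    rewrite -(ler_pM2l A0) -[X in X * `|_|]gtr0_norm// -normrM.
    rewrite (_ : 2 ^+ size v * (dt * ln n%:R) = dt * 2 ^+ size v * ln n%:R); last ring.
    apply: le_trans hd; rewrite le_eqVlt; apply/orP; left; apply/eqP.
    congr `|_|; rewrite -/S; field; rewrite gt_eqF//.
  rewrite big_const_seq iter_addr addr0 count_predT -[leLHS]mulr_natl.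
  have -> : lam = m * (dt * ln n%:R) by rewrite /lam /dt; field; rewrite gt_eqF.
  rewrite ler_wpM2r//; first by rewrite mulr_ge0 ?ltW.
  by rewrite /m ler_nat.
have tS : 0 <= 2 * (c - word_mass K) * S <= lam.
  have cm : 0 <= c - word_mass K by rewrite subr_ge0 word_mass_le.
  rewrite !mulr_ge0//=; apply: (@le_trans _ _ (2 * t * S)).
    by rewrite ler_wpM2r// ler_wpM2l.
  by move: hB2; rewrite ltr_pdivlMr ?mulr_gt0// mulrC => /ltW.
have t00 : 0 <= (count_S (word_set_tail K) 2 n.+1 w)%:R :> R by [].
have z0 : 0 <= `[< Z 1 w >]%:R :> R by rewrite ler0n.
have z1 : `[< Z 1 w >]%:R <= 1 :> R by rewrite lern1 leq_b1.
have -> : c * ln n%:R * eps = 4 * lam by rewrite /lam; field.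
move: sumb tS t00 hB1 z0 z1; move: (\sum_(_ <- _) _) (2 * _ * S)
  ((count_S (word_set_tail K) 2 n.+1 w)%:R) (`[< Z 1 w >]%:R) => x y z q.
by rewrite ler_norml => /andP[? ?] /andP[? ?] *; rewrite ler_norml; lra.
Unshelve. all: by end_near. Qed.

End WordCountLimit.

(** * Transfer of the exponential limit to the word counts *)

Section ExponentialLimit.
Context {R : realType} {d : measure_display} {T : measurableType d}.
Variables (P : probability T R).

Lemma expRN_lipschitz (s e : R) : 0 <= s -> 0 <= e ->
  expR (- s) - expR (- (s + e)) <= e.
Proof.
move=> s0 e0; rewrite opprD expRD.
have h1 : expR (- s) <= 1 by rewrite -expR0 ler_expR oppr_le0.
have h2 : 1 - e <= expR (- e) by exact: expR_ge1Dx.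
have h3 := expR_ge0 (- s); have h4 : expR (- e) <= 1.
  by rewrite -expR0 ler_expR oppr_le0.
by nra.
Qed.

(** Off [B], the event [Y <= t] lies between [D <= t - q] and [D <= t + q]. Three errors of size
    [q = e / 4] occur: the probability of [B], the convergence of [D], and the shift by [q] in the
    exponential. *)
Lemma conv_in_dist_close (Y D : nat -> T -> R) :
  (forall n t, measurable [set w | Y n w <= t]) ->
  (forall n t, measurable [set w | t < D n w]) ->
  (\forall n \near \oo, forall w, 0 <= Y n w) ->
  (forall t, 0 <= t -> pr P [set w | t < D n w] @[n --> \oo] --> expR (- t)) ->
  (forall eps eta : R, 0 < eps -> 0 < eta ->
    \forall n \near \oo, exists B : set T, [/\ measurable B, pr P B <= eta &
      forall w, ~ B w -> `|Y n w - D n w| <= eps]) ->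
  conv_in_dist P Y exp1_cdf.
Proof.
move=> mY mD Y0 hD close t _; apply/fine_cvgP; split.
  by apply: nearW => n; exact: fin_num_measure.
rewrite -[fine \o _]/(fun n => pr P [set w | Y n w <= t]) /exp1_cdf.
case: ltP => [t0|t0]; apply/cvgrPdist_le => e e0.
  near=> n; rewrite sub0r normrN (_ : [set w | _] = set0); last first.
    apply/seteqP; split => // w /= h; move: (le_lt_trans h t0).
    rewrite ltNge => /negP; apply; move: w h; near: n.
    by apply: filterS Y0 => n h w _.
  by rewrite /pr measure0 normr0 ltW.
pose q := e / 4; have q0 : 0 < q by rewrite divr_gt0.
have tq : 0 <= t + q by rewrite addr_ge0// ltW.
have h1 : \forall n \near \oo, `|expR (- (t + q)) - pr P [set w | t + q < D n w]| <= q.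
  by move/cvgrPdist_le : (hD _ tq); exact.
have h2 : 0 <= t - q ->
    \forall n \near \oo, `|expR (- (t - q)) - pr P [set w | t - q < D n w]| <= q.
  by move=> h; move/cvgrPdist_le : (hD _ h); exact.
have h3 := close _ _ q0 q0.
have compl n s : pr P [set w | D n w <= s] = 1 - pr P [set w | s < D n w].
  rewrite -(pr_setT P) -[X in _ - pr P X]setTI -prDI//; congr pr.
  by apply/seteqP; split => w /=; rewrite leNgt; [move/negP|move=> [_ /negP]].
have mD' n s : measurable [set w | D n w <= s].
  rewrite (_ : [set w | _] = ~` [set w | s < D n w]); first exact: measurableC.
  by apply/seteqP; split => w /=; rewrite leNgt => /negP.
have up : \forall n \near \oo, pr P [set w | Y n w <= t] <= 1 - expR (- t) + e.
  near=> n.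
  have [B [mB pB hB]] : exists B : set T, [/\ measurable B, pr P B <= q &
      forall w, ~ B w -> `|Y n w - D n w| <= q] by near: n.
  have l1 : pr P [set w | Y n w <= t] <= pr P ([set w | D n w <= t + q] `|` B).
    apply: pr_le => //; first exact: measurableU.
    move=> w /= h; have [Bw|/hB] := pselect (B w); first by right.
    by rewrite ler_norml => /andP[? ?]; left => /=; lra.
  have l2 := pr_U_le P _ _ (mD' n (t + q)) mB; rewrite compl in l2.
  have : `|expR (- (t + q)) - pr P [set w | t + q < D n w]| <= q by near: n.
  rewrite ler_norml => /andP[a1 a2].
  have a3 := expRN_lipschitz _ _ t0 (ltW q0).
  by rewrite /q in a1 a2 a3 pB *; lra.
have lo : \forall n \near \oo, 1 - expR (- t) - e <= pr P [set w | Y n w <= t].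
  (* If [t < q] the lower bound is negative, because [1 - expR (- t) <= t]. *)
  have [tq0|tq0] := lerP 0 (t - q); last first.
    apply: nearW => n; apply: le_trans (pr_ge0 _ _).
    have := expR_ge1Dx (- t); rewrite /q in tq0; lra.
  have h2' := h2 tq0.
  near=> n.
  have [B [mB pB hB]] : exists B : set T, [/\ measurable B, pr P B <= q &
      forall w, ~ B w -> `|Y n w - D n w| <= q] by near: n.
  have l1 : pr P [set w | D n w <= t - q] <= pr P ([set w | Y n w <= t] `|` B).
    apply: pr_le => //; first exact: measurableU.
    move=> w /= h; have [Bw|/hB] := pselect (B w); first by right.
    by rewrite ler_norml => /andP[? ?]; left => /=; lra.
  have l2 := pr_U_le P _ _ (mY n t) mB; rewrite compl in l1.
  have : `|expR (- (t - q)) - pr P [set w | t - q < D n w]| <= q by near: n.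
  rewrite ler_norml => /andP[a1 a2].
  have a3 := expRN_lipschitz _ _ tq0 (ltW q0); rewrite subrK in a3.
  by rewrite /q in a1 a2 a3 pB *; lra.
near=> n.
have : pr P [set w | Y n w <= t] <= 1 - expR (- t) + e by near: n.
have : 1 - expR (- t) - e <= pr P [set w | Y n w <= t] by near: n.
by rewrite ler_norml => *; lra.
Unshelve. all: by end_near. Qed.

Variable X : nat -> T -> nat.
Hypothesis Xmeas : forall k x, measurable [set w | X k w = x].
Hypothesis HX : is_markov_chain_from0 P X (trans pseq).

Theorem word_count_conv (phi : pred (seq bool)) (c : R) (Z : nat -> set T)
  (N : set T) : (forall v, phi v -> last false v) -> 0 < c ->
  word_mass phi K @[K --> \oo] --> c ->
  (forall x, measurable (Z x)) -> measurable N -> pr P N = 0 ->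
  (forall x w, (2 <= x)%N -> ~ N w -> Z x w <-> word_set X phi x w) ->
  conv_in_dist P (fun n w => count_in (fun x => Z x w) n / (c * ln n%:R)) exp1_cdf.
Proof.
move=> hphi c0 hc mZ mN N0 hZ.
have mcut x : measurable (cut X x) by exact: measurable_word_event.
apply: (conv_in_dist_close _
  (fun n w => 2 * (count_S (cut X) 2 n.+1 w)%:R / ln n%:R)).
- move=> n t; have [->|n0] := posnP n.
    rewrite (_ : [set w | _] = [set _ | 0 / (c * ln 0%:R) <= t]); last first.
      by apply/seteqP; split => w /=; rewrite /count_in big_geq.
    have [h|h] := pselect (0 / (c * ln 0%:R) <= t).
      by rewrite (_ : [set w | _] = setT)//; apply/seteqP; split.
    by rewrite (_ : [set w | _] = set0)//; apply/seteqP; split.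
  rewrite (_ : [set w | _] =
    [set w | (count_S Z 1 n.+1 w)%:R / (c * ln n%:R) <= t]).
    exact: (measurable_count Z mZ _ _ (fun k => k%:R / (c * ln n%:R) <= t)).
  by apply/seteqP; split => w /=; rewrite /count_in /count_S natr_sum.
- move=> n t.
  exact: (measurable_count _ mcut _ _ (fun k => t < 2 * k%:R / ln n%:R)).
- near=> n => w; rewrite divr_ge0//; first by apply: sumr_ge0.
  apply: mulr_ge0; first exact: ltW.
  by rewrite ln_ge0// ler1n; near: n; exact: nbhs_infty_gt.
- move=> t t0.
  have := renewal_count_cvg P (cut X) mcut (pr_cut_chain P X Xmeas HX) t t0.
  apply: cvg_trans; apply: near_eq_cvg; near=> n.
  have L0 : 0 < ln n%:R :> R.
    by apply: (@lt_le_trans _ _ 1) => //; near: n; exact: near_ln_ge.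
  congr pr; apply/seteqP; split => w /=; rewrite ltr_pdivlMr//.
    by rewrite mulrAC ltr_pdivrMr// [_ * 2]mulrC.
  by rewrite mulrAC ltr_pdivrMr// [_ * 2]mulrC.
- move=> eps eta.
  exact: (count_close P X Xmeas HX phi hphi c c0 hc Z N mN N0 hZ).
Unshelve. all: by end_near. Qed.

End ExponentialLimit.

(** * Numbers of words of each kind and their total masses *)

Section WordCounting.
Context {R : realType}.

Definition up_word (b : nat) : pred (seq bool) :=
  fun v => (count id v == b) && last false v.

Lemma count_up_word0 L : count (up_word 0) (words L) = 0%N.
Proof.
apply/eqP; rewrite -leqn0 leqNgt -has_count; apply/hasPn => v _.
rewrite /up_word; apply/negP => /andP[/eqP h0 hl].
have : (0 < count id v)%N.
  rewrite -has_count; apply/hasP; exists true => //.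
  case: v hl {h0} => //= b v hl; have := mem_last b v; move: hl => /=.
  by case: (last b v).
by rewrite h0.
Qed.

(** The last letter is up and the other [b] ups are placed freely; splitting on the first letter is
    Pascal's rule. *)
Lemma count_up_wordS L b : count (up_word b.+1) (words L.+1) = 'C(L, b).
Proof.
elim: L b => [|L IH] b.
  by case: b.
rewrite -[words L.+2]/(map (cons true) (words L.+1) ++ map (cons false) (words L.+1)).
rewrite count_cat !count_map.
have -> : count (preim (cons false) (up_word b.+1)) (words L.+1) = 'C(L, b).
  rewrite -IH; apply: eq_in_count => -[|c v]; rewrite mem_words//.
have -> : count (preim (cons true) (up_word b.+1)) (words L.+1) =
    count (up_word b) (words L.+1).
  by apply: eq_in_count => -[|c v]; rewrite mem_words.
by case: b => [|b]; rewrite ?count_up_word0 ?IH ?bin0// addnC -binS.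
Qed.

Fixpoint downs_then_ups (v : seq bool) : bool :=
  match v with
  | [::] => false
  | true :: v' => all id v'
  | false :: v' => downs_then_ups v'
  end.

Lemma downs_then_ups_last v : downs_then_ups v -> last false v.
Proof.
elim: v => [//|[] v IH] /=; last by case: v IH.
by elim: v {IH} => [//|[] v IH] /= // /IH.
Qed.

Lemma downs_then_ups_cat s1 s2 : all negb s1 -> all id s2 -> s2 != [::] ->
  downs_then_ups (s1 ++ s2).
Proof.
elim: s1 => [|[] s1 IH] //= _.
by case: s2 => // -[].
Qed.

Lemma downs_then_ups_after s1 s2 : downs_then_ups (s1 ++ true :: s2) -> all id s2.
Proof.
elim: s1 => [//|[] s1 IH] /=; last exact: IH.
by rewrite all_cat /= => /andP[].
Qed.

Lemma count_all_ups L : count (all id) (words L) = 1%N.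
Proof.
elim: L => [//|L IH] /=; rewrite count_cat !count_map.
rewrite (eq_count (a2 := all id)) ?IH; last by [].
by rewrite (eq_count (a2 := pred0)) ?count_pred0.
Qed.

(** Such a word is determined by the position of its first up step. *)
Lemma count_downs_then_ups L : count downs_then_ups (words L) = L.
Proof.
elim: L => [//|L IH] /=; rewrite count_cat !count_map.
rewrite (eq_count (a2 := all id)) ?count_all_ups//.
by rewrite (eq_count (a2 := downs_then_ups)) ?IH.
Qed.

Lemma bin_le_exp2 n k : ('C(n, k) <= 2 ^ n)%N.
Proof.
elim: n k => [|n IH] [|k]//; first by rewrite bin0 expn_gt0.
by rewrite binS expnS mul2n -addnn leq_add.
Qed.

(** From [(n - k) * 'C(n, k) = (k + 1) * 'C(n, k + 1) <= (k + 1) * 2 ^ n]. *)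
Lemma cvg_bin_exp2 k : 'C(n, k)%:R * 2 ^- n @[n --> \oo] --> (0 : R).
Proof.
apply/cvgrPdist_le => e e0; near=> n.
have hn : k.+1%:R / e + k.+1%:R <= n%:R :> R by near: n; exact: nbhs_infty_ger.
have kn : (k < n)%N.
  rewrite -(ler_nat R); apply: le_trans hn; rewrite lerDr divr_ge0//; exact: ltW.
have p0 : 0 < 2 ^+ n :> R by rewrite exprn_gt0.
rewrite sub0r normrN ger0_norm; last by rewrite divr_ge0// ltW.
rewrite ler_pdivrMr//.
have nk0 : 0 < (n - k)%:R :> R by rewrite ltr0n subn_gt0.
rewrite -(ler_pM2l nk0).
have -> : (n - k)%:R * 'C(n, k)%:R = k.+1%:R * 'C(n, k.+1)%:R :> R.
  by rewrite -!natrM mul_bin_left.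
apply: (@le_trans _ _ (k.+1%:R * 2 ^+ n)).
  by rewrite ler_wpM2l// -natrX ler_nat bin_le_exp2.
rewrite mulrA ler_pM2r// -ler_pdivrMr// natrB ?(ltnW kn)//.
have : k%:R <= k.+1%:R :> R by rewrite ler_nat.
by move: hn; move: (k.+1%:R / e) => q *; lra.
Unshelve. all: by end_near. Qed.

Lemma sum_bin_succ (k n : nat) :
  (\sum_(0 <= i < k.+1) 'C(n.+1, i) + 'C(n, k) =
   2 * \sum_(0 <= i < k.+1) 'C(n, i))%N.
Proof.
elim: k => [|k IH]; first by rewrite !big_nat1 !bin0.
by rewrite [in LHS]big_nat_recr//= [in RHS]big_nat_recr//= binS; lia.
Qed.

(** Under fair coin tossing both sides are the probability that the head number [a + 1] occurs
    within [n] tosses: the left side splits by its time, the right side excludes at most [a]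
    heads. *)
Lemma up_word_mass (a n : nat) : word_mass (up_word a.+1) n.+1 =
  1 - 2 ^- n * (\sum_(0 <= i < a.+1) 'C(n, i))%:R :> R.
Proof.
elim: n => [|n IH].
  rewrite /word_mass big_nat1 /up_word /= mul0r big_ltn// bin0 big_nat_cond big1.
    by rewrite expr0 invr1 mul1r addn0 subrr.
  by move=> i /andP[hi _]; rewrite bin0n; case: i hi.
rewrite /word_mass big_nat_recr// -/(word_mass _ _) IH count_up_wordS.
have := sum_bin_succ a n; move/(congr1 (fun m => m%:R : R)).
rewrite natrD natrM exprS.
move: (\sum_(_ <= _ < _) _)%:R (\sum_(_ <= _ < _) _)%:R 'C(n, a)%:R => x y z e.
have -> : y = 2 * x - z by lra.
by rewrite /=; field; rewrite expf_neq0.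
Qed.

Lemma up_word_mass_cvg a : word_mass (up_word a.+1) n @[n --> \oo] --> (1 : R).
Proof.
have h m : 2 ^- n * (\sum_(0 <= i < m) 'C(n, i))%:R @[n --> \oo] --> (0 : R).
  elim: m => [|m IH].
    by under eq_fun do rewrite big_geq// mulr0; exact: cvg_cst.
  under eq_fun do rewrite big_nat_recr//= natrD mulrDr [2 ^- _ * 'C(_, _)%:R]mulrC.
  have -> : 0 = 0 + 0 :> R by rewrite addr0.
  by apply: cvgD => //; exact: cvg_bin_exp2.
rewrite -(cvg_shiftS (word_mass (up_word a.+1))) /=.
have : 1 - 2 ^- n * (\sum_(0 <= i < a.+1) 'C(n, i))%:R @[n --> \oo] --> (1 - 0 : R).
  by apply: cvgB; [exact: cvg_cst|exact: h].
rewrite subr0; apply: cvg_trans; apply: near_eq_cvg; apply: nearW => n.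
by rewrite up_word_mass.
Qed.

(** The partial sum of [L / 2 ^ L], equal to [2 - (n + 2) / 2 ^ n]; the remainder is written with
    binomials so that [cvg_bin_exp2] applies. *)
Lemma downs_then_ups_mass n :
  word_mass downs_then_ups n.+1 = 2 - ('C(n, 1)%:R * 2 ^- n + 2 * ('C(n, 0)%:R * 2 ^- n)) :> R.
Proof.
elim: n => [|n IH].
  by rewrite /word_mass big_nat1 /= bin0 mul0r add0r expr0 invr1 !mulr1 subrr.
rewrite /word_mass big_nat_recr// -/(word_mass _ _) IH.
rewrite count_downs_then_ups !bin1 !bin0 exprS -natr1.
by rewrite /=; field; rewrite expf_neq0.
Qed.

Lemma downs_then_ups_mass_cvg :
  word_mass downs_then_ups n @[n --> \oo] --> (2 : R).
Proof.
rewrite -(cvg_shiftS (word_mass downs_then_ups)) /=.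
have : 2 - ('C(n, 1)%:R * 2 ^- n + 2 * ('C(n, 0)%:R * 2 ^- n)) @[n --> \oo] -->
    (2 - (0 + 2 * 0) : R).
  apply: cvgB; first exact: cvg_cst.
  apply: cvgD; first exact: cvg_bin_exp2.
  by apply: cvgM; [exact: cvg_cst|exact: cvg_bin_exp2].
rewrite mulr0 addr0 subr0; apply: cvg_trans; apply: near_eq_cvg.
by apply: nearW => n; rewrite downs_then_ups_mass.
Qed.

Definition sized_up_word (a b : nat) : pred (seq bool) :=
  fun v => (size v == a) && up_word b v.

Lemma sized_up_word_mass_cvg a b :
  word_mass (sized_up_word a.+1 b.+1) n @[n --> \oo] -->
  (2 ^- a.+1 * 'C(a, b)%:R : R).
Proof.
have zero L : L != a.+1 -> count (sized_up_word a.+1 b.+1) (words L) = 0%N.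
  move=> La; apply/eqP; rewrite -leqn0 leqNgt -has_count; apply/hasPn => v.
  by rewrite mem_words /sized_up_word => /eqP ->; rewrite (negbTE La).
have one : count (sized_up_word a.+1 b.+1) (words a.+1) = 'C(a, b).
  rewrite -count_up_wordS; apply: eq_in_count => v.
  by rewrite mem_words /sized_up_word => ->.
apply: cvg_near_cst; near=> n.
have an : (a.+1 < n)%N by near: n; exact: nbhs_infty_gt.
rewrite /word_mass (bigD1_seq a.+1) ?iota_uniq ?mem_index_iota//= one.
rewrite big1 ?addr0 1?mulrC// => L La.
by rewrite zero// mul0r.
Unshelve. all: by end_near. Qed.

End WordCounting.

(** * Reading local times and weak cutpoints off the exit word of a path *)

Section GoodPaths.
Context {d : measure_display} {T : measurableType d}.
Variables (X : nat -> T -> nat) (w : T).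

Definition unit_step (k : nat) : Prop :=
  X k.+1 w = (X k w).+1 \/ X k.+1 w = (X k w).-1.

Lemma has_exactlyE (A : nat -> Prop) (s : seq nat) m : uniq s ->
  (forall k, A k <-> k \in s) -> has_exactly A m <-> size s = m.
Proof.
move=> us hs; split => [[s' [us' <- hs']]|<-]; last by exists s.
apply: perm_size; apply: uniq_perm => // k.
by apply/idP/idP => [/hs/hs'|/hs'/hs].
Qed.

Variables (x : nat) (v : seq bool).
Hypothesis hv : word_event X x v w.

(** A visit after the word has stabilised would lengthen it. *)
Lemma word_event_visits : exists M, exits X 0 M x w = v /\
  forall i, X i w = x -> (i < M)%N.
Proof.
have [M hM] := hv; exists M; split; first exact: hM.
move=> i Xi; rewrite ltnNge; apply/negP => Mi.
have := hM i.+1 (leqW Mi); have := hM i Mi => {1}<-.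
rewrite -addn1 exitsD add0n exitsS Xi eqxx => /(congr1 size).
by rewrite size_cat /=; lia.
Qed.

Lemma local_time_eqE a : local_time_eq X w x a <-> size v = a.
Proof.
have [M [<- hM]] := word_event_visits.
rewrite /local_time_eq (has_exactlyE _ [seq i <- iota 0 M | X i w == x]).
- by rewrite /exits size_map.
- by rewrite filter_uniq// iota_uniq.
- move=> k; rewrite mem_filter mem_iota add0n /=; split.
    by move=> h; rewrite h eqxx hM.
  by case/andP => /eqP.
Qed.

Lemma up_time_eqE b : up_time_eq X w x b <-> count id v = b.
Proof.
have [M [<- hM]] := word_event_visits.
rewrite /up_time_eq
  (has_exactlyE _ [seq i <- iota 0 M | (X i.+1 w == x.+1) && (X i w == x)]).
- by rewrite /exits count_map count_filter size_filter.
- by rewrite filter_uniq// iota_uniq.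
- move=> k; rewrite mem_filter mem_iota add0n /=; split.
    by move=> [h1 h2]; rewrite h1 h2 !eqxx hM.
  by case/andP => /andP[/eqP -> /eqP ->].
Qed.

Hypotheses (x2 : (2 <= x)%N) (X0 : X 0 w = 0%N) (steps : forall k, unit_step k).

Lemma exits_all (a : pred bool) k m :
  (forall i, (k <= i < k + m)%N -> X i w = x -> a (X i.+1 w == x.+1)) ->
  all a (exits X k m x w).
Proof.
move=> h; apply/allP => b /mapP[i]; rewrite mem_filter mem_iota.
by move=> /andP[/eqP Xi hi] ->; exact: h.
Qed.

(** Before the cut time the walk may leave [x] only downward, from that time on only upward;
    conversely, unit steps cannot cross [x] without visiting it. *)
Lemma weak_cutpointE : weak_cutpoint X w x <-> downs_then_ups v.
Proof.
have [M [eM hM]] := word_event_visits; rewrite -eM; split.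
  move=> [k [Xk before after]]; have kM := hM _ Xk.
  rewrite -(subnKC (ltnW kM)) exitsD add0n; apply: downs_then_ups_cat.
  - apply: exits_all => i hi Xi; apply/eqP => Xi1.
    have [ik|ik] := eqVneq i.+1 k; first by rewrite ik Xk in Xi1; lia.
    have := before i.+1; rewrite Xi1; lia.
  - apply: exits_all => i hi Xi; have := after i.+1.
    by have [->|->] := steps i; rewrite Xi ?eqxx//; lia.
  - by case E : (M - k)%N => [|j]; [lia|rewrite exitsS Xk eqxx].
move=> hd.
have ex_up : exists k, (X k w == x) && (X k.+1 w == x.+1).
  have hl := downs_then_ups_last _ hd.
  have : true \in exits X 0 M x w.
    by case: (exits X 0 M x w) hl => //= b s hl; rewrite -{1}hl mem_last.
  move/mapP => [i]; rewrite mem_filter => /andP[Xi _] Xi1.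
  by exists i; rewrite Xi -Xi1.
(* The cut time is the first upward exit from [x]: the walk starts below [x] and cannot pass above
   it earlier. *)
case: (ex_minnP ex_up) => k /andP[/eqP Xk /eqP Xk1] kmin.
have kM := hM _ Xk.
have ups i : (k < i)%N -> X i w = x -> X i.+1 w = x.+1.
  move=> ki Xi; have iM := hM _ Xi.
  have e : exits X 0 M x w = exits X 0 k x w ++ true :: exits X k.+1 (M - k.+1) x w.
    rewrite -[in LHS](subnKC kM) addSnnS exitsD add0n exitsS.
    by rewrite Xk Xk1 !eqxx.
  move: hd; rewrite e => /downs_then_ups_after/allP/(_ (X i.+1 w == x.+1)) h.
  apply/eqP; apply: h; apply/mapP; exists i => //.
  by rewrite mem_filter Xi eqxx mem_iota; lia.
exists k; split => //.
  elim=> [|i IH] ik; first by rewrite X0.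
  have Xi := IH (ltnW ik).
  have [Xi1|Xi1] := steps i; last by rewrite Xi1; lia.
  rewrite Xi1 ltnNge; apply/negP => h.
  have Xix : X i w = x by lia.
  have := kmin i; rewrite Xi1 Xix !eqxx => /(_ isT); lia.
elim=> [//|i IH] ki.
have [->|ik] := eqVneq i k; first by rewrite Xk1.
have ki' : (k < i)%N by lia.
have Xi := IH ki'.
have [Xix|Xix] := eqVneq (X i w) x; first by rewrite ups.
by have [->|->] := steps i; lia.
Qed.

End GoodPaths.

(** * Measurability and the almost sure properties of paths *)

Section AlmostSure.
Context {R : realType} {d : measure_display} {T : measurableType d}.
Variables (P : probability T R) (X : nat -> T -> nat).
Hypothesis Xmeas : forall k x, measurable [set w | X k w = x].
Hypothesis HX : is_markov_chain_from0 P X (trans pseq).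

Lemma measurable_X (k : nat) (Q : nat -> Prop) : measurable [set w | Q (X k w)].
Proof.
rewrite (_ : [set w | _] = \bigcup_(j in [set j | Q j]) [set w | X k w = j]).
  by apply: bigcup_measurable.
by apply/seteqP; split => w /=; [exists (X k w)|move=> [j /= Qj ->]].
Qed.

Lemma measurable_bigcup_seq (I : countType) (F : I -> set T) :
  (forall i, measurable (F i)) -> measurable [set w | exists i, F i w].
Proof.
move=> mF; rewrite (_ : [set w | _] =
  \bigcup_j (if @unpickle I j is Some i then F i else set0)).
  by apply: bigcup_measurable => j _; case: unpickle.
apply/seteqP; split => w /=.
  by move=> [i Fi]; exists (pickle i) => //; rewrite pickleK.
by move=> [j _]; case: unpickle => // i Fi; exists i.
Qed.

Lemma pr_null_countable (I : countType) (F : I -> set T) :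
  (forall i, measurable (F i)) -> (forall i, pr P (F i) = 0) ->
  pr P [set w | exists i, F i w] = 0.
Proof.
move=> mF F0; rewrite (_ : [set w | _] =
  \bigcup_j (if @unpickle I j is Some i then F i else set0)).
  apply: pr_null_bigcup => j; case: unpickle => //.
  by rewrite /pr measure0.
apply/seteqP; split => w /=.
  by move=> [i Fi]; exists (pickle i) => //; rewrite pickleK.
by move=> [j _]; case: unpickle => // i Fi; exists i.
Qed.

Lemma measurable_has_exactly (A : nat -> T -> Prop) m :
  (forall k, measurable [set w | A k w]) ->
  measurable [set w | has_exactly (A^~ w) m].
Proof.
move=> mA; apply: (measurable_bigcup_seq (seq nat)
  (fun s => [set w | [/\ uniq s, size s = m & forall k, A k w <-> k \in s]])).
move=> s; have [h|h] := pselect (uniq s /\ size s = m); last first.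
  rewrite (_ : [set w | _] = set0)//; apply/seteqP; split => // w [? ? _].
  exact: h.
rewrite (_ : [set w | _] = \bigcap_k
  (if k \in s then [set w | A k w] else ~` [set w | A k w])).
  apply: bigcap_measurableType => k _; case: ifP => // _; exact: measurableC.
apply/seteqP; split => w /=.
  move=> [_ _ H] k _; case: ifP => ks; first by apply/H.
  by move/H; rewrite ks.
move=> H; split; [exact: h.1|exact: h.2|] => k; have := H k I.
by case: ifP => // _ hA; split.
Qed.

Lemma measurable_local_time x a : measurable [set w | local_time_eq X w x a].
Proof. by apply: (measurable_has_exactly (fun k w => X k w = x)). Qed.

Lemma measurable_up_time x b : measurable [set w | up_time_eq X w x b].
Proof.
apply: (measurable_has_exactly (fun k w => X k w = x /\ X k.+1 w = x.+1)) => k.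
exact: (measurableI _ _ (Xmeas k x) (Xmeas k.+1 x.+1)).
Qed.

Lemma measurable_weak_cutpoint r : measurable [set w | weak_cutpoint X w r].
Proof.
rewrite (_ : [set w | _] = \bigcup_k ([set w | X k w = r] `&`
  (\bigcap_(i in [set i | (i < k)%N]) [set w | (X i w <= r)%N] `&`
   \bigcap_(i in [set i | (k < i)%N]) [set w | (r <= X i w)%N]))).
  apply: bigcup_measurable => k _; apply: measurableI => //.
  apply: measurableI; apply: bigcap_measurableType => i _.
    exact: (measurable_X i (fun j => j <= r)%N).
  exact: (measurable_X i (fun j => r <= j)%N).
apply/seteqP; split => w /=.
  by move=> [k [h1 h2 h3]]; exists k => //; split => //; split.
by move=> [k _ [h1 [h2 h3]]]; exists k.
Qed.

Lemma measurable_unit_step k : measurable [set w | unit_step X w k].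
Proof.
rewrite (_ : [set w | _] = [set w | exists z,
  ([set w | X k w = z] `&` [set w | X k.+1 w = z.+1 \/ X k.+1 w = z.-1]) w]).
  apply: (measurable_bigcup_seq nat (fun z => _ `&` _)) => z.
  by apply: measurableI => //; exact: (measurable_X _ (fun j => j = z.+1 \/ j = z.-1)).
apply/seteqP; split => w /=; first by exists (X k w).
by move=> [z [<-]].
Qed.

(** There are countably many finite histories, and a forbidden step after each of them is null by
    [pr_cyl_split]. *)
Lemma pr_not_unit_step : pr P [set w | exists k, ~ unit_step X w k] = 0.
Proof.
pose F (i : seq nat * nat) : set T :=
  cyl X (rcons i.1 i.2) `&` ~` [set w | unit_step X w (size i.1)].
rewrite (_ : [set w | _] = [set w | exists i, F i w]).
  apply: pr_null_countable => -[s z]; rewrite /F /=.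
    apply: measurableI; first exact: measurable_cyl.
    by apply: measurableC; exact: measurable_unit_step.
  rewrite (pr_cyl_split P X Xmeas HX); last first.
    by apply: measurableC; exact: measurable_unit_step.
  have z0 y : y = z.+1 \/ y = z.-1 -> cyl X (rcons (rcons s z) y) `&`
      ~` [set w | unit_step X w (size s)] = set0.
    move=> hy; apply/seteqP; split => // w; rewrite !cyl_rcons size_rcons.
    move=> [[[_ /= e1] /= e2] /= h]; apply: h.
    by rewrite /unit_step e1 e2.
  by rewrite !z0; [rewrite /pr measure0 addr0|right|left].
apply/seteqP; split => w /=.
  move=> [k hk]; exists (mkseq (X^~ w) k, X k w).
  split; last by rewrite /= size_mkseq.
  move=> i; rewrite size_rcons size_mkseq nth_rcons size_mkseq ltnS leq_eqVlt /=.
  by move=> /orP[/eqP ->|ik]; rewrite ?ltnn ?eqxx// ik nth_mkseq.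
by move=> [[s z] [_ /= h]]; exists (size s).
Qed.

Lemma word_weight_notlast x v : ~~ last false v -> word_weight x v = 0 :> R.
Proof.
elim: v => [//|c v IH]; case: v IH => [|c' v] IH h.
  by case: c h => //= _; rewrite mulr0.
have e := IH h; case: c {h}; last first.
  by change ((1 - pseq x) * word_weight x (c' :: v) = 0 :> R); rewrite e mulr0.
by change (2^-1 * word_weight x (c' :: v) = 0 :> R); rewrite e mulr0.
Qed.

(** The number of visits to [x] is geometric: after each visit the walk returns with probability
    [1 / 2 + (1 - p x) = 1 - 1 / (2 x)]. *)
Lemma sum_word_weight x L : (2 <= x)%N -> \sum_(v <- words L.+1) word_weight x v =
  (2 * x%:R)^-1 * (1 - (2 * x%:R)^-1) ^+ L :> R.
Proof.
move=> x2; have x0 : x%:R != 0 :> R by rewrite pnatr_eq0; lia.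
elim: L => [|L IH].
  by rewrite /= !big_cons big_nil /= mulr0 !addr0 expr0 mulr1.
rewrite -[words L.+2]/(map (cons true) (words L.+1) ++ map (cons false) (words L.+1)).
rewrite big_cat !big_map /=.
have -> : \sum_(v <- words L.+1) word_weight x (true :: v) =
    2^-1 * \sum_(v <- words L.+1) word_weight x v :> R.
  rewrite mulr_sumr !big_seq; apply: eq_bigr => -[|c v]; first by rewrite mem_words.
  by [].
rewrite -mulr_sumr -mulrDl IH exprS qseqE// (_ : x.-1%:R = x%:R - 1).
  by field.
by rewrite -subn1 natrB//; lia.
Qed.

Lemma sum_word_weight_lt x K : (2 <= x)%N ->
  \sum_(v <- words_lt K.+1) word_weight x v = 1 - (1 - (2 * x%:R)^-1) ^+ K :> R.
Proof.
move=> x2; elim: K => [|K IH].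
  by rewrite /= big_cons big_nil /= addr0 expr0 subrr.
rewrite -[words_lt K.+2]/(words_lt K.+1 ++ words K.+1) big_cat.
rewrite [X in X + _ = _]IH sum_word_weight// exprS; ring.
Qed.

Let fin_word : pred (seq bool) := fun v => last false v.

Lemma measurable_word_set phi x : measurable (word_set X phi x).
Proof.
rewrite (_ : word_set X phi x = word_set_tail X phi 0 x).
  exact: measurable_word_set_tail.
apply/seteqP; split => w.
  by move=> [v pv hv]; exists (size v) => //; exists v => //; rewrite pv add0n /=.
by move=> [i _ [v /andP[pv _] hv]]; exists v.
Qed.

(** Transience: the words of length at most [K] carry mass [1 - rho ^ K], so almost surely [x] is
    visited, finitely often, and left upward at the end. *)
Lemma pr_fin_word x : (2 <= x)%N -> pr P (word_set X fin_word x) = 1.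
Proof.
move=> x2; have mW := measurable_word_set fin_word x.
apply/eqP; rewrite eq_le pr_le1//=.
set rho : R := 1 - (2 * x%:R)^-1.
have x0 : 0 < 2 * x%:R :> R by rewrite mulr_gt0// ltr0n; lia.
have rho01 : 0 <= rho < 1.
  rewrite /rho gtrBl invr_gt0 x0 andbT subr_ge0 invf_le1//.
  by rewrite -[2]/(2%:R) -natrM ler1n; lia.
have low K : 1 - rho ^+ K <= pr P (word_set X fin_word x).
  rewrite -sum_word_weight_lt//.
  have -> : \sum_(v <- words_lt K.+1) word_weight x v =
      \sum_(v <- [seq v <- words_lt K.+1 | fin_word v]) 1 * pr P (word_event X x v) :> R.
    rewrite big_filter [RHS]big_mkcond; apply: eq_bigr => v _.
    rewrite mul1r (pr_word_event P X Xmeas HX)//; case: ifPn => //.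
    exact: word_weight_notlast.
  have := @pr_comb_le _ _ _ P (seq bool) unit [seq v <- words_lt K.+1 | fin_word v]
    [:: tt] (fun=> 1) (fun=> 1) (word_event X x) (fun=> word_set X fin_word x)
    (measurable_word_event X Xmeas x) (fun=> mW).
  rewrite big_seq1 mul1r; apply => w; rewrite big_seq1 mul1r.
  under eq_bigr do rewrite mul1r.
  by rewrite (indic_word_set_split X fin_word K.+1) lerDl indicE.
have c1 : 1 - rho ^+ K @[K --> \oo] --> (1 - 0 : R).
  apply: cvgB; first exact: cvg_cst.
  apply: cvg_expr; case/andP: rho01 => r0 r1; rewrite ger0_norm//.
rewrite subr0 in c1.
rewrite -(cvg_lim _ c1)//; apply: limr_le; first exact: cvgP c1.
exact: nearW.
Qed.

Definition bad_paths : set T :=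
  ~` cyl X [:: 0%N] `|` [set w | exists k, ~ unit_step X w k] `|`
  [set w | exists x, ~ word_set X fin_word x.+2 w].

Lemma measurable_bad_paths : measurable bad_paths.
Proof.
apply: measurableU; first apply: measurableU.
- by apply: measurableC; exact: measurable_cyl.
- apply: (measurable_bigcup_seq nat (fun k => ~` [set w | unit_step X w k])) => k.
  by apply: measurableC; exact: measurable_unit_step.
- apply: (measurable_bigcup_seq nat (fun x => ~` word_set X fin_word x.+2)) => x.
  by apply: measurableC; exact: measurable_word_set.
Qed.

Lemma pr_bad_paths : pr P bad_paths = 0.
Proof.
have mcyl := measurable_cyl X Xmeas [:: 0%N].
have m1 : measurable (~` cyl X [:: 0%N]) by exact: measurableC.
have m2 : measurable [set w | exists k, ~ unit_step X w k].
  apply: (measurable_bigcup_seq nat (fun k => ~` [set w | unit_step X w k])) => k.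
  by apply: measurableC; exact: measurable_unit_step.
have m3 : measurable [set w | exists x, ~ word_set X fin_word x.+2 w].
  apply: (measurable_bigcup_seq nat (fun x => ~` word_set X fin_word x.+2)) => x.
  by apply: measurableC; exact: measurable_word_set.
have prC A : measurable A -> pr P A = 1 -> pr P (~` A) = 0.
  by move=> mA h; rewrite -setTD prDI// setTI pr_setT h subrr.
have e1 : pr P (~` cyl X [:: 0%N]) = 0.
  by apply: prC => //; rewrite (pr_cyl P X HX) /= mulr1.
have e3 : pr P [set w | exists x, ~ word_set X fin_word x.+2 w] = 0.
  apply: (pr_null_countable nat (fun x => ~` word_set X fin_word x.+2)) => x.
    by apply: measurableC; exact: measurable_word_set.
  by apply: prC; [exact: measurable_word_set|exact: pr_fin_word].
apply/eqP; rewrite eq_le pr_ge0 andbT.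
have := pr_U_le P _ _ (measurableU _ _ m1 m2) m3.
have := pr_U_le P _ _ m1 m2; have := pr_not_unit_step.
by rewrite /bad_paths => *; lra.
Qed.

Lemma good_path w x : ~ bad_paths w -> (2 <= x)%N ->
  [/\ X 0 w = 0%N, forall k, unit_step X w k &
      exists2 v, last false v & word_event X x v w].
Proof.
move=> hw x2; split.
- apply: contrapT => h; apply: hw; left; left => hc; apply: h.
  exact: (hc 0%N isT).
- by move=> k; apply: contrapT => h; apply: hw; left; right; exists k.
- apply: contrapT => h; apply: hw; right; exists x.-2 => hx; apply: h.
  by move: hx; rewrite (_ : x.-2.+2 = x) //; lia.
Qed.

Lemma event_word_set (Z : nat -> set T) (phi : pred (seq bool)) :
  (forall x w v, (2 <= x)%N -> ~ bad_paths w -> last false v ->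
     word_event X x v w -> Z x w <-> phi v) ->
  (forall v, phi v -> last false v) ->
  forall x w, (2 <= x)%N -> ~ bad_paths w -> Z x w <-> word_set X phi x w.
Proof.
move=> hZ hphi x w x2 hw; have [_ _ [v lv hv]] := good_path _ _ hw x2.
have e := hZ x w v x2 hw lv hv; split => [/e pv|[u pu hu]]; first by exists v.
by apply/e; rewrite (word_event_uniq _ _ _ _ _ hv hu).
Qed.

End AlmostSure.

Theorem theorem2 (R : realType) (d : measure_display) (T : measurableType d)
  (P : probability T R) (X : nat -> T -> nat)
  (Xmeas : forall k x, measurable [set w | X k w = x])
  (HX : is_markov_chain_from0 P X (trans pseq))
  (a b : nat) (hb : (1 <= b)%N) (hab : (b <= a)%N) :
  [/\ conv_in_dist P
        (fun n w => count_in (fun x => local_time_eq X w x a /\ up_time_eq X w x b) n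
                    / ((2:R) ^- a * 'C(a.-1, b.-1)%:R * ln n%:R))
        exp1_cdf,
      conv_in_dist P
        (fun n w => count_in (fun x => up_time_eq X w x a) n / ln n%:R)
        exp1_cdf
    & conv_in_dist P
        (fun n w => count_in (fun x => weak_cutpoint X w x) n / (2 * ln n%:R))
        exp1_cdf].
Proof.
have mN := measurable_bad_paths X Xmeas; have N0 := pr_bad_paths P X Xmeas HX.
have conv phi c Z := word_count_conv P X Xmeas HX phi c Z (bad_paths X).
(* Passing to successors turns ['C(a.-1, b.-1)] into the number of words of length [a.+1] with
   [b.+1] ups, the last letter being up. *)
case: b hb hab => // b _; case: a => // a hab; split.
- apply: (conv (sized_up_word a.+1 b.+1) (2 ^- a.+1 * 'C(a, b)%:R)
    (fun x => [set w | local_time_eq X w x a.+1 /\ up_time_eq X w x b.+1])) => //.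
  + by move=> v /andP[_ /andP[]].
  + by rewrite mulr_gt0 ?invr_gt0 ?exprn_gt0// ltr0n bin_gt0.
  + exact: sized_up_word_mass_cvg.
  + move=> x; apply: measurableI; first exact: measurable_local_time.
    exact: measurable_up_time.
  + apply: event_word_set => [x w v x2 hw lv hv|v /andP[_ /andP[]]//].
    rewrite /= (local_time_eqE _ _ _ _ hv) (up_time_eqE _ _ _ _ hv).
    rewrite /sized_up_word /up_word lv andbT.
    by split => [[-> ->]|/andP[/eqP -> /eqP ->]]; rewrite ?eqxx.
(* The total mass is [1], since fair tosses almost surely produce any given number of heads; the
   factor gives the normalisation the shape [c * ln n]. *)
- under eq_fun do under eq_fun do rewrite -[ln _]mul1r.
  apply: (conv (up_word a.+1) 1 (fun x => [set w | up_time_eq X w x a.+1])) => //.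
  + by move=> v /andP[].
  + exact: up_word_mass_cvg.
  + by move=> x; exact: measurable_up_time.
  + apply: event_word_set => [x w v x2 hw lv hv|v /andP[]//].
    rewrite /= (up_time_eqE _ _ _ _ hv) /up_word lv andbT.
    by split => [->|/eqP].
- apply: (conv downs_then_ups 2 (fun x => [set w | weak_cutpoint X w x])) => //.
  + exact: downs_then_ups_last.
  + exact: downs_then_ups_mass_cvg.
  + by move=> x; exact: measurable_weak_cutpoint.
  + apply: event_word_set; last exact: downs_then_ups_last.
    move=> x w v x2 hw lv hv; have [X0 steps _] := good_path _ _ _ hw x2.
    exact: weak_cutpointE.
Qed.
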